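(* Let $n\geq 2$ be an integer and let $p>n$ be real. If $\Omega\subset\mathbb{R}^n$ is nonempty, bounded, open, and $C^1$, and $$\lambda_p(\Omega)<\lambda_p(\mathbb{R}^n_+),$$ where $\mathbb{R}^n_+=\{x\in\mathbb{R}^n:x_n>0\}$, then $\Omega$ has an extremal.
   Context: $\mathcal{D}^{1,p}(\mathbb{R}^n)=\{u\in L^1_{\rm loc}(\mathbb{R}^n): \text{all weak partial derivatives } u_{x_i}\in L^p(\mathbb{R}^n)\}$; since $p>n$, each $u$ is identified with its Hölder continuous representative. For a nonempty open $\Omega\subsetneq\mathbb{R}^n$, $\mathcal{D}^{1,p}_0(\Omega)=\{u\in\mathcal{D}^{1,p}(\mathbb{R}^n): u(x)=0 \text{ for all } x\notin\Omega\}$, with norm $\|Du\|_p$, and $d_\Omega(x)=\inf_{y\in\Omega^c}|x-y|$. For $u\in\mathcal{D}^{1,p}_0(\Omega)\setminus\{0\}$, $\mathcal{R}_p(\Omega,u)=\bigl\|u/d_\Omega^{1-n/p}\bigr\|_\infty^{-p}\,\|Du\|_p^p$ (the supremum norm is taken over $\Omega$), and $\lambda_p(\Omega)=\inf_{u\in\mathcal{D}^{1,p}_0(\Omega)\setminus\{0\}}\mathcal{R}_p(\Omega,u)$. An extremal for $\Omega$ is a $u\in\mathcal{D}^{1,p}_0(\Omega)\setminus\{0\}$ with $\mathcal{R}_p(\Omega,u)=\lambda_p(\Omega)$. $\Omega$ is $C^1$ if its boundary is $C^1$-regular: near each boundary point, after a rigid motion, $\Omega$ coincides with the region above the graph of a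 $C^1$ function of $n-1$ variables. *)

(* Defs.v *)
From HB Require Import structures.
From mathcomp Require Import all_boot all_order all_algebra.
From mathcomp Require Import all_classical all_reals all_analysis.

Set Implicit Arguments.
Unset Strict Implicit.
Unset Printing Implicit Defensive.

Import Order.TTheory GRing.Theory Num.Theory.
Import numFieldNormedType.Exports.

Local Open Scope classical_set_scope.
Local Open Scope ring_scope.

(** * Lebesgue measure on [R^n] *)

Definition rV_display : measure_display.
Proof. exact: measure_tuple_display default_measure_display. Qed.

Section measurable_rV.
Variables (R : realType) (n : nat).

Let coors : 'I_n -> 'rV[R]_n -> R := fun i x => x 0 i.

Let rV_set0 : g_sigma_preimage coors set0.
Proof. exact: sigma_algebra0. Qed.

Let rV_setC A : g_sigma_preimage coors A -> g_sigma_preimage coors (~` A).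
Proof. exact: sigma_algebraC. Qed.

Let rV_bigcup (F : (set 'rV[R]_n)^nat) :
  (forall i, g_sigma_preimage coors (F i)) ->
  g_sigma_preimage coors (\bigcup_i (F i)).
Proof. exact: sigma_algebra_bigcup. Qed.

(* The sigma-algebra generated by the coordinates; as [R] is second countable,
   it is the Borel sigma-algebra of ['rV[R]_n]. *)
HB.instance Definition _ := @isMeasurable.Build rV_display
  'rV[R]_n (g_sigma_preimage coors) rV_set0 rV_setC rV_bigcup.

Lemma measurable_coord (i : 'I_n) :
  measurable_fun [set: 'rV[R]_n] (fun x : 'rV[R]_n => x 0 i).
Proof.
move=> _ Y mY; rewrite setTI; apply: sub_sigma_algebra => /=.
rewrite -bigcup_seq/=; exists i => /=; first by rewrite mem_index_enum.
by exists Y => //; rewrite setTI.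
Qed.

Lemma measurable_fun_rV d (T : measurableType d) (f : T -> 'rV[R]_n) :
  (forall i, measurable_fun [set: T] (fun t => f t 0 i)) ->
  measurable_fun [set: T] f.
Proof.
move=> mf.
suff sub : g_sigma_preimage (fun i => coors i \o f) `<=` measurable.
  move=> _ A mA; apply: sub.
  by rewrite g_sigma_preimage_comp; exists A.
apply: smallest_sub; first exact: sigma_algebra_measurable.
move=> A; rewrite -bigcup_seq => -[i _] [B mB <-].
exact: mf.
Qed.

End measurable_rV.

Section lebesgue_rV.
Variable R : realType.

Definition consrV n (xy : R * 'rV[R]_n) : 'rV[R]_n.+1 :=
  \row_i oapp (xy.2 0) xy.1 (unlift ord0 i).

Lemma measurable_consrV n : measurable_fun setT (@consrV n).
Proof.
apply: measurable_fun_rV => i; rewrite /consrV.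
under eq_fun do rewrite mxE.
case: unliftP => [j _|_] /=; last exact: measurable_fst.
exact: (measurableT_comp (@measurable_coord R n j)).
Qed.

Section cons_measure.
Variables (n : nat) (mu : {sigma_finite_measure set 'rV[R]_n -> \bar R}).
Local Open Scope ereal_scope.

Definition lebesgue_cons : set 'rV[R]_n.+1 -> \bar R :=
  pushforward (lebesgue_measure \x mu) (@consrV n).

Let mcons (A : set 'rV[R]_n.+1) :
  measurable A -> measurable (@consrV n @^-1` A).
Proof.
by move=> mA; rewrite -[X in measurable X]setTI; exact: measurable_consrV.
Qed.

Let lebesgue_cons0 : lebesgue_cons set0 = 0.
Proof. by rewrite /lebesgue_cons /pushforward preimage_set0 measure0. Qed.

Let lebesgue_cons_ge0 A : 0 <= lebesgue_cons A.
Proof. by rewrite /lebesgue_cons /pushforward; exact: measure_ge0. Qed.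

Let lebesgue_cons_sigma_additive : semi_sigma_additive lebesgue_cons.
Proof.
move=> F mF tF mUF; rewrite /lebesgue_cons /pushforward preimage_bigcup.
apply: measure_semi_sigma_additive.
- by move=> k; exact: mcons.
- apply/trivIsetP => /= i j _ _ ij; rewrite -preimage_setI.
  by move/trivIsetP : tF => /(_ _ _ _ _ ij) ->//; rewrite preimage_set0.
- by rewrite -preimage_bigcup; exact: mcons.
Qed.

HB.instance Definition _ := isMeasure.Build _ _ _ lebesgue_cons
  lebesgue_cons0 lebesgue_cons_ge0 lebesgue_cons_sigma_additive.

Let unconsrV (x : 'rV[R]_n.+1) : R * 'rV[R]_n :=
  (x 0%R ord0, \row_j x 0%R (lift ord0 j)).

Let consrVK : cancel (@consrV n) unconsrV.
Proof.
move=> [a y]; rewrite /unconsrV /consrV mxE unlift_none /=; congr pair.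
by apply/rowP => j; rewrite !mxE liftK.
Qed.

Let measurable_unconsrV : measurable_fun setT unconsrV.
Proof.
apply/measurable_fun_pair; first exact: measurable_coord.
apply: measurable_fun_rV => i; under eq_fun do rewrite mxE.
exact: measurable_coord.
Qed.

Let lebesgue_cons_sigma_finite : sigma_finite setT lebesgue_cons.
Proof.
have /sigma_finiteP[F [TF ndF Foo]] := sigma_finiteT (@lebesgue_measure R).
have /sigma_finiteP[G [TG ndG Goo]] := sigma_finiteT mu.
exists (fun k => unconsrV @^-1` (F k `*` G k)).
  rewrite -preimage_bigcup (_ : \bigcup_k _ = setT) ?preimage_setT//.
  apply/seteqP; split=> // -[x y] _.
  have [k _ Fkx] : (\bigcup_k F k) x by rewrite -TF.
  have [l _ Gly] : (\bigcup_l G l) y by rewrite -TG.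
  exists (maxn k l) => //; split => /=.
  - by move: x Fkx; exact/subsetPset/ndF/leq_maxl.
  - by move: y Gly; exact/subsetPset/ndG/leq_maxr.
move=> k; have [? ?] := Foo k; have [? ?] := Goo k; split.
  rewrite -[X in measurable X]setTI; apply: measurable_unconsrV => //.
  exact: measurableX.
rewrite /lebesgue_cons /pushforward -comp_preimage.
rewrite (_ : unconsrV \o _ = id) ?preimage_id.
  by rewrite product_measure1E// lte_mul_pinfty// ge0_fin_numE.
by apply/funext => ?; exact: consrVK.
Qed.

HB.instance Definition _ := Measure_isSigmaFinite.Build _ _ _ lebesgue_cons
  lebesgue_cons_sigma_finite.

End cons_measure.

Fixpoint lebesgue_rV n : {sigma_finite_measure set 'rV[R]_n -> \bar R} :=
  match n with
  | 0%N => \d_(0 : 'rV[R]_0)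
  | m.+1 => lebesgue_cons (lebesgue_rV m)
  end.

Lemma lebesgue_rV_box n (A : 'I_n -> set R) : (forall i, measurable (A i)) ->
  lebesgue_rV n [set x | forall i, A i (x 0 i)] =
  (\prod_(i < n) lebesgue_measure (A i))%E.
Proof.
elim: n A => [|n IH] A mA.
  rewrite big_ord0 /= diracE mem_set// => -[].
  by [].
rewrite big_ord_recl -IH// /= /lebesgue_cons /pushforward.
set B := [set y : 'rV[R]_n | forall i, A (lift ord0 i) (y 0 i)].
have mB : measurable B.
  rewrite (_ : B = \bigcap_(i in [set: 'I_n])
      ((fun y : 'rV[R]_n => y 0 i) @^-1` A (lift ord0 i))).
    apply: fin_bigcap_measurable => // i _.
    by rewrite -[X in measurable X]setTI; exact: measurable_coord.
  by apply/seteqP; split=> y yA i; [move=> _; exact: yA|exact: (yA i I)].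
rewrite (_ : _ @^-1` _ = A ord0 `*` B).
  by rewrite product_measure1E//; exact: mA.
apply/seteqP; split=> -[a y] /=.
  move=> yA; split; first by have := yA ord0; rewrite mxE unlift_none.
  by move=> i; have := yA (lift ord0 i); rewrite mxE liftK.
move=> [Aa Ay] i; rewrite mxE.
by case: (unliftP ord0 i) => [j ->|->] /=.
Qed.

End lebesgue_rV.

(** * Weak derivatives and [D^{1,p}] *)

Section sobolev.
Variables (R : realType) (n : nat).
Implicit Types (u g f : 'rV[R]_n -> R) (p : R) (Omega : set 'rV[R]_n).

Local Notation mu := (lebesgue_rV R n).

(* The canonical norm of ['rV[R]_n] is the max-norm. *)
Definition enorm (x : 'rV[R]_n) : R := Num.sqrt (\sum_(i < n) x 0 i ^+ 2).

Definition partial (i : 'I_n) f : 'rV[R]_n -> R := 'D_(delta_mx 0 i) f.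

Definition C1 f :=
  continuous f /\
  forall i, (forall x, derivable f x (delta_mx 0 i)) /\
            continuous (partial i f).

Definition smooth f := forall s : seq 'I_n, C1 (foldr partial f s).

Definition test_function f :=
  smooth f /\ compact (closure [set x | f x != 0]).

Definition loc_integrable f :=
  measurable_fun setT f /\
  forall K, compact K -> (\int[mu]_(x in K) `|f x|%:E < +oo)%E.

Definition weak_partial u (i : 'I_n) g :=
  loc_integrable g /\
  forall f, test_function f ->
    (\int[mu]_x (u x * partial i f x)%:E = - \int[mu]_x (g x * f x)%:E)%E.

Definition weak_gradient u (G : 'rV[R]_n -> 'rV[R]_n) :=
  forall i, weak_partial u i (fun x => G x 0 i).

(* Some weak gradient of [u]; it is unique almost everywhere if it exists. *)
Definition gradient u : 'rV[R]_n -> 'rV[R]_n := xget (cst 0) (weak_gradient u).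

(* [Lfun mu p%:E] consists of the Borel functions with finite [L^p] norm. *)
Definition D1p p u :=
  loc_integrable u /\
  exists2 G, weak_gradient u G & forall i, (fun x => G x 0 i) \in Lfun mu p%:E.

(* For [p > n] an almost everywhere class in [D^{1,p}] contains exactly one
   continuous function, its Hoelder representative: the class is encoded by
   that function. *)
Definition D1p0 p Omega u :=
  [/\ D1p p u, continuous u & forall x, ~ Omega x -> u x = 0].

Definition dist_compl Omega (x : 'rV[R]_n) : R :=
  inf [set enorm (x - y) | y in ~` Omega].

Definition hardy_norm p Omega u : \bar R :=
  ereal_sup
    [set `|u x / dist_compl Omega x `^ (1 - n%:R / p)|%:E | x in Omega].

Definition grad_norm p u : \bar R :=
  Lnorm mu p%:E (fun x => (enorm (gradient u x))%:E).

Definition rayleigh p Omega u : \bar R :=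
  ((hardy_norm p Omega u `^ p)^-1 * grad_norm p u `^ p)%E.

Definition D1p0_neq0 p Omega : set ('rV[R]_n -> R) :=
  [set u | D1p0 p Omega u /\ u <> cst 0].

Definition lambda p Omega : \bar R :=
  ereal_inf [set rayleigh p Omega u | u in D1p0_neq0 p Omega].

Definition extremal p Omega u :=
  D1p0_neq0 p Omega u /\ rayleigh p Omega u = lambda p Omega.

End sobolev.

(** * The half-space and [C^1] domains *)

(* [l] is the index of the last coordinate whenever [l.+1 = n]. *)
Definition half_space (R : realType) (n : nat) : set 'rV[R]_n :=
  [set x | exists2 l : 'I_n, l.+1 = n & 0 < x 0 l].
Arguments half_space : clear implicits.

Definition boundary (T : topologicalType) (A : set T) : set T :=
  closure A `\` A°.

(* [y = x *m Q + b] are the coordinates of [x] after the rigid motion, and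
   [col' l y] drops the last one of them. *)
Definition C1_domain (R : realType) (n : nat) (Omega : set 'rV[R]_n) :=
  forall x0, boundary Omega x0 ->
  exists (r : R) (Q : 'M[R]_n) (b : 'rV[R]_n) (h : 'rV[R]_n.-1 -> R) (l : 'I_n),
  [/\ 0 < r, Q *m Q^T = 1%:M, C1 h, l.+1 = n &
      forall x, enorm (x - x0) < r ->
        Omega x <-> h (col' l (x *m Q + b)) < (x *m Q + b) 0 l].
Arguments C1_domain {R n} Omega.

(* Main.v *)
Require Import Defs.
From HB Require Import structures.
From mathcomp Require Import all_boot all_order all_algebra.
From mathcomp Require Import all_classical all_reals all_analysis.
From mathcomp Require Import measurable_realfun ring lra.

(** By scaling, [lambda p Omega] is the infimum over [x] in [Omega] of
    [d(x)^(p-n)] times the least energy [int |Du|^p] of a function [u] that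
    vanishes off [Omega] and has [u(x) = 1].  Take almost minimal pairs
    [(x_k, u_k)] with [x_k] converging to some [x0].

    If [x0] is in [Omega], Morrey's inequality gives [u_k(x0) --> 1], and the
    least energy under the constraint [u(x0) = 1] is attained by an extremal.

    If [x0] is on the boundary, the functions [u_k(x_k + d(x_k) eta)] have
    energy tending to [lambda p Omega], equal [1] at [eta = 0] and, [Omega]
    being [C^1], vanish asymptotically on a half-space [eta . nu <= -1].  A
    limit shows that [lambda] of the half-space is at most [lambda p Omega],
    which is excluded.

    Both limits are obtained without weak compactness: in a decreasing sequence
    of convex constraint sets, Clarkson's inequality makes almost minimisers
    Cauchy in energy, and Morrey's inequality gives pointwise convergence. *)

Set Implicit Arguments.
Unset Strict Implicit.
Unset Printing Implicit Defensive.

Import Order.TTheory GRing.Theory Num.Theory.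
Import numFieldNormedType.Exports.

Local Open Scope classical_set_scope.
Local Open Scope ring_scope.

(** * Vectors and boxes *)

Section row_vectors.
Variables (R : realType) (n : nat).
Implicit Types (x y : 'rV[R]_n) (r : R).

Lemma norm_coord_le x i : `|x 0 i| <= `|x|.
Proof.
rewrite [leRHS]mx_normrE.
exact: (le_bigmax_cond _ (fun ij => `|x ij.1 ij.2|) (j := (0, i))).
Qed.

Lemma rV_norm_le x r : 0 <= r -> (forall i, `|x 0 i| <= r) -> `|x| <= r.
Proof.
move=> r0 xr; rewrite [leLHS]mx_normrE; apply: bigmax_le => // -[i j] _ /=.
by rewrite (ord1 i).
Qed.

Lemma rV_norm_lt x r : 0 < r -> (forall i, `|x 0 i| < r) -> `|x| < r.
Proof.
move=> r0 xr; rewrite [ltLHS]mx_normrE; apply: bigmax_lt => // -[i j] _ /=.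
by rewrite (ord1 i).
Qed.

Lemma exists_coord_gt x r : 0 <= r -> r < `|x| -> exists i, r < `|x 0 i|.
Proof.
move=> r0 rx; apply: contrapT => /forallNP xr; move: rx; rewrite ltNge => /negP.
by apply; apply: rV_norm_le => // i; rewrite leNgt; apply/negP; exact: xr.
Qed.

Lemma cvg_rV (T : Type) (F : set_system T) {FF : Filter F}
    (f : T -> 'rV[R]_n) x :
  (forall i, f t 0 i @[t --> F] --> x 0 i) -> f t @[t --> F] --> x.
Proof.
move=> fx A [P xP PA].
suff : \forall t \near F, forall i j, P i j (f t i j).
  by apply: filterS => t; exact: PA.
apply: filter_forall => i; apply: filter_forall => j.
by rewrite (ord1 i); apply: (fx j); have := xP i j; rewrite (ord1 i).
Qed.

Lemma continuous_near (f : 'rV[R]_n -> R) x (e : R) : continuous f -> 0 < e ->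
  \forall y \near x, `|f x - f y| < e.
Proof.
move=> cf e0; have /cvgrPdist_lt/(_ e e0) fe := cf x.
exact: fe.
Qed.

Lemma holder_continuous (f : 'rV[R]_n -> R) (C al : R) : 0 < al ->
  (forall x y, `|f x - f y| <= C * `|x - y| `^ al) -> continuous f.
Proof.
move=> al0 fC x; apply/(@cvgrPdist_le _ _ _ (nbhs (x : 'rV[R]_n))) => e e0.
have C0 : 0 < `|C| + 1 by rewrite ltr_wpDl.
pose d := (e / (`|C| + 1)) `^ al^-1.
have d0 : 0 < d by apply: powR_gt0; exact: divr_gt0.
have := nbhsx_ballx x _ d0; apply: filterS => y.
rewrite mx_norm_ball /ball_/= => xy; apply: le_trans (fC x y) _.
apply: (@le_trans _ _ ((`|C| + 1) * d `^ al)).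
  apply: le_trans (_ : (`|C| + 1) * `|x - y| `^ al <= _).
    by rewrite ler_wpM2r ?powR_ge0// ler_wpDr// ler_norm.
  by rewrite ler_pM2l// ge0_ler_powR ?nnegrE// ltW.
rewrite -powRrM mulVf ?gt_eqF// powRr1; last exact/ltW/divr_gt0.
by rewrite mulrC divfK ?gt_eqF.
Qed.

End row_vectors.

Lemma norm_mulmx_le (R : realType) n m (x : 'rV[R]_n) (O : 'M[R]_(n, m)) :
  `|x *m O| <= n%:R * (`|x| * `|O|).
Proof.
apply: rV_norm_le => [|j]; first by rewrite !mulr_ge0.
rewrite mxE; apply: le_trans (ler_norm_sum _ _ _) _.
have -> : n%:R * (`|x| * `|O|) = \sum_(k < n) `|x| * `|O|.
  by rewrite sumr_const card_ord mulr_natl.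
apply: ler_sum => k _.
rewrite normrM ler_pM ?norm_coord_le// [leRHS]mx_normrE.
exact: (le_bigmax_cond _ (fun ij => `|O ij.1 ij.2|) (j := (k, j))).
Qed.

Section affine_maps.
Variables (R : realType) (n : nat).
Implicit Types (u : 'rV[R]_n -> R).

Lemma continuous_affine_map (s : R) (O : 'M[R]_n) (a : 'rV[R]_n) :
  continuous (fun x : 'rV[R]_n => s *: (x *m O) + a).
Proof.
move=> x; apply: (@cvg_rV _ _ _ (nbhs x) (nbhs_filter x)) => i.
rewrite [X in _ --> X]mxE [X in X + _]mxE mxE.
under eq_fun do rewrite !mxE.
apply: cvgD; last exact: cvg_cst.
apply: cvgM; first exact: cvg_cst.
apply: (@cvg_big _ _ +%R) => [|j _]; first exact: add_continuous.
by apply: cvgM; [exact: coord_continuous|exact: cvg_cst].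
Qed.

Lemma continuous_comp_affine (s : R) (O : 'M[R]_n) (a : 'rV[R]_n) u :
  continuous u -> continuous (fun x : 'rV[R]_n => u (s *: (x *m O) + a)).
Proof.
move=> cu x; apply: (@continuous_comp _ _ _ (fun x : 'rV[R]_n => _) u).
  exact: continuous_affine_map.
exact: cu.
Qed.

Lemma continuous_comp_homothety (s : R) (a : 'rV[R]_n) u :
  continuous u -> continuous (fun x : 'rV[R]_n => u (s *: x + a)).
Proof.
move=> cu; have := continuous_comp_affine (s := s) (O := 1%:M) (a := a) cu.
by under eq_fun do rewrite mulmx1.
Qed.

End affine_maps.

Section measurable_subsets.
Variables (R : realType) (n : nat).
Implicit Types (A : 'I_n -> set R) (K U : set 'rV[R]_n) (f : 'rV[R]_n -> R).

Definition box A : set 'rV[R]_n := [set x | forall i, A i (x 0 i)].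

Lemma measurable_box A : (forall i, measurable (A i)) -> measurable (box A).
Proof.
move=> mA; rewrite (_ : box A = \bigcap_(i in [set: 'I_n])
    ((fun x : 'rV[R]_n => x 0 i) @^-1` A i)).
  apply: fin_bigcap_measurable => // i _.
  by rewrite -[X in measurable X]setTI; exact: measurable_coord.
by apply/seteqP; split=> y yA i; [move=> _; exact: yA|exact: (yA i I)].
Qed.

(* An open set is the union of the balls it contains, among those with rational
   centre and radius [1 / (k + 1)]. *)
Lemma open_measurable_rV U : open U -> measurable U.
Proof.
move=> oU.
pose cell (kq : nat * 'rV[rat]_n) : set 'rV[R]_n :=
  box (fun i => `]ratr (kq.2 0 i) - kq.1.+1%:R^-1,
                  ratr (kq.2 0 i) + kq.1.+1%:R^-1[%classic).
rewrite (_ : U = \bigcup_kq (if `[< cell kq `<=` U >] then cell kq else set0)).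
  apply: countable_bigcupT_measurable; first exact: countableP.
  by move=> kq; case: ifP => // _; apply: measurable_box => i.
apply/seteqP; split => x; last first.
  by move=> [kq _]; case: ifPn => // /asboolP; apply.
move=> Ux; have /nbhs_ballP[e /= e0 xeU] : nbhs x U by exact: open_nbhs_nbhs.
have ke : 2 / e < (Num.truncn (2 / e)).+1%:R by exact: truncnS_gt.
set k := Num.truncn _ in ke; set r : R := k.+1%:R^-1.
have [r0 {}ke] : 0 < r /\ 2 * r < e.
  by split; [rewrite invr_gt0|rewrite ltr_pdivrMr// mulrC -ltr_pdivrMr].
have /choice[q qx] i : exists q : rat, ratr q \in `]x 0 i - r, x 0 i + r[.
  by apply: rat_in_itvoo; rewrite ltrD2l gtrN.
have cellP y : cell (k, \row_i q i) y <->
    forall i, ratr (q i) - r < y 0 i < ratr (q i) + r.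
  by split=> yq i; have := yq i; rewrite /= mxE in_itv.
clearbody r; exists (k, \row_i q i) => //; rewrite ifT.
  by apply/cellP => i; have := qx i; rewrite in_itv/=; lra.
apply/asboolP => y /cellP yq; apply: xeU; split=> // i j.
by rewrite (ord1 i) /ball/= ltr_norml; have := qx j; have := yq j; rewrite in_itv/=; lra.
Qed.

Lemma closed_measurable_rV K : closed K -> measurable K.
Proof.
move=> cK; rewrite -[K]setCK; apply: measurableC.
by apply: open_measurable_rV; exact: closed_openC.
Qed.

Lemma compact_measurable_rV K : compact K -> measurable K.
Proof.
by move=> cK; apply: closed_measurable_rV; apply: compact_closed.
Qed.

Lemma continuous_measurable_rV f : continuous f -> measurable_fun setT f.
Proof.
move=> cf; apply: (measurability _ (RGenOpens.measurableE R)) => _ [_ [a [b ->] <-]].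
by rewrite setTI; apply: open_measurable_rV; apply: open_comp.
Qed.

End measurable_subsets.

Section half_open_boxes.
Variables (R : realType) (n : nat).
Implicit Types (a b : 'I_n -> R) (m : {measure set 'rV[R]_n -> \bar R}).

Definition ocbox a b : set 'rV[R]_n := box (fun i => `]a i, b i]%classic).

Lemma measurable_ocbox a b : measurable (ocbox a b).
Proof. by apply: measurable_box => i. Qed.

Lemma lebesgue_ocbox a b : (lebesgue_rV R n (ocbox a b) =
  \prod_(i < n) (@lebesgue_measure R `]a i, b i]%classic))%E.
Proof. exact: (@lebesgue_rV_box R n (fun i => `]a i, b i]%classic)). Qed.

Lemma lebesgue_ocbox_lty a b : (lebesgue_rV R n (ocbox a b) < +oo)%E.
Proof.
rewrite lebesgue_ocbox -ge0_fin_numE; last by apply: prode_ge0.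
by apply: prode_fin_num => i _; rewrite lebesgue_measure_itv/=; case: ifP.
Qed.

Lemma ocboxI a b a' b' : ocbox a b `&` ocbox a' b' =
  ocbox (fun i => Num.max (a i) (a' i)) (fun i => Num.min (b i) (b' i)).
Proof.
apply/seteqP; split => x /=; last first.
  by move=> xI; split=> i; have := xI i; rewrite /= !in_itv/= gt_max le_min; lra.
move=> [xab xab'] i; have := xab i; have := xab' i.
by rewrite /= !in_itv/= gt_max le_min => /andP[-> ->] /andP[-> ->].
Qed.

Lemma bigcup_ocbox : \bigcup_N ocbox (fun=> - N%:R) (fun=> N%:R) = setT.
Proof.
apply/seteqP; split=> // x _; exists (Num.truncn `|x|).+1 => // j /=.
have := le_lt_trans (norm_coord_le x j) (truncnS_gt `|x|).
by rewrite ltr_norml /= in_itv/= => /andP[-> /ltW ->].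
Qed.

Lemma ocbox_generates :
  measurable = <<s [set ocbox ab.1 ab.2 | ab in [set: ('I_n -> R) * ('I_n -> R)]] >>.
Proof.
set G := image _ _; apply/seteqP; split; last first.
  apply: smallest_sub; first exact: sigma_algebra_measurable.
  by move=> _ [ab _ <-]; exact: measurable_ocbox.
apply: smallest_sub; first exact: smallest_sigma_algebra.
move=> C; rewrite -bigcup_seq => -[i _] [D mD <-]; rewrite setTI.
have := sigma_algebra_image (fun x : 'rV[R]_n => x 0 i)
  (smallest_sigma_algebra setT G : sigma_algebra setT <<s G >>).
move=> sI; suff : image_set_system setT (fun x : 'rV[R]_n => x 0 i) <<s G >> D.
  by rewrite /image_set_system/= setTI.
move: D mD; apply: smallest_sub; first exact: sI.
move=> _ [[a b] _ <-] /=; rewrite /image_set_system/= setTI.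
pose lo (N : nat) j := if j == i then a else - N%:R : R.
pose hi (N : nat) j := if j == i then b else N%:R : R.
rewrite (_ : _ @^-1` _ = \bigcup_N ocbox (lo N) (hi N)).
  apply: sigma_algebra_bigcup => N.
  by apply: sub_sigma_algebra; exists (lo N, hi N).
apply/seteqP; split => x /=; last by move=> [N _ /(_ i)]; rewrite /lo /hi eqxx.
move=> xab; have [N _ xN] : (\bigcup_N ocbox (fun=> - N%:R) (fun=> N%:R)) x.
  by rewrite bigcup_ocbox.
by exists N => // j; rewrite /lo /hi; have [->|_] := eqVneq j i; [|exact: xN].
Qed.

Lemma ocbox_measure_unique m m' :
  (forall a b, m (ocbox a b) = m' (ocbox a b)) ->
  (forall a b, m (ocbox a b) < +oo)%E ->
  forall A, measurable A -> m A = m' A.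
Proof.
move=> mm' moo; apply: (@measure_unique _ R _
  [set ocbox ab.1 ab.2 | ab in [set: ('I_n -> R) * ('I_n -> R)]]
  (fun N : nat => ocbox (fun=> - N%:R) (fun=> N%:R))) => //.
- exact: ocbox_generates.
- move=> _ _ [ab _ <-] [cd _ <-]; rewrite ocboxI.
  by exists (fun i => Num.max (ab.1 i) (cd.1 i), fun i => Num.min (ab.2 i) (cd.2 i)).
- by move=> N; exists ((fun=> - N%:R), (fun=> N%:R)).
- exact: bigcup_ocbox.
- by move=> _ [ab _ <-]; exact: mm'.
Qed.

End half_open_boxes.

(** * Changes of variables *)

Definition image_measure d1 d2 (T1 : measurableType d1) (T2 : measurableType d2)
    (R : realType) (m : {measure set T1 -> \bar R}) (f : T1 -> T2)
    (mf : measurable_fun setT f) : {measure set T2 -> \bar R} :=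
  measure_function_pushforward__canonical__measure_function_Measure m mf.

Lemma lebesgue_measure_preimage_affine (R : realType) (s a u v : R) : s != 0 ->
  (`|s|%:E * lebesgue_measure ((fun t => s * t + a)%R @^-1` `]u, v]) =
   lebesgue_measure (`]u, v] : set R))%E.
Proof.
move=> sn0; rewrite -[a](divfK sn0); set c := a / s.
have -> : (fun t : R => s * t + c * s) = (fun t => (t + c) * s).
  by apply/funext => t; ring.
have [s0|s0|s0] := ltgtP s 0; last by rewrite s0 eqxx in sn0.
- rewrite (_ : _ @^-1` _ = `[v / s - c, u / s - c[%classic); last first.
    apply/seteqP; split => t; rewrite /= !in_itv/= lerBlDr ltrBrDr;
    by rewrite ler_ndivrMr// ltr_ndivlMr// andbC.
  rewrite !lebesgue_measure_itv/= !lte_fin ltrD2r ltr_nM2r ?invr_lt0//.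
  case: ifP => _; last by rewrite mule0.
  by rewrite -!EFinB -EFinM ltr0_norm//; congr EFin; field.
- rewrite (_ : _ @^-1` _ = `]u / s - c, v / s - c]%classic); last first.
    apply/seteqP; split => t; rewrite /= !in_itv/= ltrBlDr lerBrDr;
    by rewrite ler_pdivlMr// ltr_pdivrMr.
  rewrite !lebesgue_measure_itv/= !lte_fin ltrD2r ltr_pM2r ?invr_gt0//.
  case: ifP => _; last by rewrite mule0.
  by rewrite -!EFinB -EFinM gtr0_norm//; congr EFin; field.
Qed.

Section homotheties.
Local Open Scope ereal_scope.
Variables (R : realType) (n : nat).
Local Notation mu := (lebesgue_rV R n).
Implicit Types (f : 'rV[R]_n -> \bar R) (s : R) (a : 'rV[R]_n).

Lemma measurable_affine_map s (O : 'M[R]_n) a :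
  measurable_fun setT (fun x : 'rV[R]_n => s *: (x *m O) + a)%R.
Proof.
apply: measurable_fun_rV => i; apply: continuous_measurable_rV.
have := @continuous_comp_affine R n s O a _ (@coord_continuous _ 1 n 0%R i).
exact.
Qed.

Lemma measurable_homothety s a :
  measurable_fun setT (fun x : 'rV[R]_n => s *: x + a)%R.
Proof.
by have := measurable_affine_map s 1%:M a; under eq_fun do rewrite mulmx1.
Qed.

Lemma lebesgue_homothety s a A : s != 0%R -> measurable A ->
  (`|s| ^+ n)%:E * mu ((fun x => s *: x + a)%R @^-1` A) = mu A.
Proof.
move=> s0; pose m : {measure set 'rV[R]_n -> \bar R} :=
  mscale (NngNum (exprn_ge0 n (normr_ge0 s)))
         (image_measure mu (measurable_homothety s a)).
move=> mA; apply/esym; rewrite -[RHS]/(m A).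
apply: ocbox_measure_unique mA => b c; last exact: lebesgue_ocbox_lty.
rewrite [LHS]lebesgue_ocbox.
rewrite -[RHS]/((`|s| ^+ n)%:E * mu ((fun x => s *: x + a)%R @^-1` ocbox b c)).
rewrite (_ : _ @^-1` _ = box (fun i =>
    (fun t => s * t + a 0 i)%R @^-1` `]b i, c i]%classic)); last first.
  by apply/seteqP; split => x /= + i => /(_ i); rewrite !mxE.
rewrite lebesgue_rV_box; last first.
  move=> i; rewrite -[X in measurable X]setTI.
  have : measurable_fun setT (fun t : R => s * t + a 0 i)%R.
    by apply: measurable_funD => //; exact: measurable_funM.
  exact.
have -> : (`|s| ^+ n)%:E = \prod_(i < n) `|s|%:E.
  by rewrite prodEFin prodr_const card_ord.
rewrite -big_split/=; apply: eq_bigr => i _.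
exact/esym/lebesgue_measure_preimage_affine.
Qed.

Lemma ge0_integral_homothety s a f : s != 0%R ->
  measurable_fun setT f -> (forall x, 0 <= f x) ->
  (`|s| ^+ n)%:E * \int[mu]_x f (s *: x + a)%R = \int[mu]_x f x.
Proof.
move=> s0 mf f0.
transitivity (\int[mscale (NngNum (exprn_ge0 n (normr_ge0 s)))
    (image_measure mu (measurable_homothety s a))]_x f x).
  rewrite ge0_integral_mscale//= ge0_integral_pushforward//.
  exact: measurable_homothety.
by apply: eq_measure_integral => A mA _; exact: lebesgue_homothety.
Qed.

Lemma ge0_integral_translate a f :
  measurable_fun setT f -> (forall x, 0 <= f x) ->
  \int[mu]_x f (x + a)%R = \int[mu]_x f x.
Proof.
move=> mf f0; rewrite -[RHS](ge0_integral_homothety a (oner_neq0 R))// normr1 expr1n mul1e.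
by apply: eq_integral => x _; rewrite scale1r.
Qed.

Lemma ge0_integral_reflect a f :
  measurable_fun setT f -> (forall x, 0 <= f x) ->
  \int[mu]_x f (a - x)%R = \int[mu]_x f x.
Proof.
move=> mf f0; have N1 : (-1 : R)%R != 0%R by rewrite oppr_eq0 oner_eq0.
rewrite -[RHS](ge0_integral_homothety a N1)// normrN1 expr1n mul1e.
by apply: eq_integral => x _; rewrite scaleN1r addrC.
Qed.

End homotheties.

Section finite_positive_sets.
Variables (R : realType) (n : nat).
Local Notation mu := (lebesgue_rV R n).

Definition normball (L : R) : set 'rV[R]_n := [set x | `|x| <= L].

Lemma closed_normball L : closed (normball L).
Proof.
rewrite (_ : normball L = (fun x : 'rV[R]_n => `|x|) @^-1` [set t | t <= L])//.
apply: (@preimage_closed _ _ (fun x : 'rV[R]_n => `|x|)); last exact: closed_le.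
by move=> x _; exact: norm_continuous.
Qed.

Lemma measurable_normball L : measurable (normball L).
Proof. by apply: closed_measurable_rV; exact: closed_normball. Qed.

Lemma normball_lty L : (mu (normball L) < +oo)%E.
Proof.
pose a := `|L| + 1.
apply: le_lt_trans (lebesgue_ocbox_lty (fun _ : 'I_n => - a) (fun=> a)).
apply: le_measure; rewrite ?inE; [exact: measurable_normball|exact: measurable_ocbox|].
move=> x xL i; have := le_trans (norm_coord_le x i) xL; have := ler_norm L.
by rewrite /a ler_norml /= in_itv/=; lra.
Qed.

Lemma compact_normball L : compact (normball L).
Proof.
apply: bounded_closed_compact; last exact: closed_normball.
by exists L; split => [|M LM x /= xL]; [exact: num_real|exact/ltW/le_lt_trans/LM].
Qed.

Lemma compact_sub_normball K : compact K -> exists L, K `<=` normball L.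
Proof. by move=> /compact_bounded/pinfty_ex_gt0[L _ KL]; exists L. Qed.

Lemma open_lebesgue_gt0 U : open U -> U !=set0 -> (0 < mu U)%E.
Proof.
move=> oU [x Ux]; have /nbhs_ballP[e /= e0 xeU] : nbhs x U by exact: open_nbhs_nbhs.
pose d := e / 2; have d0 : 0 < d by rewrite divr_gt0.
pose Q := ocbox (fun i => x 0 i - d) (fun i => x 0 i + d).
apply: (@lt_le_trans _ _ (mu Q)).
  rewrite lebesgue_ocbox; under eq_bigr => i _.
    rewrite lebesgue_measure_itv/= lte_fin ifT; last lra.
    rewrite -EFinB; over.
  by rewrite prodEFin lte_fin prodr_gt0// => i _; lra.
apply: le_measure; rewrite ?inE.
- exact: measurable_ocbox.
- exact: open_measurable_rV.
move=> y Qy; apply: xeU; split=> // i j; rewrite (ord1 i) /ball/= ltr_norml.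
by have := Qy j; rewrite /= in_itv/=; move: (e0) (d0); rewrite /d; lra.
Qed.

End finite_positive_sets.

Section euclidean_norm.
Variables (R : realType) (n : nat).
Implicit Types x y : 'rV[R]_n.

Definition dotv x y : R := \sum_(i < n) x 0 i * y 0 i.

Lemma enorm_ge0 x : 0 <= enorm x.
Proof. exact: sqrtr_ge0. Qed.

Lemma sqr_enorm x : enorm x ^+ 2 = \sum_(i < n) x 0 i ^+ 2.
Proof. by rewrite sqr_sqrtr// sumr_ge0// => i _; exact: sqr_ge0. Qed.

Lemma enorm0 : enorm (0 : 'rV[R]_n) = 0.
Proof.
by rewrite /enorm big1 ?sqrtr0// => i _; rewrite mxE expr0n.
Qed.

Lemma enormZ (s : R) x : enorm (s *: x) = `|s| * enorm x.
Proof.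
rewrite /enorm (eq_bigr (fun i => s ^+ 2 * x 0 i ^+ 2)); last first.
  by move=> i _; rewrite mxE exprMn.
by rewrite -mulr_sumr sqrtrM ?sqr_ge0// sqrtr_sqr.
Qed.

Lemma enormN x : enorm (- x) = enorm x.
Proof. by rewrite -scaleN1r enormZ normrN1 mul1r. Qed.

Lemma dotvC x y : dotv x y = dotv y x.
Proof. by apply: eq_bigr => i _; rewrite mulrC. Qed.

Lemma dotvZl (s : R) x y : dotv (s *: x) y = s * dotv x y.
Proof. by rewrite mulr_sumr; apply: eq_bigr => i _; rewrite mxE mulrA. Qed.

Lemma dotvDl x x' y : dotv (x + x') y = dotv x y + dotv x' y.
Proof. by rewrite -big_split; apply: eq_bigr => i _; rewrite mxE mulrDl. Qed.

Lemma dotvNl x y : dotv (- x) y = - dotv x y.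
Proof. by rewrite -scaleN1r dotvZl mulN1r. Qed.

Lemma dotvZr (s : R) x y : dotv x (s *: y) = s * dotv x y.
Proof. by rewrite dotvC dotvZl dotvC. Qed.

Lemma dotvDr x y y' : dotv x (y + y') = dotv x y + dotv x y'.
Proof. by rewrite dotvC dotvDl !(dotvC x). Qed.

Lemma dotvNr x y : dotv x (- y) = - dotv x y.
Proof. by rewrite dotvC dotvNl dotvC. Qed.

Lemma dotvv x : dotv x x = enorm x ^+ 2.
Proof. by rewrite sqr_enorm; apply: eq_bigr. Qed.

Lemma enorm_eq0 x : enorm x = 0 -> x = 0.
Proof.
move=> x0; have := sqr_enorm x; rewrite x0 expr0n/= => /esym/eqP.
rewrite psumr_eq0; last by move=> i _; exact: sqr_ge0.
move=> /allP all0; apply/rowP => i; rewrite mxE; apply/eqP.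
by have := all0 i; rewrite mem_index_enum sqrf_eq0; apply.
Qed.

Lemma dotv_le x y : `|dotv x y| <= enorm x * enorm y.
Proof.
suff dotv_le_enorm x' : dotv x' y <= enorm x' * enorm y.
  rewrite ler_norml dotv_le_enorm andbT lerNl -dotvNl.
  by rewrite -[X in X * _]enormN; exact: dotv_le_enorm.
have [/enorm_eq0->|x0] := eqVneq (enorm x') 0.
  by rewrite enorm0 mul0r /dotv big1// => i _; rewrite mxE mul0r.
have [/enorm_eq0->|y0] := eqVneq (enorm y) 0.
  by rewrite enorm0 mulr0 /dotv big1// => i _; rewrite mxE mulr0.
have : 0 <= dotv (enorm y *: x' - enorm x' *: y) (enorm y *: x' - enorm x' *: y).
  by rewrite dotvv sqr_ge0.
rewrite !(dotvDl, dotvDr, dotvNl, dotvNr, dotvZl, dotvZr) !dotvv (dotvC y x').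
have ex : 0 < enorm x' by rewrite lt_def x0 enorm_ge0.
have ey : 0 < enorm y by rewrite lt_def y0 enorm_ge0.
move: (enorm x') (enorm y) ex ey (dotv x' y) => a b a0 b0 c expanded.
have : 0 <= (2 * a * b) * (a * b - c) by lra.
by rewrite pmulr_rge0 ?subr_ge0// !mulr_gt0.
Qed.

Lemma ler_enormD x y : enorm (x + y) <= enorm x + enorm y.
Proof.
rewrite -(@ler_pXn2r _ 2)// ?nnegrE ?addr_ge0 ?enorm_ge0//.
rewrite -dotvv !(dotvDl, dotvDr) !dotvv (dotvC y x).
have := le_trans (ler_norm _) (dotv_le x y); lra.
Qed.

Lemma ler_enorm_dist x y : `|enorm x - enorm y| <= enorm (x - y).
Proof.
have := ler_enormD (x - y) y; have := ler_enormD (y - x) x.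
rewrite !subrK -[in X in X -> _](opprB x y) enormN ler_norml.
by move=> *; apply/andP; split; lra.
Qed.

Lemma norm_coord_le_enorm x i : `|x 0 i| <= enorm x.
Proof.
rewrite -(@ler_pXn2r _ 2)// ?nnegrE ?enorm_ge0//.
rewrite sqr_enorm real_normK ?num_real// (bigD1 i)//= lerDl sumr_ge0// => j _.
exact: sqr_ge0.
Qed.

Lemma norm_le_enorm x : `|x| <= enorm x.
Proof. by apply: rV_norm_le => [|i]; [exact: enorm_ge0|exact: norm_coord_le_enorm]. Qed.

Lemma enorm_le_norm x : enorm x <= n%:R * `|x|.
Proof.
rewrite -(@ler_pXn2r _ 2)// ?nnegrE ?enorm_ge0// ?mulr_ge0// sqr_enorm.
apply: (@le_trans _ _ (n%:R * `|x| ^+ 2)).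
  have -> : n%:R * `|x| ^+ 2 = \sum_(i < n) `|x| ^+ 2.
    by rewrite sumr_const card_ord mulr_natl.
  apply: ler_sum => i _; rewrite -[leLHS]real_normK ?num_real//.
  by rewrite ler_pXn2r ?nnegrE ?norm_coord_le.
rewrite exprMn ler_wpM2r ?sqr_ge0// -natrX ler_nat.
by case: (n) => // m; rewrite leq_pmulr.
Qed.

Lemma enorm_continuous : continuous (@enorm R n).
Proof.
apply: (@holder_continuous _ _ _ n%:R 1) => // x y; rewrite powRr1//.
exact: le_trans (ler_enorm_dist x y) (enorm_le_norm _).
Qed.

Lemma measurable_enorm : measurable_fun setT (@enorm R n).
Proof. by apply: continuous_measurable_rV; exact: enorm_continuous. Qed.

Lemma mulmx_trV x y : x *m y^T = (dotv x y)%:M.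
Proof.
apply/matrixP => i j; rewrite (ord1 i) (ord1 j) !mxE eqxx mulr1n.
by apply: eq_bigr => k _; rewrite mxE.
Qed.

Lemma dotv_delta x (l : 'I_n) : dotv x (delta_mx 0 l) = x 0 l.
Proof.
rewrite /dotv (bigD1 l)//= big1 => [|i il]; first by rewrite mxE !eqxx mulr1 addr0.
by rewrite mxE (negbTE il) andbF mulr0.
Qed.

Lemma enorm_delta (l : 'I_n) : enorm (delta_mx 0 l : 'rV[R]_n) = 1.
Proof.
by apply/eqP; rewrite -(@eqrXn2 _ 2) ?enorm_ge0// -dotvv dotv_delta mxE !eqxx expr1n.
Qed.

Lemma dotv_mulmx x y (O : 'M[R]_n) : O *m O^T = 1%:M ->
  dotv (x *m O) (y *m O) = dotv x y.
Proof.
move=> OO; have : (x *m O) *m (y *m O)^T = x *m y^T.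
  by rewrite trmx_mul mulmxA -(mulmxA x) OO mulmx1.
by move/matrixP => /(_ 0 0); rewrite !mulmx_trV !mxE !eqxx.
Qed.

Lemma enorm_mulmx x (O : 'M[R]_n) : O *m O^T = 1%:M ->
  enorm (x *m O) = enorm x.
Proof.
move=> OO; apply/eqP; rewrite -(@eqrXn2 _ 2)// ?enorm_ge0//.
by rewrite -!dotvv dotv_mulmx.
Qed.

End euclidean_norm.

Section householder.
Variables (R : realType) (n : nat).
Implicit Types (v x y : 'rV[R]_n).

Definition householder v : 'M[R]_n := 1%:M - (2 / dotv v v) *: (v^T *m v).

Lemma householder_orthogonal v : v != 0 -> householder v *m (householder v)^T = 1%:M.
Proof.
move=> v0; rewrite /householder; set P := v^T *m v; set c := 2 / _.
have vv0 : dotv v v != 0.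
  by rewrite dotvv sqrf_eq0; apply: contra_neq v0; exact: enorm_eq0.
have PP : P *m P = dotv v v *: P.
  by rewrite /P -mulmxA (mulmxA v) mulmx_trV mul_scalar_mx scalemxAr.
have -> : (1%:M - c *: P)^T = 1%:M - c *: P.
  by rewrite linearB/= linearZ/= trmx1 trmx_mul trmxK.
have cvv : c * dotv v v = 2 by rewrite /c divfK.
rewrite mulmxBl !mulmxBr !mul1mx mulmx1 -scalemxAl -scalemxAr PP !scalerA.
by rewrite -mulrA cvv mulr_natr mulr2n scalerDl opprB addrK subrK.
Qed.

Lemma mulmx_householder x y : enorm x = enorm y ->
  x != y -> x *m householder (x - y) = y.
Proof.
rewrite -subr_eq0 => xy; rewrite /householder; set v := x - y => v0.
have vv0 : dotv v v != 0.
  by rewrite dotvv sqrf_eq0; apply: contra_neq v0; exact: enorm_eq0.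
have vv : dotv v v = 2 * dotv x v.
  rewrite /v !(dotvDl, dotvDr, dotvNl, dotvNr) (dotvC y x) (dotvv y) -xy -dotvv.
  by ring.
rewrite mulmxBr mulmx1 -scalemxAr mulmxA mulmx_trV mul_scalar_mx scalerA.
by rewrite mulrAC -vv mulfV// scale1r subKr.
Qed.

Lemma orthogonal_exchange x y : enorm x = enorm y ->
  exists2 O : 'M[R]_n, O *m O^T = 1%:M & x *m O = y.
Proof.
move=> xy; have [->|nxy] := eqVneq x y.
  by exists 1%:M; [rewrite trmx1 mulmx1|rewrite mulmx1].
exists (householder (x - y)); last exact: mulmx_householder.
by rewrite householder_orthogonal// subr_eq0.
Qed.

End householder.

Section orthogonal_invariance.
Local Open Scope ereal_scope.
Variables (R : realType) (n : nat).
Local Notation mu := (lebesgue_rV R n).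
Implicit Types (O : 'M[R]_n) (f g : 'rV[R]_n -> \bar R).

Lemma measurable_mulmx O : measurable_fun setT (fun x : 'rV[R]_n => x *m O).
Proof. by have := measurable_affine_map 1 O 0; under eq_fun do rewrite scale1r addr0. Qed.

Lemma measurable_shear (s t : R) O : measurable_fun setT
  (fun xy : 'rV[R]_n * 'rV[R]_n => s *: xy.1 + t *: (xy.2 *m O))%R.
Proof.
apply: measurable_fun_rV => i.
under eq_fun do rewrite mxE [X in (X + _)%R]mxE [X in (_ + X)%R]mxE.
apply: measurable_funD; apply: measurable_funM => //.
  exact: (measurableT_comp (measurable_coord i)).
apply: (measurableT_comp (measurable_coord i)).
exact: (measurableT_comp (measurable_mulmx O)).
Qed.

Lemma ge0_integral_translates O f g :
  measurable_fun setT f -> (forall x, 0 <= f x) ->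
  measurable_fun setT g -> (forall x, 0 <= g x) ->
  \int[mu]_y \int[mu]_x (g y * f (x + y *m O)%R) =
  (\int[mu]_y g y) * \int[mu]_x f x.
Proof.
move=> mf f0 mg g0; rewrite muleC -ge0_integralZl//; last exact: integral_ge0.
apply: eq_integral => y _; rewrite ge0_integralZl//; last first.
  apply: measurableT_comp mf _.
  by have := measurable_homothety 1 (y *m O); under eq_fun do rewrite scale1r.
by rewrite ge0_integral_translate// muleC.
Qed.

Lemma ge0_integral_rotates O f g : O *m O^T = 1%:M ->
  measurable_fun setT f -> (forall x, 0 <= f x) ->
  measurable_fun setT g -> (forall x, 0 <= g x) ->
  (forall x, g (x *m O) = g x) ->
  \int[mu]_x \int[mu]_y (g y * f (x + y *m O)%R) =
  (\int[mu]_y g y) * \int[mu]_y f (y *m O).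
Proof.
move=> OO mf f0 mg g0 gO; have OtO : O^T *m O = 1%:M by exact: mulmx1C.
have mfO := measurableT_comp mf (measurable_mulmx O).
have mgB : measurable_fun setT
    (fun xy : 'rV[R]_n * 'rV[R]_n => g (xy.2 *m O - xy.1)%R).
  apply: (measurableT_comp mg); have := measurable_shear (-1) 1 O.
  by under eq_fun do rewrite scaleN1r scale1r addrC.
transitivity (\int[mu]_x \int[mu]_y (g (y *m O - x)%R * f (y *m O))).
  apply: eq_integral => x _.
  rewrite -[RHS](ge0_integral_translate (x *m O^T)%R); last 2 first.
  - apply: emeasurable_funM => //.
    exact: (measurableT_comp mgB (pair1_measurable x)).
  - by move=> y; exact: mule_ge0.
  apply: eq_integral => y _; rewrite mulmxDl -mulmxA OtO mulmx1 addrK gO.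
  by rewrite addrC.
rewrite (fubini_tonelli
  (fun xy : 'rV[R]_n * 'rV[R]_n => g (xy.2 *m O - xy.1)%R * f (xy.2 *m O)))/=.
- rewrite -ge0_integralZl//; last exact: integral_ge0.
  apply: eq_integral => y _; under eq_integral do rewrite muleC.
  rewrite ge0_integralZl//; last first.
    exact: (measurableT_comp mgB (pair2_measurable y)).
  by rewrite ge0_integral_reflect// muleC.
- apply: emeasurable_funM => //.
  exact: (measurableT_comp mfO).
- by move=> xy; exact: mule_ge0.
Qed.

(* The ratio of [mu \o O] and [mu] is computed on the unit ball, which [O]
   preserves. *)
Lemma ge0_integral_orthogonal O f : O *m O^T = 1%:M ->
  measurable_fun setT f -> (forall x, 0 <= f x) ->
  \int[mu]_x f (x *m O) = \int[mu]_x f x.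
Proof.
move=> OO mf f0; pose B := [set x : 'rV[R]_n | (enorm x < 1)%R].
have oB : open B.
  apply: (@open_comp _ _ (@enorm R n) [set t | (t < 1)%R]); last exact: open_lt.
  by move=> x _; exact: enorm_continuous.
have mB := open_measurable_rV oB.
have B0 : 0 < mu B by apply: open_lebesgue_gt0 => //; exists 0%R; rewrite /B/= enorm0.
have Boo : mu B < +oo.
  apply: le_lt_trans (normball_lty n 1).
  apply: le_measure; rewrite ?inE//; first exact: measurable_normball.
  by move=> x /ltW; apply: le_trans; exact: norm_le_enorm.
pose g x : \bar R := (\1_B x)%:E.
have mg : measurable_fun setT g by apply/measurable_EFinP; exact: measurable_indic.
have g0 x : 0 <= g x by rewrite lee_fin.
have gO x : g (x *m O) = g x.
  rewrite /g !indicE; congr (nat_of_bool _)%:R%:E.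
  by apply/idP/idP; rewrite !inE /B/= enorm_mulmx.
have intg : \int[mu]_x g x = mu B by rewrite integral_indic// setIT.
have := ge0_integral_rotates OO mf f0 mg g0 gO.
rewrite (fubini_tonelli
  (fun xy : 'rV[R]_n * 'rV[R]_n => g xy.2 * f (xy.1 + xy.2 *m O)%R)); last 2 first.
- apply: emeasurable_funM; first exact: (measurableT_comp mg).
  apply: (measurableT_comp mf); have := measurable_shear 1 1 O.
  by under eq_fun do rewrite !scale1r.
- by move=> xy; exact: mule_ge0.
rewrite /= ge0_integral_translates// intg => /esym.
have muB : mu B \is a fin_num by rewrite ge0_fin_numE// ltW.
have muBV : (fine (mu B))^-1%:E * mu B = 1.
  by rewrite -[X in _ * X](fineK muB) -EFinM mulVf// gt_eqF// fine_gt0// B0.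
move=> /(congr1 (fun t => (fine (mu B))^-1%:E * t)).
by rewrite !muleA muBV !mul1e.
Qed.

End orthogonal_invariance.

Section affine_change_of_variables.
Local Open Scope ereal_scope.
Variables (R : realType) (n : nat) (s : R) (O : 'M[R]_n) (a : 'rV[R]_n).
Local Notation mu := (lebesgue_rV R n).
Hypotheses (s0 : s != 0%R) (OO : O *m O^T = 1%:M).
Let A (x : 'rV[R]_n) := (s *: (x *m O) + a)%R.

Lemma ge0_integral_affine (f : 'rV[R]_n -> \bar R) :
  measurable_fun setT f -> (forall x, 0 <= f x) ->
  (`|s| ^+ n)%:E * \int[mu]_x f (A x) = \int[mu]_x f x.
Proof.
move=> mf f0; rewrite -[RHS](ge0_integral_homothety a s0)//; congr (_ * _).
rewrite -[RHS](ge0_integral_orthogonal OO)//.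
exact: measurableT_comp mf (measurable_homothety s a).
Qed.

Lemma integral_affine (f : 'rV[R]_n -> \bar R) : measurable_fun setT f ->
  (`|s| ^+ n)%:E * \int[mu]_x f (A x) = \int[mu]_x f x.
Proof.
move=> mf; rewrite [X in _ * X]integralE [RHS]integralE.
have pE : \int[mu]_x f^\+ x = (`|s| ^+ n)%:E * \int[mu]_x (f \o A)^\+ x.
  rewrite -[LHS]ge0_integral_affine//; last exact: measurable_funepos.
  by congr (_ * _); apply: eq_integral => x _; rewrite !funeposE.
have nE : \int[mu]_x f^\- x = (`|s| ^+ n)%:E * \int[mu]_x (f \o A)^\- x.
  rewrite -[LHS]ge0_integral_affine//; last exact: measurable_funeneg.
  by congr (_ * _); apply: eq_integral => x _; rewrite !funenegE.
rewrite pE nE.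
have p0 : 0 <= \int[mu]_x (f \o A)^\+ x by exact: integral_ge0.
have n0 : 0 <= \int[mu]_x (f \o A)^\- x by exact: integral_ge0.
have sn : (0 < `|s| ^+ n)%R by rewrite exprn_gt0// normr_gt0.
case: (\int[mu]_x _) p0 => [x| |]// _; case: (\int[mu]_x _) n0 => [y| |]// _.
- by rewrite -EFinB -!EFinM -EFinB mulrBr.
- by rewrite /= gt0_muley ?lte_fin// gt0_muleNy ?lte_fin.
- by rewrite /= gt0_muley ?lte_fin.
- by rewrite /= gt0_muley ?lte_fin// gt0_muleNy ?lte_fin.
Qed.

Lemma Rintegral_affine (f : 'rV[R]_n -> R) : mu.-integrable setT (EFin \o f) ->
  (\int[mu]_x f (A x) = `|s| ^- n * \int[mu]_x f x)%R.
Proof.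
move=> iF; have sn : (`|s| ^+ n != 0)%R by rewrite expf_neq0// normr_eq0.
have := integral_affine (measurable_int _ iF) => /(congr1 (fun t => (`|s| ^- n)%:E * t)).
rewrite muleA -EFinM mulVf// mul1e /Rintegral => ->.
by rewrite fineM//; exact: integrable_fin_num.
Qed.

End affine_change_of_variables.

Lemma Rintegral_homothety (R : realType) n (s : R) (a : 'rV[R]_n) (f : 'rV[R]_n -> R) :
  s != 0 -> (lebesgue_rV R n).-integrable setT (EFin \o f) ->
  \int[lebesgue_rV R n]_x f (s *: x + a) = `|s| ^- n * \int[lebesgue_rV R n]_x f x.
Proof.
move=> s0 iF; have I1 : 1%:M *m (1%:M : 'M[R]_n)^T = 1%:M by rewrite trmx1 mulmx1.
by rewrite -(Rintegral_affine a s0 I1)//; apply: eq_Rintegral => x _; rewrite mulmx1.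
Qed.

(** * Smooth functions and test functions *)

Section smooth_real_functions.
Variable R : realType.
Implicit Types (f g : R -> R) (x : R).

Fixpoint derivable_upto (k : nat) f : Prop :=
  if k is k'.+1 then (forall x, derivable f x 1) /\ derivable_upto k' f^`()%classic
  else True.

Definition smoothR f := forall k, derivable_upto k f.

Lemma smoothR_derivable f x : smoothR f -> derivable f x 1.
Proof. by move=> /(_ 1%N)[]. Qed.

Lemma smoothR_derive1 f : smoothR f -> smoothR f^`()%classic.
Proof. by move=> sf k; have [] := sf k.+1. Qed.

Lemma smoothR_continuous f : smoothR f -> continuous f.
Proof.
move=> sf x; apply: differentiable_continuous.
exact/derivable1_diffP/smoothR_derivable.
Qed.

Lemma is_derive_derive1 f x : derivable f x 1 -> is_derive x (1 : R) f (f^`()%classic x).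
Proof. by move=> df; apply: (DeriveDef df); rewrite derive1E. Qed.

Lemma derive1_is_derive f g : (forall x, is_derive x (1 : R) f (g x)) ->
  f^`()%classic = g.
Proof. by move=> fg; apply/funext => x; rewrite derive1E; have [_ ->] := fg x. Qed.

Lemma derivable_uptoS k f g : (forall x, is_derive x (1 : R) f (g x)) ->
  derivable_upto k g -> derivable_upto k.+1 f.
Proof.
move=> fg Dg; split; first by move=> x; have [] := fg x.
by rewrite (derive1_is_derive fg).
Qed.

Lemma derivable_uptoW k f : derivable_upto k.+1 f -> derivable_upto k f.
Proof. by elim: k f => [//|k ih] f [df Df]; split => //; exact: ih. Qed.

Lemma derivable_upto_cst k (c : R) : derivable_upto k (cst c).
Proof.
by elim: k c => [//|k ih] c; apply: derivable_uptoS (ih 0) => x.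
Qed.

Lemma derivable_uptoD k f g : derivable_upto k f -> derivable_upto k g ->
  derivable_upto k (fun t => f t + g t).
Proof.
elim: k f g => [//|k ih] f g [df Df] [dg Dg].
apply: derivable_uptoS (ih _ _ Df Dg) => x.
exact: (is_deriveD (is_derive_derive1 (df x)) (is_derive_derive1 (dg x))).
Qed.

Lemma derivable_uptoM k f g : derivable_upto k f -> derivable_upto k g ->
  derivable_upto k (fun t => f t * g t).
Proof.
elim: k f g => [//|k ih] f g Df Dg; have [df Df'] := Df; have [dg Dg'] := Dg.
apply: (@derivable_uptoS _ _ (fun t => f t * g^`()%classic t + g t * f^`()%classic t)).
  move=> x; exact: (is_deriveM (is_derive_derive1 (df x)) (is_derive_derive1 (dg x))).
by apply: derivable_uptoD; apply: ih => //; exact: derivable_uptoW.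
Qed.

Lemma is_derive1_comp_affine f (c a b x d : R) : is_derive (a * x + b) (1 : R) f d ->
  is_derive x (1 : R) (fun t => c * f (a * t + b)) (c * a * d).
Proof.
move=> df; have dl : is_derive x (1 : R) (fun t : R => a * t + b) a.
  have -> : (fun t : R => a * t + b) = horner (a *: 'X + b%:P).
    by apply/funext => t; rewrite !hornerE.
  apply: (is_derive_eq (is_derive_poly _ x)).
  by rewrite derivD derivZ derivX derivC !hornerE.
have dfl := @is_derive1_comp _ f (fun t => a * t + b) _ _ _ df dl.
by apply: (is_derive_eq (is_deriveZ c dfl)); rewrite /GRing.scale/=; ring.
Qed.

Lemma derivable_upto_comp_affine k f (c a b : R) : derivable_upto k f ->
  derivable_upto k (fun t => c * f (a * t + b)).
Proof.
elim: k f c => [//|k ih] f c [df Df].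
apply: derivable_uptoS (ih _ (c * a) Df) => x.
exact/is_derive1_comp_affine/is_derive_derive1.
Qed.

Lemma derivable_uptoV k f : (forall x, f x != 0) -> derivable_upto k f ->
  derivable_upto k (fun t => (f t)^-1).
Proof.
move=> f0; elim: k => [//|k ih] Df; have [df Df'] := Df.
have DV := ih (derivable_uptoW Df).
apply: (@derivable_uptoS k (fun t => (f t)^-1)
    (fun t => -1 * f^`()%classic t * ((f t)^-1 * (f t)^-1))).
  move=> x; have := is_deriveV (f0 x) (is_derive_derive1 (df x)).
  by move=> /is_derive_eq; apply; rewrite /GRing.scale/= -exprVn; ring.
apply: derivable_uptoM; last exact: derivable_uptoM.
by apply: derivable_uptoM => //; exact: derivable_upto_cst.
Qed.

Lemma smoothRD f g : smoothR f -> smoothR g -> smoothR (fun t => f t + g t).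
Proof. by move=> sf sg k; exact: derivable_uptoD. Qed.

Lemma smoothRM f g : smoothR f -> smoothR g -> smoothR (fun t => f t * g t).
Proof. by move=> sf sg k; exact: derivable_uptoM. Qed.

Lemma smoothRV f : (forall x, f x != 0) -> smoothR f -> smoothR (fun t => (f t)^-1).
Proof. by move=> f0 sf k; exact: derivable_uptoV. Qed.

Lemma smoothR_comp_affine f (c a b : R) : smoothR f ->
  smoothR (fun t => c * f (a * t + b)).
Proof. by move=> sf k; exact: derivable_upto_comp_affine. Qed.

End smooth_real_functions.

Lemma is_derive0_quadratic (R : realType) (f : R -> R) (M x : R) :
  (forall y, `|f y - f x| <= M * (y - x) ^+ 2) -> is_derive x (1 : R) f 0.
Proof.
move=> fM; pose M' := `|M| + 1; have M'0 : 0 < M' by rewrite ltr_wpDl.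
have {}fM y : `|f y - f x| <= M' * (y - x) ^+ 2.
  apply: le_trans (fM y) _; rewrite ler_wpM2r ?sqr_ge0//.
  by rewrite ler_wpDr// ler_norm.
suff quotient_cvg :
    (h^-1 *: ((f \o shift x) (h *: (1 : R)) - f x)) @[h --> (0 : R)^'] --> (0 : R).
  by apply: DeriveDef; [apply/cvg_ex; exists 0|apply/cvg_lim].
apply/cvgrPdist_le => e e0; near=> h; rewrite sub0r normrN /= [_ *: 1]mulr1.
have h0 : h != 0 by near: h; exact: nbhs_dnbhs_neq.
rewrite normrZ normfV ler_pdivrMl ?normr_gt0//.
apply: le_trans (fM _) _; rewrite addrK -real_normK ?num_real// expr2 mulrCA.
rewrite ler_wpM2l// mulrC -ler_pdivlMr//.
by near: h; apply: dnbhs0_le; exact: divr_gt0.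
Unshelve. all: by end_near. Qed.

Section smooth_step.
Variable R : realType.
Implicit Types (P : {poly R}) (t v x : R).

(* For [P = 1] this is the classical smooth function that is not analytic at
   [0]; polynomials in [1 / t] make the family stable under differentiation. *)
Definition flat P t := if 0 < t then P.[t^-1] * expR (- t^-1) else 0.

Lemma flat_le0 P t : t <= 0 -> flat P t = 0.
Proof. by rewrite /flat ltNge => ->. Qed.

Lemma horner_le_expR P : exists M, forall v, 0 <= v -> `|P.[v]| <= M * expR v.
Proof.
exists (\sum_(i < size P) `|P`_i| * i`!%:R) => v v0.
rewrite horner_coef mulr_suml; apply: le_trans (ler_norm_sum _ _ _) _.
apply: ler_sum => -[[|i] /= _] _; rewrite normrM normrX (ger0_norm v0) -mulrA.
  by rewrite ler_wpM2l// expr0 mul1r -expR0 ler_expR.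
rewrite ler_wpM2l// mulrC -ler_pdivrMr ?ltr0n ?fact_gt0//.
by apply: le_trans (expR_ge1Dxn i v0); rewrite lerDr.
Qed.

Lemma flat_le_sqr P : exists M, forall t, `|flat P t| <= M * t ^+ 2.
Proof.
have [M PM] := horner_le_expR ('X^2 * P).
have M0 : 0 <= M.
  have := PM 0 (lexx _); rewrite expR0 mulr1; exact: le_trans.
exists M => t; rewrite /flat; case: ifPn => [t0|_]; last first.
  by rewrite normr0 mulr_ge0// sqr_ge0.
have v0 : 0 <= t^-1 by rewrite invr_ge0 ltW.
have := PM _ v0; rewrite hornerM hornerXn normrM normrX (ger0_norm v0) => vP.
rewrite normrM expRN normfV (ger0_norm (expR_ge0 _)) ler_pdivrMr ?expR_gt0//.
by rewrite mulrAC -ler_pdivrMr ?exprn_gt0// [leLHS]mulrC -exprVn.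
Qed.

Lemma is_derive_flat P x :
  is_derive x (1 : R) (flat P) (flat ('X^2 * (P - P^`())) x).
Proof.
have [x0|x0] := leP x 0.
  rewrite (flat_le0 _ x0); have [M PM] := flat_le_sqr P.
  apply: (@is_derive0_quadratic _ _ M) => y; rewrite (flat_le0 _ x0) subr0.
  have [y0|y0] := leP y 0.
    rewrite flat_le0// normr0 mulr_ge0 ?sqr_ge0//.
    by have := PM 1; rewrite expr1n mulr1; exact: le_trans.
  apply: le_trans (PM y) _; apply: ler_wpM2l.
    by have := PM 1; rewrite expr1n mulr1; exact: le_trans.
  by rewrite ler_pXn2r ?nnegrE//; lra.
apply: (@near_eq_is_derive _ _ _ (fun t => P.[t^-1] * expR (- t^-1))).
  by near=> t; rewrite /flat ifT//; near: t; exact: lt_nbhsr.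
have dV : is_derive x (1 : R) (fun t : R => t^-1) (- x ^- 2).
  have := is_deriveV (lt0r_neq0 x0) (is_derive_id x (1 : R)).
  by move=> /is_derive_eq; apply; rewrite /GRing.scale/= mulr1.
have dP := @is_derive1_comp _ (horner P) (fun t => t^-1) _ _ _ (is_derive_poly P _) dV.
have dE := @is_derive1_comp _ expR (fun t => - t^-1) _ _ _ (is_derive_expR _) (is_deriveN dV).
apply: (is_derive_eq (is_deriveM dP dE)).
rewrite /flat x0 !hornerE /GRing.scale/= -exprVn; ring.
Unshelve. all: by end_near. Qed.

Lemma smoothR_flat P : smoothR (flat P).
Proof.
move=> k; elim: k P => [//|k ih] P.
exact: derivable_uptoS (is_derive_flat P) (ih _).
Qed.

Definition smooth_step t := flat 1 t / (flat 1 t + flat 1 (1 - t)).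

Definition bump := smooth_step^`()%classic.

Lemma flat1_ge0 t : 0 <= flat 1 t.
Proof. by rewrite /flat; case: ifP => // _; rewrite hornerC mul1r expR_ge0. Qed.

Lemma flat1_gt0 t : 0 < t -> 0 < flat 1 t.
Proof. by move=> t0; rewrite /flat t0 hornerC mul1r expR_gt0. Qed.

Lemma flat_partition_gt0 t : 0 < flat 1 t + flat 1 (1 - t).
Proof.
have [t0|t0] := leP t 0; last by rewrite ltr_pwDl ?flat1_gt0 ?flat1_ge0.
by rewrite ltr_wpDl ?flat1_ge0// flat1_gt0//; lra.
Qed.

Lemma smoothR_smooth_step : smoothR smooth_step.
Proof.
have sf := smoothR_flat 1.
apply: smoothRM => //; apply: smoothRV => [t|]; first by rewrite gt_eqF// flat_partition_gt0.
apply: smoothRD => //; have := @smoothR_comp_affine _ _ 1 (-1) 1 sf.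
by under eq_fun do rewrite mul1r mulN1r addrC.
Qed.

Lemma smoothR_bump : smoothR bump.
Proof. exact/smoothR_derive1/smoothR_smooth_step. Qed.

Lemma smooth_step_ge0 t : 0 <= smooth_step t.
Proof. by rewrite divr_ge0 ?flat1_ge0// ltW ?flat_partition_gt0. Qed.

Lemma smooth_step_le1 t : smooth_step t <= 1.
Proof. by rewrite ler_pdivrMr ?flat_partition_gt0// mul1r lerDl flat1_ge0. Qed.

Lemma smooth_step_le0 t : t <= 0 -> smooth_step t = 0.
Proof. by move=> t0; rewrite /smooth_step flat_le0// mul0r. Qed.

Lemma smooth_step_ge1 t : 1 <= t -> smooth_step t = 1.
Proof.
move=> t1; rewrite /smooth_step [flat 1 (1 - t)]flat_le0 ?subr_le0// addr0.
by rewrite mulfV// gt_eqF// flat1_gt0//; lra.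
Qed.

Lemma bumpE t : bump t =
  (flat 'X^2 t * flat 1 (1 - t) + flat 1 t * flat 'X^2 (1 - t)) /
  (flat 1 t + flat 1 (1 - t)) ^+ 2.
Proof.
have df x : is_derive x (1 : R) (flat 1) (flat 'X^2 x).
  by have := is_derive_flat 1 x; rewrite derivC subr0 mulr1.
have dg : is_derive t (1 : R) (fun t => flat 1 (1 - t)) (- flat 'X^2 (1 - t)).
  have := @is_derive1_comp_affine _ (flat 1) 1 (-1) 1 t _ (df _).
  by rewrite mul1r !mulN1r [- t + 1]addrC; under eq_fun do rewrite mul1r mulN1r addrC.
have s0 := lt0r_neq0 (flat_partition_gt0 t).
have dV := @is_deriveV _ (fun t => flat 1 t + flat 1 (1 - t)) _ _ _ s0 (is_deriveD (df t) dg).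
rewrite /bump derive1E; have [_ ->] := is_deriveM (df t) dV.
rewrite /GRing.scale/=; move: s0; move: (flat 1 t) (flat 1 (1 - t)) => b c s0.
by field.
Qed.

Lemma flatX2_ge0 t : 0 <= flat 'X^2 t.
Proof. by rewrite /flat; case: ifP => // _; rewrite hornerXn mulr_ge0 ?sqr_ge0 ?expR_ge0. Qed.

Lemma bump_ge0 t : 0 <= bump t.
Proof.
by rewrite bumpE divr_ge0 ?sqr_ge0// addr_ge0// mulr_ge0 ?flat1_ge0 ?flatX2_ge0.
Qed.

Lemma bump_gt0 t : 0 < t < 1 -> 0 < bump t.
Proof.
move=> /andP[t0 t1]; rewrite bumpE divr_gt0 ?exprn_gt0 ?flat_partition_gt0//.
rewrite ltr_wpDr ?mulr_ge0 ?flat1_ge0 ?flatX2_ge0// mulr_gt0 ?flat1_gt0 ?subr_gt0//.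
by rewrite /flat t0 hornerXn mulr_gt0 ?expR_gt0// exprn_gt0// invr_gt0.
Qed.

Lemma bump_eq0 t : ~~ (0 < t < 1) -> bump t = 0.
Proof.
rewrite negb_and -!leNgt bumpE => /orP[t0|t1].
  by rewrite !(flat_le0 _ t0) !mul0r addr0 mul0r.
by rewrite !(@flat_le0 _ (1 - t)) ?subr_le0// !mulr0 addr0 mul0r.
Qed.

End smooth_step.

Section directional_derivative.
Variables (R : realType) (n : nat).
Implicit Types (f : 'rV[R]_n -> R) (x v : 'rV[R]_n).

Lemma is_derive_lineP f x v (t d : R) :
  is_derive t (1 : R) (fun h : R => f (h *: v + x)) d <->
  is_derive (t *: v + x) v f d.
Proof.
have quotientE : (fun h : R => h^-1 *: (((fun h : R => f (h *: v + x)) \o shift t)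
      (h *: (1 : R)) - f (t *: v + x))) =
    (fun h : R => h^-1 *: ((f \o shift (t *: v + x)) (h *: v) - f (t *: v + x))).
  by apply/funext => h /=; rewrite [_ *: 1]mulr1 scalerDl addrA.
split=> -[dv de]; apply: DeriveDef.
- by move: dv; rewrite /derivable quotientE.
- by move: de; rewrite /derive quotientE.
- by rewrite /derivable quotientE.
- by rewrite /derive quotientE.
Qed.

Lemma is_derive_line0P f x v (d : R) :
  is_derive (0 : R) (1 : R) (fun h : R => f (h *: v + x)) d <-> is_derive x v f d.
Proof. by have := is_derive_lineP f x v 0 d; rewrite scale0r add0r. Qed.

Lemma is_derive_partial f i x : derivable f x (delta_mx 0 i) ->
  is_derive x (delta_mx 0 i) f (partial i f x).
Proof. by move=> df; apply: (DeriveDef df). Qed.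

Lemma partial_is_derive f i (g : 'rV[R]_n -> R) :
  (forall x, is_derive x (delta_mx 0 i) f (g x)) -> partial i f = g.
Proof. by move=> fg; apply/funext => x; have [_] := fg x. Qed.

Lemma MVT_coord f k x (h : R) :
  (forall z, derivable f z (delta_mx 0 k)) ->
  exists2 t : R, Num.min 0 h <= t <= Num.max 0 h &
    f (h *: delta_mx 0 k + x) - f x = h * partial k f (t *: delta_mx 0 k + x).
Proof.
move=> df; pose g (t : R) := f (t *: delta_mx 0 k + x).
have dg (t : R) : is_derive t (1 : R) g (partial k f (t *: delta_mx 0 k + x)).
  by apply/is_derive_lineP; exact: is_derive_partial.
have cg : continuous g.
  move=> t; apply: differentiable_continuous; apply/derivable1_diffP.
  by have [] := dg t.
have g0 : g 0 = f x by rewrite /g scale0r add0r.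
have [h0|/ltW h0] := leP 0 h;
    have [t] := MVT_segment h0 (fun z _ => dg z) (continuous_subspaceT cg);
    rewrite in_itv/= => t0h gE; exists t => //; rewrite -g0.
  by rewrite gE subr0 mulrC.
by rewrite -opprB gE sub0r mulrN opprK mulrC.
Qed.

End directional_derivative.

Section strict_differentiability.
Variables (R : realType) (n : nat).
Implicit Types (f : 'rV[R]_n -> R) (x y a v : 'rV[R]_n).

Definition staircase x y (k : nat) : 'rV[R]_n :=
  \row_i if (i < k)%N then x 0 i else y 0 i.

Lemma staircase0 x y : staircase x y 0 = y.
Proof. by apply/rowP => i; rewrite mxE. Qed.

Lemma staircase_full x y : staircase x y n = x.
Proof. by apply/rowP => i; rewrite mxE ltn_ord. Qed.

Lemma staircaseS x y (k : 'I_n) :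
  staircase x y k.+1 = (x 0 k - y 0 k) *: delta_mx 0 k + staircase x y k.
Proof.
apply/rowP => i; rewrite !mxE/= ltnS leq_eqVlt.
have [->|ik] := eqVneq i k; first by rewrite eqxx ltnn mulr1 subrK.
by rewrite -val_eqE/= in ik *; rewrite (negbTE ik)/= mulr0 add0r.
Qed.

Lemma telescope_staircase f x y :
  f x - f y = \sum_(k < n) (f (staircase x y k.+1) - f (staircase x y k)).
Proof.
pose g k := f (staircase x y k).
by rewrite -(big_mkord xpredT (fun k => g k.+1 - g k)) telescope_sumr// /g
  staircase0 staircase_full.
Qed.

Lemma C1_staircase_step f a x y (d e : R) (k : 'I_n) : C1 f ->
  (forall z, `|z - a| < d -> `|partial k f z - partial k f a| <= e) ->
  `|x - a| < d -> `|y - a| < d ->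
  `|f (staircase x y k.+1) - f (staircase x y k) -
    partial k f a * (x 0 k - y 0 k)| <= e * `|x - y|.
Proof.
move=> [_ /(_ k)[df _]] fd xa ya.
have [t t_xy fE] := MVT_coord (staircase x y k) (x 0 k - y 0 k) df.
rewrite staircaseS fE [X in X - _]mulrC -mulrBl normrM; apply: ler_pM => //; last first.
  by have := norm_coord_le (x - y) k; rewrite !mxE.
apply: fd; apply: rV_norm_lt => [|j]; first exact: le_lt_trans xa.
have xj := le_lt_trans (norm_coord_le (x - a) j) xa.
have yj := le_lt_trans (norm_coord_le (y - a) j) ya.
rewrite !mxE /= in xj yj *; have [jk|jk] := eqVneq j k; last first.
  by rewrite mulr0 add0r; case: ifP.
rewrite jk ltnn mulr1; rewrite jk in xj yj.
move: t_xy xj yj; rewrite !ltr_norml ge_min le_max.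
by move=> /andP[/orP[?|?] /orP[?|?]] /andP[? ?] /andP[? ?]; apply/andP; split; lra.
Qed.

Lemma C1_strict_differentiable f a (e : R) : C1 f -> 0 < e ->
  exists2 d : R, 0 < d & forall x y, `|x - a| < d -> `|y - a| < d ->
    `|f x - f y - \sum_(j < n) partial j f a * (x 0 j - y 0 j)| <= e * `|x - y|.
Proof.
move=> C1f e0; pose e' := e / n.+1%:R.
have e'0 : 0 < e' by rewrite divr_gt0.
have fa j : \forall z \near a, `|partial j f a - partial j f z| < e'.
  by have [_ /(_ j)[_ cf]] := C1f; exact: continuous_near.
have /nbhs_ballP[d /= d0 fd] := filter_forall (nbhs_filter a) fa; exists d => // x y xa ya.
rewrite telescope_staircase -sumrB; apply: le_trans (ler_norm_sum _ _ _) _.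
apply: (@le_trans _ _ (\sum_(k < n) e' * `|x - y|)).
  apply: ler_sum => k _; apply: C1_staircase_step C1f _ xa ya => z za.
  by rewrite distrC ltW// fd// mx_norm_ball /ball_/= distrC.
rewrite sumr_const card_ord -mulr_natl mulrA ler_wpM2r// /e'.
by rewrite mulrA ler_pdivrMr// mulrC ler_wpM2l ?(ltW e0)// ler_nat.
Qed.

Lemma C1_is_derive f x v : C1 f ->
  is_derive x v f (\sum_(j < n) v 0 j * partial j f x).
Proof.
move=> C1f; set D := \sum_(j < n) _.
suff fD : (h^-1 *: ((f \o shift x) (h *: v) - f x)) @[h --> (0 : R)^'] --> D.
  by apply: DeriveDef; [apply/cvg_ex; exists D|apply/cvg_lim].
apply/cvgrPdist_le => e e0.
pose V := `|v| + 1; have V0 : 0 < V by rewrite ltr_wpDl.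
have [d d0 fd] := C1_strict_differentiable x C1f (divr_gt0 e0 V0).
near=> h.
have h0 : h != 0 by near: h; exact: nbhs_dnbhs_neq.
have hp : 0 < `|h| by rewrite normr_gt0.
have hvd : `|h *: v| < d.
  apply: (@le_lt_trans _ _ (`|h| * V)); first by rewrite normrZ ler_wpM2l// lerDl.
  by rewrite -ltr_pdivlMr//; near: h; apply: dnbhs0_lt; exact: divr_gt0.
have := fd (h *: v + x) x; rewrite addrK subrr normr0 => /(_ hvd d0).
have -> : \sum_(j < n) partial j f x * ((h *: v + x) 0 j - x 0 j) = h * D.
  by rewrite mulr_sumr; apply: eq_bigr => j _; rewrite !mxE; ring.
move=> fxD; rewrite distrC -(ler_pM2l hp) -normrM mulrBr.
rewrite [X in X - _](_ : _ = f (h *: v + x) - f x); last by rewrite /GRing.scale/= mulVKf.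
apply: le_trans fxD _; rewrite normrZ mulrCA ler_pM2l//.
by rewrite mulrC mulrA ler_pdivrMr// mulrC ler_pM2l// lerDl.
Unshelve. all: by end_near. Qed.

End strict_differentiability.

Section continuously_differentiable.
Variables (R : realType) (n : nat).
Implicit Types (f g : 'rV[R]_n -> R) (x : 'rV[R]_n).

Fixpoint Ck (k : nat) f : Prop :=
  if k is k'.+1 then C1 f /\ forall i, Ck k' (partial i f) else continuous f.

Lemma Ck_continuous k f : Ck k f -> continuous f.
Proof. by case: k => [|k] // [[]]. Qed.

Lemma smooth_continuous f : smooth f -> continuous f.
Proof. by move=> /(_ [::])[]. Qed.

Lemma smooth_partial f i : smooth f -> smooth (partial i f).
Proof. by move=> sf s; have := sf (rcons s i); rewrite foldr_rcons. Qed.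

Lemma smoothP f : smooth f <-> forall k, Ck k f.
Proof.
split=> [sf k|].
  elim: k f sf => [|k ih] f sf /=; first exact: smooth_continuous.
  by split=> [|i]; [exact: (sf [::])|apply: ih; exact: smooth_partial].
move=> Cf s; elim/last_ind: s f Cf => [|s i ih] f Cf; first by have [] := Cf 1%N.
by rewrite foldr_rcons; apply: ih => k; have [_] := Cf k.+1; apply.
Qed.

Lemma CkS k f (df : 'I_n -> 'rV[R]_n -> R) : continuous f ->
  (forall i x, is_derive x (delta_mx 0 i) f (df i x)) ->
  (forall i, Ck k (df i)) -> Ck k.+1 f.
Proof.
move=> cf fdf Cdf; have pE i : partial i f = df i by exact: partial_is_derive.
split=> [|i]; last by rewrite pE.
split=> // i; split; first by move=> x; have [] := fdf i x.
by rewrite pE; exact: Ck_continuous (Cdf i).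
Qed.

Lemma continuous_lin a b f g : continuous f -> continuous g ->
  continuous (fun x => a * f x + b * g x).
Proof.
move=> cf cg x.
apply: (@continuousD _ _ _ (fun x => a * f x) (fun x => b * g x)).
  by apply: (@continuousM _ _ (cst a)); [exact: cst_continuous|exact: cf].
by apply: (@continuousM _ _ (cst b)); [exact: cst_continuous|exact: cg].
Qed.

Lemma Ck_lin k a b f g : Ck k f -> Ck k g -> Ck k (fun x => a * f x + b * g x).
Proof.
elim: k f g => [|k ih] f g; first exact: continuous_lin.
move=> [[cf df] Cf] [[cg dg] Cg].
apply: (@CkS _ _ (fun i x => a * partial i f x + b * partial i g x)).
- exact: continuous_lin.
- move=> i x; have dfx := is_derive_partial ((df i).1 x).
  have dgx := is_derive_partial ((dg i).1 x).
  exact: (is_deriveD (is_deriveZ a dfx) (is_deriveZ b dgx)).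
- by move=> i; exact: (ih _ _ (Cf i) (Cg i)).
Qed.

Lemma Ck0 k : Ck k (cst 0).
Proof.
elim: k => [|k ih]; first exact: cst_continuous.
apply: (@CkS _ _ (fun=> cst 0)) => //; exact: cst_continuous.
Qed.

Lemma Ck_sum k (I : Type) (r : seq I) (c : I -> R) (F : I -> 'rV[R]_n -> R) :
  (forall i, Ck k (F i)) -> Ck k (fun x => \sum_(i <- r) c i * F i x).
Proof.
move=> CF; elim: r => [|i r ih].
  by under eq_fun do rewrite big_nil; exact: Ck0.
under eq_fun do rewrite big_cons -[X in _ + X]mul1r.
exact: Ck_lin.
Qed.

Section comp_affine.
Variables (s : R) (O : 'M[R]_n) (a : 'rV[R]_n).
Let A (x : 'rV[R]_n) : 'rV[R]_n := s *: (x *m O) + a.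

Lemma is_derive_comp_affine f i x : C1 f -> is_derive x (delta_mx 0 i) (f \o A)
  (\sum_(j < n) (s * O i j) * partial j f (A x)).
Proof.
move=> C1f; apply/is_derive_line0P.
pose v : 'rV[R]_n := s *: (delta_mx 0 i *m O).
rewrite [X in is_derive _ _ X _](_ : _ = (fun h : R => f (h *: v + A x))); last first.
  apply/funext => h /=; congr f; rewrite /A /v mulmxDl scalerDr -addrA.
  by rewrite -scalemxAl scalerA mulrC -scalerA.
have -> : \sum_(j < n) (s * O i j) * partial j f (A x) =
    \sum_(j < n) v 0 j * partial j f (A x).
  by apply: eq_bigr => j _; rewrite /v mxE -rowE mxE.
by apply/is_derive_line0P; exact: C1_is_derive.
Qed.

Lemma Ck_comp_affine k f : Ck k f -> Ck k (f \o A).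
Proof.
elim: k f => [|k ih] f; first exact: continuous_comp_affine.
move=> [C1f Cf]; apply: CkS; first by apply: continuous_comp_affine; case: C1f.
  by move=> i x; exact: is_derive_comp_affine.
move=> i; apply: (@Ck_sum _ _ _ _ (fun j => partial j f \o A)) => j.
exact: (ih _ (Cf j)).
Qed.

Lemma smooth_comp_affine f : smooth f -> smooth (f \o A).
Proof. by move=> /smoothP Cf; apply/smoothP => k; exact: Ck_comp_affine. Qed.

End comp_affine.

End continuously_differentiable.

Lemma bounded_of_compact_support (R : realType) (T : topologicalType)
    (K : set T) (f : T -> R) : compact K -> continuous f ->
  (forall x, ~ K x -> f x = 0) -> exists2 M, 0 <= M & forall x, `|f x| <= M.
Proof.
move=> cK cf f0; have : compact (f @` K).
  by apply: continuous_compact => //; exact: continuous_subspaceT.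
move=> /compact_bounded/pinfty_ex_gt0[M M0 fM]; exists M => [|x]; first exact: ltW.
have [Kx|/f0->] := pselect (K x); last by rewrite normr0 ltW.
by apply: (fM (f x)); exists x.
Qed.

Section test_functions.
Variables (R : realType) (n : nat).
Implicit Types (f : 'rV[R]_n -> R) (x : 'rV[R]_n) (phi : 'I_n -> R -> R).

Lemma test_functionP f : test_function f <->
  smooth f /\ exists2 L : R, 0 <= L & forall x, L < `|x| -> f x = 0.
Proof.
split=> -[sf]; [move=> /compact_sub_normball[L fL]|move=> [L _ fL]]; split=> //.
  exists `|L| => // x Lx; apply/eqP; apply: contraTT Lx => fx0.
  rewrite -leNgt; apply: le_trans (ler_norm L); apply: fL.
  exact: subset_closure.
apply: (subclosed_compact _ (@compact_normball R n L)); first exact: closed_closure.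
rewrite closureE; apply: smallest_sub; first exact: closed_normball.
move=> x /= fx0; rewrite /normball/= leNgt; apply: contra_neqN fx0; exact: fL.
Qed.

Lemma test_function_continuous f : test_function f -> continuous f.
Proof. by case=> sf _; exact: smooth_continuous. Qed.

Lemma measurable_test_function f : test_function f -> measurable_fun setT f.
Proof. by move=> tf; apply: continuous_measurable_rV; exact: test_function_continuous. Qed.

Lemma test_function_bounded f : test_function f ->
  exists2 M : R, 0 <= M & forall x, `|f x| <= M.
Proof.
move=> tf; have [_ [L _ fL]] := (test_functionP f).1 tf.
apply: (bounded_of_compact_support (@compact_normball R n L)).
  exact: test_function_continuous.
by move=> x /negP; rewrite -ltNge; exact: fL.
Qed.

Lemma test_function_partial f i : test_function f -> test_function (partial i f).
Proof.
move=> /test_functionP[sf [L L0 fL]]; apply/test_functionP.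
split; first exact: smooth_partial.
exists L => // x Lx; suff : is_derive x (delta_mx 0 i) f 0 by case.
apply: (@near_eq_is_derive _ _ _ (cst 0)).
apply/nbhs_ballP; exists (`|x| - L) => /=; first by rewrite subr_gt0.
move=> y; rewrite mx_norm_ball /ball_/= => xy; apply/esym/fL.
by have := lerB_dist x y; lra.
Qed.

Lemma test_function_comp_affine (s : R) (O O' : 'M[R]_n) (a : 'rV[R]_n) f :
  s != 0 -> O *m O' = 1%:M -> test_function f ->
  test_function (fun x => f (s *: (x *m O) + a)).
Proof.
move=> s0 OO /test_functionP[sf [L L0 fL]]; apply/test_functionP.
split; first exact: (smooth_comp_affine s O a sf).
exists (`|s|^-1 * (n%:R * ((L + `|a|) * `|O'|))) => [|x xL].
  by rewrite !mulr_ge0 ?invr_ge0 ?addr_ge0.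
apply: fL; rewrite ltNge; apply/negP => Lx; move: xL; rewrite ltNge => /negP; apply.
rewrite ler_pdivlMl ?normr_gt0// -normrZ.
rewrite -[s *: x]mulmx1 -OO mulmxA -scalemxAl.
apply: le_trans (norm_mulmx_le _ _) _; rewrite ler_wpM2l// ler_wpM2r//.
rewrite -[s *: _](addrK a); apply: le_trans (ler_normB _ _) _.
by rewrite lerD2r.
Qed.

Definition tensor phi x := \prod_(i < n) phi i (x 0 i).

Lemma tensor_continuous phi : (forall i, continuous (phi i)) -> continuous (tensor phi).
Proof.
move=> cphi; apply: continuous_big => [|i _ x]; first exact: mul_continuous.
apply: (@continuous_comp _ _ _ (fun x : 'rV[R]_n => x 0 i)); last exact: cphi.
exact: coord_continuous.
Qed.

Lemma is_derive_tensor phi j x : (forall i, smoothR (phi i)) ->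
  is_derive x (delta_mx 0 j) (tensor phi)
    (tensor (fun i => if i == j then (phi i)^`()%classic else phi i) x).
Proof.
move=> sphi; apply/is_derive_line0P; pose c := \prod_(i < n | i != j) phi i (x 0 i).
have -> : (fun h : R => tensor phi (h *: delta_mx 0 j + x)) =
    (fun h => c * phi j (1 * h + x 0 j)).
  apply/funext => h; rewrite /tensor (bigD1 j)//= mulrC; congr (_ * _).
    by apply: eq_bigr => i ij; rewrite !mxE (negbTE ij) mulr0 add0r.
  by rewrite !mxE !eqxx mulr1 mul1r.
rewrite [X in is_derive _ _ _ X](_ : _ = c * 1 * (phi j)^`()%classic (x 0 j)).
  apply: is_derive1_comp_affine; rewrite mulr0 add0r.
  exact/is_derive_derive1/smoothR_derivable.
rewrite /tensor (bigD1 j)//= eqxx mulr1 mulrC; congr (_ * _).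
by apply: eq_bigr => i ij; rewrite (negbTE ij).
Qed.

Lemma partial_tensor phi j : (forall i, smoothR (phi i)) ->
  partial j (tensor phi) =
  tensor (fun i => if i == j then (phi i)^`()%classic else phi i).
Proof. by move=> sphi; apply: partial_is_derive => x; exact: is_derive_tensor. Qed.

Lemma smooth_tensor phi : (forall i, smoothR (phi i)) -> smooth (tensor phi).
Proof.
move=> sphi; apply/smoothP => k; elim: k phi sphi => [|k ih] phi sphi.
  by apply: tensor_continuous => i; exact: smoothR_continuous.
apply: (@CkS _ _ k _ (fun j => tensor (fun i =>
  if i == j then (phi i)^`()%classic else phi i))).
- by apply: tensor_continuous => i; exact: smoothR_continuous.
- by move=> j x; exact: is_derive_tensor.
- by move=> j; apply: ih => i; case: ifP => _ //; exact: smoothR_derive1.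
Qed.

Lemma tensor_eq0 phi (L : R) x : 0 <= L -> (forall i t, L < `|t| -> phi i t = 0) ->
  L < `|x| -> tensor phi x = 0.
Proof.
move=> L0 phiL /(exists_coord_gt L0)[i xi].
by rewrite /tensor (bigD1 i)//= phiL// mul0r.
Qed.

Lemma norm_tensor_le phi (M : R) x : (forall i t, `|phi i t| <= M) ->
  `|tensor phi x| <= M ^+ n.
Proof.
move=> phiM; have -> : M ^+ n = \prod_(i < n) M by rewrite prodr_const card_ord.
by rewrite normr_prod; apply: ler_prod => i _; rewrite normr_ge0 phiM.
Qed.

Lemma test_function_tensor phi (L : R) : 0 <= L -> (forall i, smoothR (phi i)) ->
  (forall i t, L < `|t| -> phi i t = 0) -> test_function (tensor phi).
Proof.
move=> L0 sphi phiL; apply/test_functionP; split; first exact: smooth_tensor.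
by exists L => // x; exact: tensor_eq0.
Qed.

End test_functions.

(** * The energy *)

Section powR_inequalities.
Variable R : realType.
Implicit Types a b c p q t : R.

Lemma le_powR_chord c t q : 0 <= c <= t -> 1 <= q -> c `^ q * t <= t `^ q * c.
Proof.
move=> /andP[c0 ct] q1; have [->|cn0] := eqVneq c 0.
  by rewrite powR0 ?mul0r ?mulr0//; lra.
have cp : 0 < c by rewrite lt_def cn0.
have tp : 0 < t by exact: lt_le_trans ct.
have -> : c `^ q = (c / t) `^ q * t `^ q.
  by rewrite -powRM ?divr_ge0 ?divfK ?gt_eqF// ltW.
have -> : t `^ q * c = c / t * (t `^ q * t) by field; rewrite gt_eqF.
rewrite -mulrA ler_wpM2r ?mulr_ge0 ?powR_ge0 ?(ltW tp)//.
by apply: ge1r_powR => //; rewrite divr_gt0//= ler_pdivrMr// mul1r.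
Qed.

Lemma powR_superadditive a b q : 0 <= a -> 0 <= b -> 1 <= q ->
  a `^ q + b `^ q <= (a + b) `^ q.
Proof.
move=> a0 b0 q1; have [ab0|ab0] := eqVneq (a + b) 0.
  have [-> ->] : a = 0 /\ b = 0 by lra.
  by rewrite addr0 powR0 ?addr0//; lra.
have abp : 0 < a + b by rewrite lt_def ab0 addr_ge0.
rewrite -(ler_pM2r abp) mulrDl [leRHS]mulrDr.
by apply: lerD; apply: le_powR_chord => //; rewrite ?lerDl ?lerDr ?a0 ?b0.
Qed.

Lemma powR_midpoint a b q : 0 <= a -> 0 <= b -> 1 <= q ->
  (2^-1 * (a + b)) `^ q <= 2^-1 * (a `^ q + b `^ q).
Proof.
move=> a0 b0 q1.
rewrite !mulrDr {2 4}(_ : 2^-1 = 1 - 2^-1); last by field.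
by apply: (convex_powR q1 (Itv01 _ _)) => //=;
  rewrite ?inE/= ?in_itv/= ?a0 ?b0// ?invr_ge0// invf_le1 ?ler1n.
Qed.

Lemma le_powR_young a p t : 0 <= a -> 1 <= p -> 0 < t ->
  a <= t + t `^ (1 - p) * a `^ p.
Proof.
move=> a0 p1 t0; have [at1|ta] := leP a t.
  by apply: le_trans at1 _; rewrite lerDl mulr_ge0 ?powR_ge0.
apply: ler_wpDl; first exact: ltW.
have ap : 0 < a by exact: lt_trans ta.
rewrite -{1}(powRr1 a0) -{1}(subrK p 1) powRD; last by rewrite (gt_eqF ap) implybT.
apply: ler_wpM2r; first exact: powR_ge0.
rewrite -opprB !powRN lef_pV2 ?posrE ?powR_gt0//.
by apply: ge0_ler_powR; rewrite ?nnegrE ?subr_ge0//; exact: ltW.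
Qed.

Lemma powRK a p : 0 <= a -> p != 0 -> (a `^ p) `^ p^-1 = a.
Proof. by move=> a0 p0; rewrite -powRrM mulfV// powRr1. Qed.

Lemma powRVK a p : 0 <= a -> p != 0 -> (a `^ p^-1) `^ p = a.
Proof. by move=> a0 p0; rewrite -powRrM mulVf// powRr1. Qed.

Lemma powRV a p : 0 <= a -> a^-1 `^ p = (a `^ p)^-1.
Proof. by move=> a0; rewrite -powR_inv1// powRAC powR_inv1// powR_ge0. Qed.

Lemma cvg_powR (a_ : R ^nat) a p : 0 < p -> (forall k, 0 <= a_ k) ->
  a_ k @[k --> \oo] --> a -> (a_ k `^ p) @[k --> \oo] --> a `^ p.
Proof.
move=> p0 a_0 a_a.
have a0 : 0 <= a.
  by rewrite -(cvg_lim _ a_a)//; apply: limr_ge; [apply/cvg_ex; exists a|exact: nearW].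
have [{}a0|an0] := eqVneq a 0; last first.
  have cp : {for a, continuous (fun x : R => x `^ p)}.
    apply: differentiable_continuous; apply/derivable1_diffP.
    by apply: derivable_powR; rewrite in_itv/= andbT lt_def an0.
  exact: (continuous_cvg _ cp a_a).
rewrite a0 powR0 ?gt_eqF// in a_a *; apply/cvgrPdist_le => e e0.
have /cvgrPdist_lt/(_ (e `^ p^-1) (powR_gt0 _ e0)) := a_a.
apply: filterS => k; rewrite !sub0r !normrN (ger0_norm (a_0 k)) ger0_norm ?powR_ge0//.
move=> /ltW ae; rewrite -(powRVK (ltW e0) (lt0r_neq0 p0)).
by apply: ge0_ler_powR; rewrite ?nnegrE ?powR_ge0// ltW.
Qed.

End powR_inequalities.

Section measurable_vector_fields.
Variables (d : measure_display) (T : measurableType d) (R : realType) (n : nat).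
Implicit Types G H : T -> 'rV[R]_n.

Lemma measurable_fun_coord G i : measurable_fun setT G ->
  measurable_fun setT (fun x => G x 0 i).
Proof. exact: measurableT_comp (measurable_coord i). Qed.

Lemma measurable_funZ_rV (a : R) G : measurable_fun setT G ->
  measurable_fun setT (fun x => a *: G x).
Proof.
move=> mG; apply: measurable_fun_rV => i; under eq_fun do rewrite mxE.
by apply: measurable_funM => //; exact: measurable_fun_coord.
Qed.

Lemma measurable_funD_rV G H : measurable_fun setT G -> measurable_fun setT H ->
  measurable_fun setT (fun x => G x + H x).
Proof.
move=> mG mH; apply: measurable_fun_rV => i; under eq_fun do rewrite mxE.
by apply: measurable_funD; exact: measurable_fun_coord.
Qed.

Lemma measurable_funB_rV G H : measurable_fun setT G -> measurable_fun setT H ->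
  measurable_fun setT (fun x => G x - H x).
Proof.
move=> mG mH; apply: measurable_funD_rV => //.
by under eq_fun do rewrite -scaleN1r; exact: measurable_funZ_rV.
Qed.

End measurable_vector_fields.

Section energy.
Variables (R : realType) (n : nat).
Local Notation mu := (lebesgue_rV R n).
Implicit Types (G H : 'rV[R]_n -> 'rV[R]_n) (p : R).

Definition energy p G : \bar R := (\int[mu]_x (enorm (G x) `^ p)%:E)%E.

Lemma measurable_enorm_powR p G : measurable_fun setT G ->
  measurable_fun setT (fun x => enorm (G x) `^ p).
Proof.
move=> mG; apply: (measurableT_comp (measurable_powR p)).
exact: measurableT_comp (@measurable_enorm R n) mG.
Qed.

Lemma measurable_energy p G : measurable_fun setT G ->
  measurable_fun setT (fun x => (enorm (G x) `^ p)%:E).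
Proof. by move=> mG; apply/measurable_EFinP; exact: measurable_enorm_powR. Qed.

Lemma energy_ge0 p G : (0 <= energy p G)%E.
Proof. by apply: integral_ge0 => x _; rewrite lee_fin powR_ge0. Qed.

Lemma energyZ p a G : measurable_fun setT G ->
  energy p (fun x => a *: G x) = ((`|a| `^ p)%:E * energy p G)%E.
Proof.
move=> mG; rewrite /energy -ge0_integralZl//.
- by apply: eq_integral => x _; rewrite enormZ powRM// ?enorm_ge0.
- exact: measurable_energy.
- by move=> x _; rewrite lee_fin powR_ge0.
Qed.

Lemma eq_energy p G H : {ae mu, forall x, G x = H x} ->
  measurable_fun setT G -> measurable_fun setT H -> energy p G = energy p H.
Proof.
move=> GH mG mH; apply: ge0_ae_eq_integral => //.
- exact: measurable_energy.
- exact: measurable_energy.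
- by move=> x _; rewrite lee_fin powR_ge0.
- by move=> x _; rewrite lee_fin powR_ge0.
- by apply: filterS GH => x GHx _; rewrite GHx.
Qed.

Lemma clarkson_pointwise p (a b : 'rV[R]_n) : 2 <= p ->
  enorm (2^-1 *: a + 2^-1 *: b) `^ p + 2^-1 `^ p * enorm (a - b) `^ p <=
  2^-1 * (enorm a `^ p + enorm b `^ p).
Proof.
move=> p2.
have enorm_powRE (x : 'rV[R]_n) : enorm x `^ p = (enorm x ^+ 2) `^ (p / 2).
  rewrite -powR_mulrn ?enorm_ge0// -powRrM; congr (_ `^ _).
  by rewrite mulrC divfK.
have q1 : 1 <= p / 2 by rewrite ler_pdivlMr// mul1r.
have -> : 2^-1 `^ p * enorm (a - b) `^ p = enorm (2^-1 *: a - 2^-1 *: b) `^ p.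
  by rewrite -scalerBr enormZ ger0_norm ?invr_ge0// powRM ?enorm_ge0 ?invr_ge0.
rewrite !enorm_powRE; apply: le_trans (powR_superadditive _ _ q1) _; rewrite ?sqr_ge0//.
apply: le_trans _ (powR_midpoint _ _ q1); rewrite ?sqr_ge0//.
rewrite -!dotvv !(dotvZl, dotvZr, dotvDl, dotvDr, dotvNl, dotvNr) (dotvC b a).
by rewrite le_eqVlt; apply/orP; left; apply/eqP; congr (_ `^ _); field.
Qed.

Lemma energyD p G H : measurable_fun setT G -> measurable_fun setT H ->
  (energy p G + energy p H =
   \int[mu]_x (enorm (G x) `^ p + enorm (H x) `^ p)%:E)%E.
Proof.
move=> mG mH; under [RHS]eq_integral do rewrite EFinD.
apply/esym/ge0_integralD => //; try (by move=> x _; rewrite lee_fin powR_ge0);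
  exact: measurable_energy.
Qed.

Lemma clarkson p G H : 2 <= p -> measurable_fun setT G -> measurable_fun setT H ->
  (energy p (fun x => 2^-1 *: G x + 2^-1 *: H x)%R +
   (2^-1 `^ p)%:E * energy p (fun x => G x - H x)%R <=
   2^-1%:E * (energy p G + energy p H))%E.
Proof.
move=> p2 mG mH; have h0 : 0 <= 2^-1 :> R by rewrite invr_ge0.
have mM := measurable_funD_rV (measurable_funZ_rV 2^-1 mG) (measurable_funZ_rV 2^-1 mH).
have mB := measurable_funB_rV mG mH; have mD := measurable_funZ_rV 2^-1 mB.
have m_sum (K K' : 'rV[R]_n -> 'rV[R]_n) : measurable_fun setT K -> measurable_fun setT K' ->
    measurable_fun setT (fun x => enorm (K x) `^ p + enorm (K' x) `^ p).
  by move=> mK mK'; apply: measurable_funD; exact: measurable_enorm_powR.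
have sum_ge0 (a b : 'rV[R]_n) : 0 <= enorm a `^ p + enorm b `^ p by rewrite addr_ge0 ?powR_ge0.
have := energyZ p 2^-1 mB; rewrite ger0_norm// => <-.
rewrite [leLHS](energyD p mM mD) [X in (_ <= _ * X)%E](energyD p mG mH).
rewrite -ge0_integralZl//; last 2 first.
- by apply/measurable_EFinP; exact: m_sum.
- by move=> x _; rewrite lee_fin.
apply: ge0_le_integral => //.
- by move=> x _; rewrite lee_fin.
- by apply/measurable_EFinP; exact: m_sum.
- by apply/measurable_EFinP; apply: measurable_funM => //; exact: m_sum.
move=> x _; rewrite -EFinM lee_fin [enorm (_ *: (_ - _))]enormZ powRM ?enorm_ge0//.
by rewrite ger0_norm// clarkson_pointwise.
Qed.

Lemma energy_sub_le_of_midpoint p (m d : R) G H : 2 <= p ->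
  measurable_fun setT G -> measurable_fun setT H ->
  (energy p G <= (m + d)%:E)%E -> (energy p H <= (m + d)%:E)%E ->
  ((m - d)%:E <= energy p (fun x => 2^-1 *: G x + 2^-1 *: H x)%R)%E ->
  (energy p (fun x => G x - H x)%R <= (2 `^ p * (2 * d))%:E)%E.
Proof.
move=> p2 mG mH Gd Hd GHd; have p20 : 0 < 2 `^ p :> R by exact: powR_gt0.
have : (2^-1%:E * (energy p G + energy p H) <= (m + d)%:E)%E.
  apply: (@le_trans _ _ (2^-1%:E * ((m + d)%:E + (m + d)%:E))%E).
    by rewrite lee_wpmul2l ?lee_fin ?invr_ge0// (leeD Gd Hd).
  by rewrite -EFinD -EFinM lee_fin le_eqVlt; apply/orP; left; apply/eqP; field.
move=> /(le_trans (clarkson p2 mG mH)) /(le_trans (leeD2r _ GHd)).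
rewrite -leeBrDl// -EFinB powRV// lee_pdivrMl//.
rewrite -EFinM => /le_trans; apply; rewrite lee_fin.
by rewrite (_ : m + d - (m - d) = 2 * d)//; ring.
Qed.

End energy.

(** * Weak gradients *)

Section local_integrability.
Variables (R : realType) (n : nat).
Local Notation mu := (lebesgue_rV R n).
Implicit Types (f g u : 'rV[R]_n -> R) (K : set 'rV[R]_n) (L M : R).

Lemma compact_lty K : compact K -> (mu K < +oo)%E.
Proof.
move=> cK; have [L KL] := compact_sub_normball cK.
apply: le_lt_trans (normball_lty n L); apply: le_measure; rewrite ?inE//.
  exact: compact_measurable_rV.
exact: measurable_normball.
Qed.

Lemma loc_integrableP g : loc_integrable g <-> measurable_fun setT g /\
  forall K, compact K -> mu.-integrable K (EFin \o g).
Proof.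
split=> -[mg gK]; split=> // K cK; last by have /integrableP[] := gK K cK.
apply/integrableP; split; last exact: gK.
by apply/measurable_EFinP; exact: measurable_funS mg.
Qed.

Lemma integrable_cst_compact K (c : R) : compact K -> mu.-integrable K (fun=> c%:E).
Proof.
move=> cK; apply: (@measurable_bounded_integrable _ _ _ _ (cst c)) => //.
- exact: compact_measurable_rV.
- exact: compact_lty.
- by exists `|c|; split=> // x cx y _; exact: ltW.
Qed.

Lemma loc_integrable_continuous u : continuous u -> loc_integrable u.
Proof.
move=> cu; apply/loc_integrableP; split=> [|K cK].
  exact: continuous_measurable_rV.
have : compact (u @` K).
  by apply: continuous_compact => //; exact: continuous_subspaceT.
move=> /compact_bounded/pinfty_ex_gt0[M _ uM].
apply: measurable_bounded_integrable.
- exact: compact_measurable_rV.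
- exact: compact_lty.
- by apply: measurable_funS (continuous_measurable_rV cu).
- exists M; split=> [|N MN x Kx]; first exact: num_real.
  by apply: le_trans (ltW MN); apply: uM; exists x.
Qed.

Lemma loc_integrable_lin a b g f : loc_integrable g -> loc_integrable f ->
  loc_integrable (fun x => a * g x + b * f x).
Proof.
move=> /loc_integrableP[mg gK] /loc_integrableP[mf fK].
apply/loc_integrableP; split=> [|K cK].
  by apply: measurable_funD; exact: measurable_funM.
have mK := compact_measurable_rV cK.
have := integrableD mK (integrableZl mK a (gK _ cK)) (integrableZl mK b (fK _ cK)).
by apply: eq_integrable => // x _ /=; rewrite EFinD !EFinM.
Qed.

Lemma integrable_mul_compact_support g f M L : loc_integrable g ->
  measurable_fun setT f -> (forall x, `|f x| <= M) ->
  (forall x, L < `|x| -> f x = 0) ->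
  mu.-integrable setT (fun x => (g x * f x)%:E).
Proof.
move=> /loc_integrableP[mg gK] mf fM fL.
have mB := @measurable_normball R n L.
have := integrableZl mB M (gK _ (@compact_normball R n L)).
rewrite (integrable_mkcond _ mB); apply: le_integrable => //.
  by apply/measurable_EFinP; exact: measurable_funM.
move=> x _; rewrite patchE; case: ifPn => [_|/negP xL].
  change (`|g x * f x|%:E <= `|M * g x|%:E)%E.
  rewrite lee_fin !normrM mulrC; apply: ler_wpM2r => //.
  exact: le_trans (fM x) (ler_norm _).
by rewrite fL ?mulr0 ?abse0 ?abse_ge0// ltNge; apply/negP => xB; apply: xL; rewrite inE.
Qed.

Lemma integrable_mul_test g f : loc_integrable g -> test_function f ->
  mu.-integrable setT (fun x => (g x * f x)%:E).
Proof.
move=> lg tf; have [M _ fM] := test_function_bounded tf.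
have [_ [L _ fL]] := (test_functionP f).1 tf.
by apply: integrable_mul_compact_support fM fL => //; exact: measurable_test_function.
Qed.

Lemma loc_integrable_energy p (G : 'rV[R]_n -> 'rV[R]_n) i : 1 <= p ->
  measurable_fun setT G -> (energy p G < +oo)%E ->
  loc_integrable (fun x => G x 0 i).
Proof.
move=> p1 mG Goo; have mGi := measurable_fun_coord i mG.
apply/loc_integrableP; split=> // K cK; have mK := compact_measurable_rV cK.
have iG : mu.-integrable K (fun x => (enorm (G x) `^ p)%:E).
  apply: (integrableS measurableT mK (subsetT _)); apply/integrableP.
  split; first exact: measurable_energy.
  by under eq_integral do rewrite gee0_abs ?lee_fin ?powR_ge0//.
have := integrableD mK (integrable_cst_compact 1 cK) iG; apply: le_integrable => //.
  by apply/measurable_EFinP; exact: measurable_funS mGi.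
move=> x _ /=; rewrite lee_fin [leRHS]ger0_norm ?addr_ge0 ?powR_ge0//.
apply: le_trans (norm_coord_le_enorm _ _) _.
by have := le_powR_young (enorm_ge0 (G x)) p1 ltr01; rewrite powR1 mul1r.
Qed.

End local_integrability.

Section weak_gradients.
Variables (R : realType) (n : nat).
Local Notation mu := (lebesgue_rV R n).
Implicit Types (f g h u v : 'rV[R]_n -> R) (G H : 'rV[R]_n -> 'rV[R]_n).
Implicit Types (L M e : R).

Definition pairing u f : R := \int[mu]_x (u x * f x).

Lemma EFin_pairing u f : loc_integrable u -> test_function f ->
  (\int[mu]_x (u x * f x)%:E = (pairing u f)%:E)%E.
Proof.
move=> lu tf; rewrite fineK// (integrable_fin_num measurableT)//.
exact: integrable_mul_test.
Qed.

Lemma pairing_lin a b u v f : loc_integrable u -> loc_integrable v ->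
  test_function f ->
  pairing (fun x => a * u x + b * v x) f = a * pairing u f + b * pairing v f.
Proof.
move=> lu lv tf.
have iu := integrable_mul_test lu tf; have iv := integrable_mul_test lv tf.
rewrite /pairing -!RintegralZl// -RintegralD//; last 2 first.
- exact: (integrableZl measurableT a iu).
- exact: (integrableZl measurableT b iv).
by apply: eq_Rintegral => x _; ring.
Qed.

Lemma pairingB u v f : loc_integrable u -> loc_integrable v -> test_function f ->
  pairing (fun x => u x - v x) f = pairing u f - pairing v f.
Proof.
move=> lu lv tf; have := pairing_lin 1 (-1) lu lv tf.
by rewrite mul1r mulN1r; under eq_fun do rewrite mul1r mulN1r.
Qed.

Lemma pairingBr u f g : loc_integrable u -> test_function f -> test_function g ->
  pairing u (fun x => f x - g x) = pairing u f - pairing u g.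
Proof.
move=> lu tf tg.
rewrite /pairing -RintegralB//; [|exact: integrable_mul_test..].
by apply: eq_Rintegral => x _; rewrite mulrBr.
Qed.

Lemma Rintegral_sum (I : Type) (r : seq I) (c : I -> R) (F : I -> 'rV[R]_n -> R) :
  (forall j, mu.-integrable setT (EFin \o F j)) ->
  \int[mu]_x (\sum_(j <- r) c j * F j x) = \sum_(j <- r) c j * \int[mu]_x F j x.
Proof.
move=> iF; rewrite /Rintegral.
under eq_integral do rewrite -sumEFin.
have icF j := integrableZl measurableT (c j) (iF j).
rewrite integral_sum// (eq_bigr (fun j => (c j * \int[mu]_x F j x)%:E)) ?sumEFin//.
move=> j _; rewrite -RintegralZl// fineK//.
exact: (integrable_fin_num measurableT (icF j)).
Qed.

Lemma pairing_sum (I : Type) (r : seq I) (c : I -> R) (F f : I -> 'rV[R]_n -> R) :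
  (forall j, loc_integrable (F j)) -> (forall j, test_function (f j)) ->
  \int[mu]_x (\sum_(j <- r) c j * (F j x * f j x)) =
  \sum_(j <- r) c j * pairing (F j) (f j).
Proof. by move=> lF tf; apply: Rintegral_sum => j; exact: integrable_mul_test. Qed.

Lemma weak_partialP u i g : loc_integrable u -> weak_partial u i g <->
  loc_integrable g /\
  forall f, test_function f -> pairing u (partial i f) = - pairing g f.
Proof.
move=> lu; split=> -[lg ug]; split=> // f tf; have tf' := test_function_partial i tf.
  by apply: EFin_inj; rewrite EFinN -!EFin_pairing// ug.
by rewrite !EFin_pairing// ug.
Qed.

Lemma weak_partial_lin a b u v i g h : loc_integrable u -> loc_integrable v ->
  weak_partial u i g -> weak_partial v i h ->
  weak_partial (fun x => a * u x + b * v x) i (fun x => a * g x + b * h x).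
Proof.
move=> lu lv /(weak_partialP _ _ lu)[lg ug] /(weak_partialP _ _ lv)[lh vh].
apply/(weak_partialP _ _ (loc_integrable_lin a b lu lv)).
split=> [|f tf]; first exact: loc_integrable_lin.
have tf' := test_function_partial i tf.
by rewrite !pairing_lin// ug// vh//; ring.
Qed.

Lemma weak_gradient_lin a b u v G H : continuous u -> continuous v ->
  weak_gradient u G -> weak_gradient v H ->
  weak_gradient (fun x => a * u x + b * v x) (fun x => a *: G x + b *: H x).
Proof.
move=> cu cv uG vH i; under [X in weak_partial _ _ X]eq_fun do rewrite !mxE.
by apply: weak_partial_lin => //; exact: loc_integrable_continuous.
Qed.

Lemma weak_gradientZ c u G : continuous u -> weak_gradient u G ->
  weak_gradient (fun x => c * u x) (fun x => c *: G x).
Proof.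
move=> cu uG; have := weak_gradient_lin c 0 cu cu uG uG.
under [X in weak_gradient X]eq_fun do rewrite mul0r addr0.
by under [X in weak_gradient _ X]eq_fun do rewrite scale0r addr0.
Qed.

Lemma weak_gradientB u v G H : continuous u -> continuous v ->
  weak_gradient u G -> weak_gradient v H ->
  weak_gradient (fun x => u x - v x) (fun x => G x - H x).
Proof.
move=> cu cv uG vH; have := weak_gradient_lin 1 (-1) cu cv uG vH.
under [X in weak_gradient X]eq_fun do rewrite mul1r mulN1r.
by under [X in weak_gradient _ X]eq_fun do rewrite scale1r scaleN1r.
Qed.

Lemma measurable_weak_gradient u G : weak_gradient u G -> measurable_fun setT G.
Proof. by move=> uG; apply: measurable_fun_rV => i; have [[]] := uG i. Qed.

Lemma norm_pairing_le u f M L e : loc_integrable u -> measurable_fun setT f ->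
  (forall x, `|f x| <= M) -> (forall x, L < `|x| -> f x = 0) ->
  (forall x, `|x| <= L -> `|u x| <= e) ->
  `|pairing u f| <= M * e * fine (mu (@normball R n L)).
Proof.
move=> lu mf fM fL ue; have iuf := integrable_mul_compact_support lu mf fM fL.
have mB := @measurable_normball R n L; have cB := @compact_normball R n L.
have ufB : pairing u f = \int[mu]_(x in @normball R n L) (u x * f x).
  rewrite [RHS]Rintegral_mkcond; apply: eq_Rintegral => x _; rewrite patchE.
  case: ifPn => // /negP xL; rewrite fL ?mulr0// ltNge.
  by apply/negP => xB; apply: xL; rewrite inE.
have iB : mu.-integrable (@normball R n L) (fun x => (u x * f x)%:E).
  exact: integrableS iuf.
rewrite ufB; apply: le_trans (le_normr_Rintegral mB iB) _.
rewrite -Rintegral_cst//; apply: le_Rintegral => //.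
- exact: (integrable_norm iB).
- exact: integrable_cst_compact.
by move=> x xL; rewrite normrM mulrC ler_pM// ue.
Qed.

Lemma norm_pairing_le_energy p G f i M L e : 1 <= p -> measurable_fun setT G ->
  measurable_fun setT f -> (forall x, `|f x| <= M) ->
  (forall x, L < `|x| -> f x = 0) -> 0 < e -> (energy p G <= (e `^ p)%:E)%E ->
  `|pairing (fun x => G x 0 i) f| <= M * e * (fine (mu (@normball R n L)) + 1).
Proof.
move=> p1 mG mf fM fL e0 Ge; have mB := @measurable_normball R n L.
have M0 : 0 <= M by apply: le_trans (fM 0).
have Goo : (energy p G < +oo)%E by exact: le_lt_trans Ge (ltry _).
have iGf := integrable_mul_compact_support (loc_integrable_energy i p1 mG Goo) mf fM fL.
have mE := measurable_energy p mG.
have I0 x : (0 <= (enorm (G x) `^ p)%:E)%E by rewrite lee_fin powR_ge0.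
pose c := M * e `^ (1 - p); have c0 : 0 <= c by rewrite mulr_ge0 ?powR_ge0.
have Me : 0 <= M * e by rewrite mulr_ge0// ltW.
have leG : (\int[mu]_x `|(G x 0 i * f x)%:E| <=
    \int[mu]_x ((M * e)%:E * (\1_(@normball R n L) x)%:E + c%:E * (enorm (G x) `^ p)%:E))%E.
  apply: ge0_le_integral => //.
  - apply/measurable_EFinP; apply: measurableT_comp => //.
    by apply: measurable_funM => //; exact: measurable_fun_coord.
  - apply: emeasurable_funD; apply: emeasurable_funM => //.
    by apply/measurable_EFinP; exact: measurable_indic.
  move=> x _; rewrite -!EFinM -EFinD lee_fin normrM; have [xL|Lx] := leP `|x| L.
    rewrite indicE mem_set// mulr1 mulrC -mulrA -mulrDr; apply: ler_pM => //.
    apply: le_trans (norm_coord_le_enorm _ _) _.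
    by apply: le_powR_young => //; exact: enorm_ge0.
  by rewrite fL// normr0 mulr0 addr_ge0// mulr_ge0// powR_ge0.
have := le_trans (le_abse_integral mu measurableT (measurable_int _ iGf)) leG.
rewrite -EFin_normr_Rintegral// ge0_integralD//; last 4 first.
- by move=> x _; rewrite mule_ge0.
- by apply: emeasurable_funM => //; apply/measurable_EFinP; exact: measurable_indic.
- by move=> x _; rewrite mule_ge0.
- exact: emeasurable_funM.
rewrite !ge0_integralZl//; last by apply/measurable_EFinP; exact: measurable_indic.
rewrite integral_indic// setIT => /le_trans Gf.
rewrite -lee_fin; apply: Gf; rewrite mulrDr mulr1 EFinD; apply: leeD.
  by rewrite [leRHS]EFinM fineK// ge0_fin_numE// normball_lty.
apply: le_trans (lee_wpmul2l _ Ge) _ => //.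
rewrite -EFinM lee_fin /c -mulrA -powRD; last by rewrite (gt_eqF e0) implybT.
by rewrite subrK powRr1// ltW.
Qed.

End weak_gradients.

Section weak_gradient_affine.
Variables (R : realType) (n : nat) (s : R) (O : 'M[R]_n) (a : 'rV[R]_n).
Local Notation mu := (lebesgue_rV R n).
Implicit Types (u : 'rV[R]_n -> R) (G : 'rV[R]_n -> 'rV[R]_n).
Hypotheses (s0 : 0 < s) (OO : O *m O^T = 1%:M).
Let A (x : 'rV[R]_n) : 'rV[R]_n := s *: (x *m O) + a.
Let Ainv (y : 'rV[R]_n) : 'rV[R]_n := s^-1 *: (y *m O^T) + (- s^-1 *: (a *m O^T)).

Let AK : cancel A Ainv.
Proof.
move=> x; rewrite /A /Ainv mulmxDl scalerDr -scalemxAl scalerA mulVf ?gt_eqF// scale1r.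
by rewrite -mulmxA OO mulmx1 scaleNr addrK.
Qed.

Lemma energy_affine p G : measurable_fun setT G ->
  energy p (fun x => s *: (G (A x) *m O^T)) =
  ((s `^ (p - n%:R))%:E * energy p G)%E.
Proof.
move=> mG; have sn0 := lt0r_neq0 s0.
have OtO : O^T *m O^T^T = 1%:M by rewrite trmxK; exact: mulmx1C.
have mGA : measurable_fun setT (fun x => G (A x) *m O^T).
  apply: measurableT_comp (measurable_mulmx O^T) _.
  exact: measurableT_comp mG (measurable_affine_map s O a).
rewrite [LHS](energyZ p s mGA) (gtr0_norm s0).
have -> : energy p (fun x => G (A x) *m O^T) = energy p (fun x => G (A x)).
  by apply: eq_integral => x _; rewrite enorm_mulmx.
have := @ge0_integral_affine R n s O a sn0 OO (fun x => (enorm (G x) `^ p)%:E)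
  (measurable_energy p mG) (fun x => _).
rewrite (gtr0_norm s0) -/(energy p G) => <-; last by move=> x; rewrite lee_fin powR_ge0.
rewrite muleA -EFinM -powR_mulrn ?(ltW s0)// -powRD ?subrK//.
by rewrite sn0 implybT.
Qed.

Lemma pairing_sum_affine (I : Type) (r : seq I) (c : I -> R)
    (F f : I -> 'rV[R]_n -> R) :
  (forall j, loc_integrable (F j)) -> (forall j, test_function (f j)) ->
  \int[mu]_x (\sum_(j <- r) c j * (F j (A x) * f j (A x))) =
  s ^- n * \sum_(j <- r) c j * pairing (F j) (f j).
Proof.
move=> lF tf; rewrite -pairing_sum// -{1}(gtr0_norm s0).
rewrite -(@Rintegral_affine R n s O a (lt0r_neq0 s0) OO)//.
have := integrable_sum measurableT r (P := xpredT)
  (fun j _ => integrableZl measurableT (c j) (integrable_mul_test (lF j) (tf j))).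
by apply: eq_integrable => // x _; rewrite sumEFin.
Qed.

Lemma weak_gradient_affine p u G : 1 <= p -> continuous u ->
  weak_gradient u G -> (energy p G < +oo)%E ->
  weak_gradient (u \o A) (fun x => s *: (G (A x) *m O^T)).
Proof.
move=> p1 cu uG Goo i; have mG := measurable_weak_gradient uG.
have lu := loc_integrable_continuous cu.
have luA : loc_integrable (u \o A).
  by apply: loc_integrable_continuous; exact: continuous_comp_affine.
apply/(weak_partialP _ _ luA); split=> [|f tf].
  apply: (loc_integrable_energy i p1).
    apply: measurable_funZ_rV; apply: measurableT_comp (measurable_mulmx O^T) _.
    exact: measurableT_comp mG (measurable_affine_map s O a).
  by rewrite energy_affine// lte_mul_pinfty// lee_fin powR_ge0.
pose g := f \o Ainv; have fE x : f x = g (A x) by rewrite /g/= AK.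
have tg : test_function g.
  apply: (@test_function_comp_affine _ _ s^-1 O^T O _ f) => //.
    by rewrite invr_eq0 gt_eqF.
  exact: mulmx1C.
have C1g : C1 g by have [/(_ [::])] := tg.
have pfE x : partial i f x = \sum_(j < n) (s * O i j) * partial j g (A x).
  have -> : f = g \o A by apply/funext.
  by have [_] := is_derive_comp_affine s O a i x C1g.
transitivity (s ^- n * \sum_(j < n) (s * O i j) * pairing u (partial j g)).
  rewrite -pairing_sum_affine//; last by move=> j; exact: test_function_partial.
  apply: eq_Rintegral => x _; rewrite pfE mulr_sumr.
  by apply: eq_bigr => j _; rewrite mulrCA.
transitivity (- (s ^- n * \sum_(j < n) (s * O i j) * pairing (fun x => G x 0 j) g)).
  rewrite -mulrN -sumrN; congr (_ * _); apply: eq_bigr => j _.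
  by have /(weak_partialP _ _ lu)[_ ->//] := uG j; rewrite mulrN.
rewrite -pairing_sum_affine//; last by move=> j; have [] := uG j.
congr (- _); apply: eq_Rintegral => x _; rewrite fE !mxE mulr_sumr mulr_suml.
by apply: eq_bigr => j _; rewrite !mxE; ring.
Qed.

End weak_gradient_affine.

Section box_approximation.
Variables (R : realType) (n : nat).
Implicit Types (a b : 'I_n -> R) (c t : R).

Definition steep_step c (m : nat) t : R := smooth_step (m.+1%:R * (t - c)).

Lemma smoothR_steep_step c m : smoothR (steep_step c m).
Proof.
have := smoothR_comp_affine 1 m.+1%:R (- (m.+1%:R * c)) (@smoothR_smooth_step R).
by under eq_fun do rewrite mul1r -mulrBr.
Qed.

Lemma steep_step_le c m t : t <= c -> steep_step c m t = 0.
Proof. by move=> tc; rewrite /steep_step smooth_step_le0// mulr_ge0_le0// subr_le0. Qed.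

Lemma steep_step_ge c m t : 1 <= m.+1%:R * (t - c) -> steep_step c m t = 1.
Proof. exact: smooth_step_ge1. Qed.

Lemma steep_step_near c t : \forall m \near \oo, steep_step c m t = (c < t)%R%:R.
Proof.
have [tc|ct] := leP t c; first by near=> m; rewrite steep_step_le.
near=> m; rewrite steep_step_ge// -ler_pdivrMr ?subr_gt0// div1r.
rewrite (@le_trans _ _ m%:R)// ?ler_nat//.
by near: m; exact: nbhs_infty_ger.
Unshelve. all: by end_near. Qed.

Definition box_profile a b m (i : 'I_n) t := steep_step (a i) m t - steep_step (b i) m t.

Definition box_approx a b m : 'rV[R]_n -> R := tensor (box_profile a b m).

Definition box_radius a b : R := `|\row_i a i : 'rV[R]_n| + `|\row_i b i : 'rV[R]_n| + 1.

Lemma box_radius_ge0 a b : 0 <= box_radius a b.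
Proof. by rewrite /box_radius !addr_ge0. Qed.

Lemma smoothR_box_profile a b m i : smoothR (box_profile a b m i).
Proof.
apply: smoothRD; first exact: smoothR_steep_step.
have := smoothR_comp_affine (-1) 1 0 (smoothR_steep_step (b i) m).
by under eq_fun do rewrite mulN1r mul1r addr0.
Qed.

Lemma box_profile_eq0 a b m i t : box_radius a b < `|t| -> box_profile a b m i t = 0.
Proof.
have := norm_coord_le (\row_i a i) i; have := norm_coord_le (\row_i b i) i.
rewrite !mxE !ler_norml /box_radius => /andP[b1 b2] /andP[a1 a2] Lt.
have := normr_ge0 (\row_i a i : 'rV[R]_n); have := normr_ge0 (\row_i b i : 'rV[R]_n).
move=> b0 a0; have m1 : (1 : R) <= m.+1%:R by rewrite ler1n.
rewrite /box_profile; have [t0|t0] := leP 0 t.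
  rewrite ger0_norm// in Lt.
  by rewrite !steep_step_ge ?subrr//; apply: mulr_ege1 => //; lra.
rewrite ltr0_norm// in Lt.
by rewrite !steep_step_le ?subr0//; lra.
Qed.

Lemma norm_box_profile_le1 a b m i t : `|box_profile a b m i t| <= 1.
Proof.
rewrite /box_profile /steep_step ler_norml.
have := smooth_step_ge0 (m.+1%:R * (t - a i)); have := smooth_step_le1 (m.+1%:R * (t - a i)).
have := smooth_step_ge0 (m.+1%:R * (t - b i)); have := smooth_step_le1 (m.+1%:R * (t - b i)).
by move=> *; apply/andP; split; lra.
Qed.

Lemma test_function_box_approx a b m : test_function (box_approx a b m).
Proof.
apply: test_function_tensor (box_radius_ge0 a b) _ _ => i.
  exact: smoothR_box_profile.
exact: box_profile_eq0.
Qed.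

Lemma norm_box_approx_le a b m x :
  `|box_approx a b m x| <= \1_(@normball R n (box_radius a b)) x.
Proof.
rewrite indicE; have [xL|Lx] := leP `|x| (box_radius a b).
  rewrite mem_set//=; apply: le_trans (norm_tensor_le x (norm_box_profile_le1 a b m)) _.
  by rewrite expr1n.
rewrite /box_approx (tensor_eq0 (box_radius_ge0 a b) _ Lx) ?normr0//.
exact: box_profile_eq0.
Qed.

Lemma box_approx_near a b x : (forall i, a i <= b i) ->
  \forall m \near \oo, box_approx a b m x = \1_(ocbox a b) x.
Proof.
move=> ab; have : \forall m \near \oo, forall i,
    box_profile a b m i (x 0 i) = (a i < x 0 i)%R%:R - (b i < x 0 i)%R%:R.
  apply: filter_forall => i; near=> m; congr (_ - _).
    by near: m; exact: steep_step_near.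
  by near: m; exact: steep_step_near.
apply: filterS => m xm; rewrite /box_approx /tensor (eq_bigr _ (fun i _ => xm i)) indicE.
have [xab|/negP xab] := boolP (x \in ocbox a b).
  rewrite big1// => i _; move: xab => /set_mem/(_ i)/=; rewrite in_itv/=.
  by move=> /andP[-> xb]; rewrite ltNge xb subr0.
have [i xi] : exists i, ~~ (a i < x 0 i <= b i).
  apply/not_existsP => xi; apply: xab; apply/mem_set => i /=.
  by rewrite in_itv/=; apply/negPn/negP; exact: xi.
rewrite (bigD1 i)//= (_ : _%:R - _ = 0) ?mul0r//.
move: xi; rewrite negb_and -leNgt -ltNge => /orP[xa|xb].
  by rewrite ltNge xa/= ltNge (le_trans xa)// subr0.
by rewrite xb (le_lt_trans (ab i) xb) subrr.
Unshelve. all: by end_near. Qed.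

End box_approximation.

Section density_measure.
Local Open Scope ereal_scope.
Context d (T : measurableType d) (R : realType) (mu : {measure set T -> \bar R}).
Variables (f : T -> \bar R).
Hypotheses (mf : measurable_fun setT f) (f0 : forall x, 0 <= f x).

Definition density_measure (A : set T) : \bar R := \int[mu]_(x in A) f x.

Let density0 : density_measure set0 = 0.
Proof. exact: integral_set0. Qed.

Let density_ge0 A : 0 <= density_measure A.
Proof. by apply: integral_ge0 => x _. Qed.

Let density_additive : semi_sigma_additive density_measure.
Proof. exact: semi_sigma_additive_nng_induced. Qed.

HB.instance Definition _ := isMeasure.Build _ _ _ density_measure
  density0 density_ge0 density_additive.

Definition measure_of_density : {measure set T -> \bar R} := density_measure.

End density_measure.

Section du_bois_reymond.
Variables (R : realType) (n : nat) (k : 'rV[R]_n -> R).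
Local Notation mu := (lebesgue_rV R n).
Hypothesis lk : loc_integrable k.

Let mk : measurable_fun setT (EFin \o k).
Proof. by apply/measurable_EFinP; case: lk. Qed.

Lemma integral_ocbox_eq0 a b : (forall f, test_function f -> pairing k f = 0) ->
  (\int[mu]_(x in ocbox a b) (k x)%:E = 0)%E.
Proof.
move=> kf; have [ab|/existsP[i ba]] := boolP [forall i, a i <= b i]; last first.
  rewrite (_ : ocbox a b = set0) ?integral_set0//.
  apply/seteqP; split => // x /(_ i) /=; rewrite in_itv/= => /andP[ax xb].
  by move/negP: ba; apply; exact/ltW/(lt_le_trans ax xb).
have {}ab i : a i <= b i by exact: (forallP ab).
pose one := \1_(@normball R n (box_radius a b)) : 'rV[R]_n -> R.
have mone : measurable_fun setT one by apply: measurable_indic; exact: measurable_normball.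
have ik : mu.-integrable setT (fun x => (`|k x * one x|)%:E).
  have : mu.-integrable setT (fun x => (k x * one x)%:E).
    apply: (@integrable_mul_compact_support R n k one 1 (box_radius a b)) => //.
    - by move=> x; rewrite /one indicE ger0_norm// lern1 leq_b1.
    - by move=> x Lx; rewrite /one indicE memNset//= => xL; move: Lx; rewrite ltNge xL.
  by move=> /integrable_abse.
have mB := measurable_ocbox a b; have mk' := (measurable_EFinP _ _).1 mk.
have [||||_ _] := @dominated_convergence _ _ _ mu setT measurableT
  (fun m x => (k x * box_approx a b m x)%:E) (fun x => (k x * \1_(ocbox a b) x)%:E)
  (fun x => (`|k x * one x|)%:E) _ _ _ ik.
- move=> m; apply/measurable_EFinP; apply: measurable_funM => //.
  by apply: measurable_test_function; exact: test_function_box_approx.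
- apply/measurable_EFinP; apply: measurable_funM => //; exact: measurable_indic.
- apply: aeW => x _; apply: cvg_near_cst; have := @box_approx_near R n a b x ab.
  by apply: filterS => m ->.
- apply: aeW => x m _; rewrite /= lee_fin !normrM ler_wpM2l//.
  by rewrite (le_trans (norm_box_approx_le _ _ _ _))// ler_norm.
have kf0 m : (\int[mu]_x (k x * box_approx a b m x)%:E = 0)%E.
  by rewrite EFin_pairing ?kf//; exact: test_function_box_approx.
under eq_fun do rewrite kf0.
move=> /(cvg_lim (@ereal_hausdorff R)); rewrite lim_cst// => lim0.
rewrite integral_mkcond [RHS]lim0; apply: eq_integral => x _.
by rewrite patchE indicE; case: ifPn => _; rewrite ?mulr1 ?mulr0.
Qed.

Lemma integrable_ocbox a b : mu.-integrable (ocbox a b) (EFin \o k).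
Proof.
have /loc_integrableP[_ /(_ _ (@compact_normball R n (box_radius a b)))] := lk.
apply: integrableS; [exact: measurable_normball|exact: measurable_ocbox|].
move=> x xab; apply: rV_norm_le (box_radius_ge0 a b) _ => i; have := xab i.
have := norm_coord_le (\row_i a i) i; have := norm_coord_le (\row_i b i) i.
rewrite !mxE !ler_norml /box_radius /= in_itv/=.
have := normr_ge0 (\row_i a i : 'rV[R]_n); have := normr_ge0 (\row_i b i : 'rV[R]_n).
by move=> ? ? /andP[? ?] /andP[? ?] /andP[? ?]; apply/andP; split; lra.
Qed.

Lemma integral_funepos_funeneg A :
  (forall a b, (\int[mu]_(x in ocbox a b) (k x)%:E = 0)%E) -> measurable A ->
  (\int[mu]_(x in A) (EFin \o k)^\+ x = \int[mu]_(x in A) (EFin \o k)^\- x)%E.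
Proof.
move=> kab.
pose mp := measure_of_density mu (measurable_funepos mk) (@funepos_ge0 _ _ (EFin \o k)).
pose mn := measure_of_density mu (measurable_funeneg mk) (@funeneg_ge0 _ _ (EFin \o k)).
have poo a b : (mp (ocbox a b) < +oo)%E.
  by apply: integral_funepos_lt_pinfty; [exact: measurable_ocbox|exact: integrable_ocbox].
have noo a b : (mn (ocbox a b) < +oo)%E.
  by apply: integral_funeneg_lt_pinfty; [exact: measurable_ocbox|exact: integrable_ocbox].
apply: (@ocbox_measure_unique R n mp mn _ poo) => a b.
have pn : (mp (ocbox a b) - mn (ocbox a b) = 0)%E by rewrite -(kab a b) [RHS]integralE.
move: (poo a b) (noo a b) (measure_ge0 mp (ocbox a b)) (measure_ge0 mn (ocbox a b)) pn.
case: (mp _) => [x| |]// _; case: (mn _) => [y| |]// _ _ _.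
by rewrite -EFinB => -[] /eqP; rewrite subr_eq0 => /eqP ->.
Qed.

Theorem du_bois_reymond : (forall f, test_function f -> pairing k f = 0) ->
  {ae mu, forall x, k x = 0}.
Proof.
move=> kf; have kA := integral_funepos_funeneg (fun a b => integral_ocbox_eq0 a b kf).
have k0 (N : nat) : {ae mu, forall x, normball N%:R x -> k x = 0}.
  have mN := @measurable_normball R n N%:R.
  have /loc_integrableP[_ /(_ _ (@compact_normball R n N%:R)) iN] := lk.
  have := integral_ae_eq mN (integrable_funepos mN iN) _ (fun E _ mE => kA E mE).
  move=> /(_ (measurable_funTS (measurable_funeneg mk))).
  apply: filterS => x pn /pn; rewrite funeposE funenegE /= => /eqP.
  rewrite -!EFin_max eqe /Num.max.
  by case: (ltP (k x) 0); case: (ltP (- k x) 0) => ? ? /eqP; lra.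
have := ae_foralln k0; apply: filterS => x k0x.
by apply: (k0x (Num.truncn `|x|).+1); apply: ltW; exact: truncnS_gt.
Qed.

End du_bois_reymond.

Section weak_gradient_uniqueness.
Variables (R : realType) (n : nat).
Local Notation mu := (lebesgue_rV R n).
Implicit Types u g h : 'rV[R]_n -> R.

Lemma weak_partial_unique u i g h :
  weak_partial u i g -> weak_partial u i h -> {ae mu, forall x, g x = h x}.
Proof.
move=> [lg ug] [lh uh].
have : {ae mu, forall x, 1 * g x + -1 * h x = 0}.
  apply: du_bois_reymond => [|f tf]; first exact: loc_integrable_lin.
  have := ug f tf; rewrite uh// !EFin_pairing// => -[/oppr_inj gh].
  by rewrite pairing_lin// gh mul1r mulN1r subrr.
by apply: filterS => x; lra.
Qed.

Lemma weak_gradient_unique u G H :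
  weak_gradient u G -> weak_gradient u H -> {ae mu, forall x, G x = H x}.
Proof.
move=> uG uH; have : {ae mu, forall x, forall i, G x 0 i = H x 0 i}.
  by apply: filter_forall => i; exact: weak_partial_unique (uG i) (uH i).
by apply: filterS => x GH; apply/rowP.
Qed.

Lemma grad_normE (p : R) u G : 0 < p -> weak_gradient u G ->
  (grad_norm p u `^ p = energy p G)%E.
Proof.
move=> p0 uG; have ugu : weak_gradient u (gradient u).
  exact: (@xgetPex _ (cst 0) (weak_gradient u) (ex_intro _ G uG)).
have -> : (grad_norm p u `^ p = energy p (gradient u))%E.
  have pn0 : p != 0 by rewrite gt_eqF.
  rewrite /grad_norm (powR_Lnorm _ _ pn0).
  by apply: eq_integral => x _; rewrite /= ger0_norm ?enorm_ge0.
apply: eq_energy; first exact: weak_gradient_unique ugu uG.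
- exact: measurable_weak_gradient ugu.
- exact: measurable_weak_gradient uG.
Qed.

End weak_gradient_uniqueness.

Section sequences.
Variable R : realType.
Implicit Types (a b : R ^nat) (C q l p : R).

Lemma dist_cvg_le a b l : (forall j k, (j <= k)%N -> `|a j - a k| <= b j) ->
  a k @[k --> \oo] --> l -> forall k, `|a k - l| <= b k.
Proof.
move=> ab al k; have akl : `|a k - a j| @[j --> \oo] --> `|a k - l|.
  by apply: cvg_norm; apply: cvgB => //; exact: cvg_cst.
rewrite -(cvg_lim _ akl)//; apply: limr_le; first by apply/cvg_ex; eexists; exact: akl.
by exists k => // j /= kj; exact: ab.
Qed.

Lemma cvg_of_cauchy_rate a b : (forall j k, (j <= k)%N -> `|a j - a k| <= b j) ->
  b k @[k --> \oo] --> (0 : R) -> exists l, a k @[k --> \oo] --> l.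
Proof.
move=> ab b0; suff : cvgn a by move=> al; exists (limn a).
apply/cauchy_cvgP; apply: cauchy_exP => e e0.
have /cvgrPdist_lt/(_ e e0)[N _ HN] := b0.
exists (a N); exists N => // k /= Nk; rewrite /ball/=.
apply: le_lt_trans (ab N k Nk) _; apply: le_lt_trans (ler_norm _) _.
by have := HN N (leqnn N); rewrite sub0r normrN.
Qed.

Lemma geometric_cauchy_rate a C q : 0 <= q < 1 ->
  (forall k, `|a k - a k.+1| <= C * q ^+ k) ->
  forall j k, (j <= k)%N -> `|a j - a k| <= C / (1 - q) * q ^+ j.
Proof.
move=> /andP[q0 q1] aC j k jk.
have C0 : 0 <= C by have := aC 0%N; rewrite expr0 mulr1; exact: le_trans.
have q10 : 0 < 1 - q by rewrite subr_gt0.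
suff ajm m : `|a j - a (j + m)%N| <= C / (1 - q) * (q ^+ j - q ^+ (j + m)).
  rewrite -(subnKC jk); apply: le_trans (ajm _) _.
  by rewrite ler_wpM2l ?divr_ge0 ?(ltW q10)// gerBl exprn_ge0.
elim: m => [|m ih]; first by rewrite addn0 !subrr normr0 mulr0.
rewrite addnS -(subrK (a (j + m)%N) (a j)) -addrA.
apply: le_trans (ler_normD _ _) _; apply: le_trans (lerD ih (aC _)) _.
by rewrite exprS le_eqVlt; apply/orP; left; apply/eqP; field; rewrite gt_eqF.
Qed.

Lemma cvg_geometric0 C q : 0 <= q < 1 -> C * q ^+ k @[k --> \oo] --> (0 : R).
Proof. by move=> /andP[q0 q1]; apply: cvg_geometric; rewrite ger0_norm. Qed.

Lemma squeeze_dist a b l : (forall k, `|a k - l| <= b k) ->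
  b k @[k --> \oo] --> (0 : R) -> a k @[k --> \oo] --> l.
Proof.
move=> ab b0; apply/cvgrPdist_le => e e0; have /cvgrPdist_le/(_ e e0) := b0.
apply: filterS => k; rewrite sub0r normrN distrC => /(le_trans (ler_norm _)).
exact: le_trans (ab k).
Qed.

Lemma powR_ge0_lt1 q p : 0 <= q < 1 -> 0 < p -> 0 <= q `^ p < 1.
Proof.
move=> /andP[q0 q1] p0; rewrite powR_ge0 /=; apply: (@lt_le_trans _ _ (1 `^ p)).
  by apply: gt0_ltr_powR; rewrite ?nnegrE.
by rewrite powR1.
Qed.

Lemma powR_exprC q p k : 0 <= q -> (q ^+ k) `^ p = (q `^ p) ^+ k.
Proof.
by move=> q0; rewrite -powR_mulrn// -powRrM mulrC powRrM powR_mulrn ?powR_ge0.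
Qed.

Lemma half_ge0_lt1 : 0 <= (2^-1 : R) < 1.
Proof. by rewrite invr_ge0 ler0n invf_lt1// ltr1n. Qed.

End sequences.

Section sobolev_functions.
Variables (R : realType) (n : nat).
Implicit Types (u v : 'rV[R]_n -> R) (G H : 'rV[R]_n -> 'rV[R]_n) (p e : R).

Definition sobolev_le p e u := continuous u /\
  exists2 G, weak_gradient u G & (energy p G <= e%:E)%E.

Lemma sobolev_leW p e e' u : e <= e' -> sobolev_le p e u -> sobolev_le p e' u.
Proof.
move=> ee [cu [G uG Ge]]; split => //; exists G => //.
by apply: le_trans Ge _; rewrite lee_fin.
Qed.

Lemma sobolev_le_ge0 p e u : sobolev_le p e u -> 0 <= e.
Proof.
by move=> [_ [G _ Ge]]; rewrite -lee_fin; apply: le_trans Ge; exact: energy_ge0.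
Qed.

Lemma sobolev_leZ p e c u : sobolev_le p e u ->
  sobolev_le p (`|c| `^ p * e) (fun x => c * u x).
Proof.
move=> [cu [G uG Ge]]; split.
  by have := @continuous_lin R n c 0 _ _ cu cu; under eq_fun do rewrite mul0r addr0.
exists (fun x => c *: G x); first exact: weak_gradientZ.
by rewrite (energyZ p c (measurable_weak_gradient uG)) EFinM lee_wpmul2l// lee_fin powR_ge0.
Qed.

Lemma sobolev_leB p e u v G H : continuous u -> continuous v ->
  weak_gradient u G -> weak_gradient v H ->
  (energy p (fun x => G x - H x)%R <= e%:E)%E -> sobolev_le p e (fun x => u x - v x).
Proof.
move=> cu cv uG vH GHe; split.
  by have := @continuous_lin R n 1 (-1) _ _ cu cv; under eq_fun do rewrite mul1r mulN1r.
by exists (fun x => G x - H x) => //; exact: weak_gradientB.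
Qed.

Lemma sobolev_le_affine p e (s : R) (O : 'M[R]_n) (a : 'rV[R]_n) u : 1 <= p -> 0 < s ->
  O *m O^T = 1%:M -> sobolev_le p e u ->
  sobolev_le p (s `^ (p - n%:R) * e) (fun x => u (s *: (x *m O) + a)).
Proof.
move=> p1 s0 OO [cu [G uG Ge]]; split; first exact: continuous_comp_affine.
exists (fun x => s *: (G (s *: (x *m O) + a) *m O^T)).
  exact: (@weak_gradient_affine R n s O a s0 OO p u G p1 cu uG (le_lt_trans Ge (ltry _))).
rewrite (@energy_affine R n s O a s0 OO p G (measurable_weak_gradient uG)).
by rewrite EFinM lee_wpmul2l// lee_fin powR_ge0.
Qed.

Lemma sobolev_le_homothety p e (s : R) (a : 'rV[R]_n) u : 1 <= p -> 0 < s ->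
  sobolev_le p e u ->
  sobolev_le p (s `^ (p - n%:R) * e) (fun x => u (s *: x + a)).
Proof.
move=> p1 s0 ue.
have I1 : 1%:M *m (1%:M : 'M[R]_n)^T = 1%:M by rewrite trmx1 mulmx1.
have := sobolev_le_affine a p1 s0 I1 ue.
by under [X in sobolev_le _ _ X]eq_fun do rewrite mulmx1.
Qed.

End sobolev_functions.

(** * Morrey's inequality *)

Section hybrid_argument.
Variables (R : realType) (n : nat).
Local Notation mu := (lebesgue_rV R n).
Implicit Types (u : 'rV[R]_n -> R) (theta psi T : 'I_n -> R -> R) (L M : R).

Definition profile L M (phi : R -> R) :=
  [/\ smoothR phi, forall t, L < `|t| -> phi t = 0 & forall t, `|phi t| <= M].

Definition hybrid theta psi (k : nat) (i : 'I_n) := if (i < k)%N then psi i else theta i.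

Lemma partial_hybrid theta psi T (k : 'I_n) :
  (forall i, smoothR (theta i)) -> (forall i, smoothR (psi i)) -> smoothR (T k) ->
  (T k)^`()%classic = (fun t => theta k t - psi k t) ->
  partial k (tensor (fun i => if i == k then T i else hybrid theta psi k i)) =
  (fun x => tensor (hybrid theta psi k) x - tensor (hybrid theta psi k.+1) x).
Proof.
move=> sth spsi sT dT; rewrite partial_tensor => [|i]; last first.
  by rewrite /hybrid; case: ifP => [/eqP->//|_]; case: ifP.
apply/funext => x; rewrite /tensor (bigD1 k)//= [X in _ = X - _](bigD1 k)//=.
rewrite [X in _ = _ - X](bigD1 k)//= eqxx dT /hybrid ltnn ltnS leqnn.
rewrite mulrBl; congr (_ * _ - _ * _).
  by apply: eq_bigr => i ik; rewrite (negbTE ik).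
apply: eq_bigr => i ik; rewrite (negbTE ik) ltnS [in RHS]leq_eqVlt.
by rewrite val_eqE (negbTE ik).
Qed.

(* The difference of two product kernels is a divergence: exchange the factors
   one at a time, each exchange being a partial derivative. *)
Lemma norm_pairing_hybrid_le p u theta psi T M L : 1 <= p -> 0 <= L ->
  sobolev_le p 1 u -> (forall i, profile L M (theta i)) ->
  (forall i, profile L M (psi i)) -> (forall i, profile L M (T i)) ->
  (forall i, (T i)^`()%classic = (fun t => theta i t - psi i t)) ->
  `|pairing u (tensor theta) - pairing u (tensor psi)| <=
  n%:R * (M ^+ n * (fine (mu (@normball R n L)) + 1)).
Proof.
move=> p1 L0 [cu [G uG Ge]] pth ppsi pT dT.
have lu := loc_integrable_continuous cu.
have ph k i : profile L M (hybrid theta psi k i) by rewrite /hybrid; case: ifP.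
have th k : test_function (tensor (hybrid theta psi k)).
  by apply: (test_function_tensor L0) => i; have [] := ph k i.
pose I k := pairing u (tensor (hybrid theta psi k)).
have step (k : 'I_n) : `|I k - I k.+1| <= M ^+ n * (fine (mu (@normball R n L)) + 1).
  pose edge i := if i == k then T i else hybrid theta psi k i.
  have profile_edge i : profile L M (edge i) by rewrite /edge; case: ifP.
  have test_edge : test_function (tensor edge).
    by apply: (test_function_tensor L0) => i; have [] := profile_edge i.
  have /(weak_partialP _ _ lu)[_ /(_ _ test_edge)] := uG k.
  rewrite (partial_hybrid _ _ _ (dT k)); last 3 first.
  - by move=> i; have [] := pth i.
  - by move=> i; have [] := ppsi i.
  - by have [] := pT k.
  rewrite pairingBr// -/(I k) -/(I k.+1) => ->; rewrite normrN -[M ^+ n]mulr1.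
  apply: norm_pairing_le_energy p1 (measurable_weak_gradient uG) _ _ _ ltr01 _.
  - exact: measurable_test_function.
  - by move=> x; apply: norm_tensor_le => i t; have [] := profile_edge i.
  - by move=> x; apply: (tensor_eq0 L0) => i t; have [_ /(_ t)] := profile_edge i.
  - by rewrite powR1.
have -> : pairing u (tensor theta) - pairing u (tensor psi) =
    \sum_(k < n) (I k - I k.+1).
  have -> : tensor psi = tensor (hybrid theta psi n).
    by apply/funext => x; apply: eq_bigr => i _; rewrite /hybrid ltn_ord.
  rewrite -(big_mkord xpredT (fun k => I k - I k.+1)).
  rewrite (eq_bigr (fun k => - (I k.+1 - I k))); last by move=> k _; rewrite opprB.
  by rewrite sumrN telescope_sumr// opprB.
apply: le_trans (ler_norm_sum _ _ _) _.
apply: (@le_trans _ _ (\sum_(k < n) M ^+ n * (fine (mu (@normball R n L)) + 1))).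
  by apply: ler_sum => k _; exact: step.
by rewrite sumr_const card_ord mulr_natl.
Qed.

End hybrid_argument.

Section mollified_means.
Variables (R : realType) (n : nat).
Local Notation mu := (lebesgue_rV R n).
Implicit Types (u : 'rV[R]_n -> R) (x b : 'rV[R]_n) (r s : R).

Definition mollifier : 'rV[R]_n -> R := tensor (fun=> @bump R).

Lemma mollifier_ge0 x : 0 <= mollifier x.
Proof. by apply: prodr_ge0 => i _; exact: bump_ge0. Qed.

Lemma bump_eq0_norm (t : R) : 1 < `|t| -> bump t = 0.
Proof.
move=> t1; apply: bump_eq0; apply/negP => /andP[t0 tlt1].
by move: t1; rewrite gtr0_norm// ltNge ltW.
Qed.

Lemma test_function_mollifier : test_function mollifier.
Proof.
by apply: (@test_function_tensor _ _ _ 1) => // i; [exact: smoothR_bump|exact: bump_eq0_norm].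
Qed.

Lemma mollifier_eq0 x : 1 < `|x| -> mollifier x = 0.
Proof. by apply: tensor_eq0 => // i t; exact: bump_eq0_norm. Qed.

Lemma integral_continuous_gt0 u x : continuous u -> (forall y, 0 <= u y) ->
  0 < u x -> (0 < \int[mu]_y (u y)%:E)%E.
Proof.
move=> cu u0 ux; rewrite lt_def integral_ge0 ?andbT; last by move=> y _; rewrite lee_fin.
apply/eqP => I0.
have mu_ : measurable_fun setT (EFin \o u).
  by apply/measurable_EFinP; exact: continuous_measurable_rV.
have : (\int[mu]_y `|(u y)%:E| = 0)%E.
  by rewrite -[RHS]I0; apply: eq_integral => y _; rewrite /= ger0_norm.
move=> /(ae_eq_integral_abs mu measurableT mu_)[N [mN N0 uN]].
pose U := [set y | 0 < u y].
have oU : open U.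
  by apply: (@open_comp _ _ u [set t | 0 < t]) => [y _|]; [exact: cu|exact: open_gt].
have : (0 < mu U)%E by apply: open_lebesgue_gt0 => //; exists x.
rewrite ltNge => /negP; apply; rewrite -N0; apply: le_measure; rewrite ?inE//.
  exact: open_measurable_rV.
by move=> y Uy; apply: uN => /= /(_ I)[] /eqP; rewrite gt_eqF.
Qed.

Definition mollifier_mass : R := \int[mu]_x mollifier x.

Lemma integrable_mollifier : mu.-integrable setT (EFin \o mollifier).
Proof.
have l1 : loc_integrable (cst 1 : 'rV[R]_n -> R).
  by apply: loc_integrable_continuous; exact: cst_continuous.
have := integrable_mul_test l1 test_function_mollifier.
by apply: eq_integrable => // x _; rewrite /= mul1r.
Qed.

Lemma mollifier_mass_gt0 : 0 < mollifier_mass.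
Proof.
rewrite fine_gt0//; apply/andP; split; last first.
  rewrite -ge0_fin_numE; first exact: integrable_fin_num integrable_mollifier.
  by apply: integral_ge0 => x _; rewrite lee_fin mollifier_ge0.
apply: (@integral_continuous_gt0 _ (const_mx 2^-1)).
- exact: test_function_continuous test_function_mollifier.
- exact: mollifier_ge0.
- by apply: prodr_gt0 => i _; rewrite mxE bump_gt0// invr_gt0 ltr0n invf_lt1 ?ltr1n.
Qed.

Definition mean u s x : R := pairing (fun y => u (s *: y + x)) mollifier.

Lemma pairing_cst_mollifier (c : R) : pairing (cst c) mollifier = c * mollifier_mass.
Proof. by rewrite /pairing RintegralZl//; exact: integrable_mollifier. Qed.

Lemma loc_integrable_homothety u s x : continuous u ->
  loc_integrable (fun y => u (s *: y + x)).
Proof. by move=> cu; apply: loc_integrable_continuous; exact: continuous_comp_homothety. Qed.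

Lemma mean_homothety u (c : R) s x r b : continuous u ->
  mean (fun y => c * u (s *: y + x)) r b = c * mean u (s * r) (s *: b + x).
Proof.
move=> cu; rewrite /mean /pairing -RintegralZl//; last first.
  exact: integrable_mul_test (loc_integrable_homothety _ _ cu) test_function_mollifier.
by apply: eq_Rintegral => y _; rewrite mulrA scalerDr scalerA addrA.
Qed.

Lemma mean_cvg u (s_ : R ^nat) x : continuous u -> (forall k, 0 <= s_ k) ->
  s_ k @[k --> \oo] --> (0 : R) -> mean u (s_ k) x @[k --> \oo] --> mollifier_mass * u x.
Proof.
move=> cu s0 s_cvg; have [M M0 moM] := test_function_bounded test_function_mollifier.
pose V := fine (mu (@normball R n 1)); have V0 : 0 <= V by exact: fine_ge0.
have MV1 : 0 < M * V + 1 by rewrite ltr_wpDl// mulr_ge0.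
apply/cvgrPdist_le => e e0; have d0 : 0 < e / (M * V + 1) by exact: divr_gt0.
have /nbhs_ballP[r /= r0 ur] := continuous_near x cu d0.
have /cvgrPdist_lt/(_ r r0) := s_cvg; apply: filterS => k.
rewrite sub0r normrN ger0_norm// => sr.
have lus := loc_integrable_homothety (s_ k) x cu.
have lux := loc_integrable_continuous (@cst_continuous 'rV[R]_n R (u x)).
rewrite distrC mulrC -pairing_cst_mollifier /mean -pairingB//; last first.
  exact: test_function_mollifier.
apply: (@le_trans _ _ (M * (e / (M * V + 1)) * V)).
  apply: norm_pairing_le => //.
  - have := loc_integrable_lin 1 (-1) lus lux.
    by under eq_fun do rewrite mul1r mulN1r.
  - exact: measurable_test_function test_function_mollifier.
  - exact: mollifier_eq0.
  - move=> y y1; rewrite distrC ltW//; apply: ur; rewrite mx_norm_ball /ball_/=.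
    rewrite opprD addrCA subrr addr0 normrN normrZ ger0_norm//.
    by apply: le_lt_trans sr; rewrite ler_piMr.
have -> : M * (e / (M * V + 1)) * V = e * (M * V / (M * V + 1)) by ring.
by rewrite ler_piMr ?(ltW e0)// ler_pdivrMr// mul1r lerDl.
Qed.

Definition dilated_bump r (c t : R) : R := r^-1 * bump (r^-1 * t + - (r^-1 * c)).

Lemma mean_dilated_bump u r b : 0 < r -> continuous u ->
  test_function (tensor (fun i => dilated_bump r (b 0 i))) ->
  mean u r b = pairing u (tensor (fun i => dilated_bump r (b 0 i))).
Proof.
move=> r0 cu tpsi; have rn0 := lt0r_neq0 r0.
have rn : r ^- n != 0 by rewrite invr_eq0 expf_neq0.
set psi := tensor _ in tpsi *.
have ipsi := integrable_mul_test (loc_integrable_continuous cu) tpsi.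
have := @Rintegral_homothety R n r b (fun x => u x * psi x) rn0 ipsi.
rewrite gtr0_norm// => psiE; apply: (mulfI rn); rewrite -[RHS]psiE.
rewrite /mean /pairing -RintegralZl//; last first.
  exact: integrable_mul_test (loc_integrable_homothety _ _ cu) test_function_mollifier.
apply: eq_Rintegral => y _; rewrite mulrCA; congr (_ * _).
rewrite /psi /mollifier /tensor /dilated_bump big_split/= prodr_const card_ord exprVn.
under [in RHS]eq_bigr do rewrite !mxE mulrDr addrK mulKf//.
by [].
Qed.

Definition dilated_step r (c t : R) : R :=
  smooth_step t - smooth_step (r^-1 * t + - (r^-1 * c)).

Lemma dilation_outside r (c t : R) : 2^-1 <= r <= 1 -> `|c| <= 1 -> 3 < `|t| ->
  (1 <= t /\ 1 <= r^-1 * t + - (r^-1 * c)) \/ (t <= 0 /\ r^-1 * t + - (r^-1 * c) <= 0).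
Proof.
move=> /andP[r1 r2]; rewrite ler_norml => /andP[c1 c2] t3.
have r0 : 0 < r by lra.
rewrite -mulrBr mulrC ler_pdivlMr// ler_pdivrMr// mul0r mul1r.
have [t0|t0] := leP 0 t; first by rewrite ger0_norm// in t3; left; split; lra.
by rewrite ltr0_norm// in t3; right; split; lra.
Qed.

Lemma derive1_dilated_step r (c : R) :
  (dilated_step r c)^`()%classic = (fun t => bump t - dilated_bump r c t).
Proof.
apply: derive1_is_derive => t; rewrite /dilated_step /dilated_bump.
have dS (z : R) := is_derive_derive1 (smoothR_derivable (x := z) (@smoothR_smooth_step R)).
have := is_derive1_comp_affine 1 (dS (r^-1 * t + - (r^-1 * c))).
rewrite mul1r; under [X in is_derive _ _ X]eq_fun do rewrite mul1r.
exact: is_deriveB (dS t).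
Qed.

Lemma bump_bounded : exists2 M : R, 0 <= M & forall t : R, `|bump t| <= M.
Proof.
apply: (bounded_of_compact_support (@segment_compact R 0 1)).
  exact: smoothR_continuous (@smoothR_bump R).
move=> t t01; apply: bump_eq0; apply/negP => /andP[t0 t1].
by apply: t01; rewrite /= in_itv/= !ltW.
Qed.

Lemma profileW L L' M M' phi : L <= L' -> M <= M' -> profile L M phi -> @profile R L' M' phi.
Proof.
move=> LL' MM' [sphi phi0 phiM]; split=> // t.
  by move=> L't; apply: phi0; exact: le_lt_trans L't.
exact: le_trans MM'.
Qed.

Lemma profile_dilated_bump M r (c : R) : (forall t : R, `|bump t| <= M) ->
  2^-1 <= r <= 1 -> `|c| <= 1 -> profile 3 (2 * M) (dilated_bump r c).
Proof.
move=> bM r12 c1; have [r1 r2] := andP r12; have r0 : 0 < r by lra.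
have rV0 : 0 <= r^-1 by rewrite invr_ge0 ltW.
have rV2 : r^-1 <= 2 by rewrite -[2]invrK lef_pV2// posrE invr_gt0.
split.
- exact/smoothR_comp_affine/smoothR_bump.
- move=> t /(dilation_outside r12 c1) t3; rewrite /dilated_bump bump_eq0 ?mulr0//.
  by apply/negP => /andP[? ?]; case: t3 => -[_]; lra.
- by move=> t; rewrite /dilated_bump normrM ger0_norm// ler_pM.
Qed.

Lemma profile_dilated_step r (c : R) : 2^-1 <= r <= 1 -> `|c| <= 1 ->
  profile 3 1 (dilated_step r c).
Proof.
move=> r12 c1; split.
- apply: smoothRD; first exact: smoothR_smooth_step.
  have := smoothR_comp_affine (-1) r^-1 (- (r^-1 * c)) (@smoothR_smooth_step R).
  by under eq_fun do rewrite mulN1r.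
- move=> t /(dilation_outside r12 c1)[[t1 t2]|[t1 t2]]; rewrite /dilated_step.
    by rewrite !smooth_step_ge1// subrr.
  by rewrite !smooth_step_le0// subrr.
- move=> t; rewrite /dilated_step ler_norml.
  have := smooth_step_ge0 t; have := smooth_step_le1 t.
  have := smooth_step_ge0 (r^-1 * t + - (r^-1 * c)).
  have := smooth_step_le1 (r^-1 * t + - (r^-1 * c)).
  by move=> *; apply/andP; split; lra.
Qed.

Lemma mean_variation : exists2 C : R, 0 <= C & forall p u r b, 1 <= p ->
  sobolev_le p 1 u -> 2^-1 <= r <= 1 -> `|b| <= 1 -> `|mean u 1 0 - mean u r b| <= C.
Proof.
have [M M0 bM] := bump_bounded; pose N := 2 * M + 1.
have N0 : 0 <= N by rewrite /N; lra.
exists (n%:R * (N ^+ n * (fine (mu (@normball R n 3)) + 1))).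
  by rewrite !mulr_ge0 ?exprn_ge0// addr_ge0// fine_ge0.
move=> p u r b p1 up r12 b1; have [cu _] := up.
have r0 : 0 < r by case/andP: r12 => r1 _; lra.
have bi i : `|b 0 i| <= 1 by exact: le_trans (norm_coord_le _ _) b1.
have pbump : profile 3 N (@bump R).
  apply: (@profileW 1 _ M); [by lra|by rewrite /N; lra|].
  by split; [exact: smoothR_bump|exact: bump_eq0_norm|exact: bM].
have pdil i : profile 3 N (dilated_bump r (b 0 i)).
  by apply: profileW (profile_dilated_bump bM r12 (bi i)); rewrite // /N; lra.
have -> : mean u 1 0 = pairing u mollifier.
  by apply: eq_Rintegral => y _; rewrite scale1r addr0.
rewrite mean_dilated_bump//; last first.
  by apply: (@test_function_tensor _ _ _ 3) => // i; have [] := pdil i.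
apply: (norm_pairing_hybrid_le (T := fun i => dilated_step r (b 0 i)) p1 _ up) => //.
- move=> i; apply: profileW (profile_dilated_step r12 (bi i)) => //.
  by rewrite /N; lra.
- by move=> i; exact: derive1_dilated_step.
Qed.

End mollified_means.

Section morrey_inequality.
Variables (R : realType) (n : nat) (p : R).
Implicit Types (u : 'rV[R]_n -> R) (x y b : 'rV[R]_n) (r s M C : R).
Hypotheses (p1 : 1 <= p) (np : n%:R < p).

Definition morrey_exponent : R := 1 - n%:R / p.
Local Notation alpha := morrey_exponent.

Let p0 : 0 < p. Proof. exact: lt_le_trans p1. Qed.

Lemma morrey_exponent_gt0 : 0 < alpha.
Proof. by rewrite subr_gt0 ltr_pdivrMr// mul1r. Qed.

Lemma morrey_exponentE : alpha * p = p - n%:R.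
Proof. by rewrite mulrBl mul1r divfK// gt_eqF. Qed.

Lemma sobolev_le_rescale s x u : 0 < s -> sobolev_le p 1 u ->
  sobolev_le p 1 (fun y => s `^ (- alpha) * u (s *: y + x)).
Proof.
move=> s0 /(sobolev_le_homothety x p1 s0) /(sobolev_leZ (s `^ (- alpha))).
apply: sobolev_leW; rewrite mulr1 ger0_norm ?powR_ge0//.
rewrite -powRrM mulNr morrey_exponentE -powRD ?addNr ?powRr0//.
by rewrite (gt_eqF s0) implybT.
Qed.

Definition mean_variation_le C := forall u s x r b, 0 < s -> sobolev_le p 1 u ->
  2^-1 <= r <= 1 -> `|b| <= 1 ->
  `|mean u s x - mean u (s * r) (s *: b + x)| <= C * s `^ alpha.

Lemma mean_variation_scaled : exists2 C : R, 0 <= C & mean_variation_le C.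
Proof.
have [C C0 variationC] := mean_variation R n; exists C => // u s x r b s0 up r12 b1.
have [cu _] := up; have := variationC p _ r b p1 (sobolev_le_rescale x s0 up) r12 b1.
rewrite !mean_homothety// scaler0 add0r mulr1 -mulrBr normrM.
by rewrite (ger0_norm (powR_ge0 _ _)) powRN mulrC ler_pdivrMr ?powR_gt0.
Qed.

Local Notation q := (2^-1 `^ alpha).

Lemma morrey_ratio : 0 <= q < 1.
Proof. exact: powR_ge0_lt1 (half_ge0_lt1 R) morrey_exponent_gt0. Qed.

Lemma mean_center C u x : mean_variation_le C -> sobolev_le p 1 u ->
  `|mean u 1 x - mollifier_mass R n * u x| <= C / (1 - q).
Proof.
move=> variationC up; have [cu _] := up; pose s k : R := 2^-1 ^+ k.
have s0 k : 0 < s k by rewrite exprn_gt0 ?invr_gt0.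
have sq k : s k `^ alpha = q ^+ k by rewrite powR_exprC ?invr_ge0.
have variation k : `|mean u (s k) x - mean u (s k.+1) x| <= C * q ^+ k.
  have half : 2^-1 <= (2^-1 : R) <= 1 by rewrite lexx invf_le1 ?ler1n.
  have := variationC u (s k) x 2^-1 0 (s0 k) up half; rewrite normr0 => /(_ ler01).
  by rewrite scaler0 add0r -exprSr sq.
have cauchy := geometric_cauchy_rate morrey_ratio variation.
have s_cvg : s k @[k --> \oo] --> (0 : R).
  by have := cvg_geometric0 1 (half_ge0_lt1 R); under eq_fun do rewrite mul1r.
have := dist_cvg_le cauchy (mean_cvg (x := x) cu (fun k => ltW (s0 k)) s_cvg).
by move=> /(_ 0%N); rewrite expr0 mulr1.
Qed.

Lemma morrey_unit : exists2 K : R, 0 <= K &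
  forall u, sobolev_le p 1 u -> forall x b, `|b| <= 1 -> `|u x - u (b + x)| <= K.
Proof.
have [C C0 variationC] := mean_variation_scaled; have [_ q1] := andP morrey_ratio.
have m0 := mollifier_mass_gt0 R n; set m := mollifier_mass R n in m0.
exists ((2 * (C / (1 - q)) + C) / m).
  by rewrite divr_ge0 ?(ltW m0)// addr_ge0// mulr_ge0// divr_ge0// subr_ge0 ltW.
move=> u up x b b1.
have one : 2^-1 <= (1 : R) <= 1 by rewrite lexx invf_le1 ?ler1n.
have translation := variationC u 1 x 1 b ltr01 up one b1.
rewrite powR1 mulr1 scale1r mulr1 in translation.
have center y := mean_center y variationC up.
rewrite ler_pdivlMr// -[X in _ * X](gtr0_norm m0) -normrM mulrC mulrBr.
move: (center x) (center (b + x)) translation; rewrite -/m !ler_norml.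
move: (C / (1 - q)) (m * u x) (m * u (b + x)) (mean u 1 x) (mean u 1 (b + x)) => Z X Y A B.
by move=> /andP[? ?] /andP[? ?] /andP[? ?]; apply/andP; split; lra.
Qed.

Theorem morrey : exists2 K : R, 0 <= K & forall u M, 0 < M ->
  sobolev_le p (M `^ p) u -> forall x y, `|u x - u y| <= K * M * `|x - y| `^ alpha.
Proof.
have [K K0 morreyK] := morrey_unit; exists K => // u M M0 uM x y.
have [->|xy] := eqVneq x y.
  by rewrite !subrr !normr0 mulr_ge0 ?powR_ge0// mulr_ge0// ltW.
set r := `|x - y|; have r0 : 0 < r by rewrite normr_gt0 subr_eq0.
have u1 : sobolev_le p 1 (fun z => M^-1 * u z).
  apply: sobolev_leW (sobolev_leZ M^-1 uM).
  rewrite ger0_norm ?invr_ge0 ?(ltW M0)// -powRM ?invr_ge0 ?(ltW M0)//.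
  by rewrite mulVf ?gt_eqF// powR1.
have := morreyK _ (sobolev_le_rescale x r0 u1) 0 (r^-1 *: (y - x)).
rewrite normrZ ger0_norm ?invr_ge0 ?(ltW r0)// [`|y - x|]distrC mulVf ?gt_eqF//.
move=> /(_ (lexx _)); rewrite scaler0 addr0 add0r scalerA mulfV ?gt_eqF// scale1r subrK.
rewrite -!mulrBr !normrM (ger0_norm (powR_ge0 _ _)) ger0_norm ?invr_ge0 ?(ltW M0)//.
rewrite powRN ler_pdivrMl ?powR_gt0// ler_pdivrMl// => KM; apply: le_trans KM _.
by rewrite [leLHS](_ : _ = K * M * r `^ alpha)//; ring.
Qed.

End morrey_inequality.

(** * Limits in energy *)

Section almost_everywhere_limits.
Context d (T : measurableType d) (R : realType) (mu : {measure set T -> \bar R}).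

Lemma ae_fatou (f_ : (T -> \bar R)^nat) (f : T -> \bar R) (c : \bar R) :
  (forall k, measurable_fun setT (f_ k)) -> measurable_fun setT f ->
  (forall k x, 0 <= f_ k x)%E -> (forall x, 0 <= f x)%E ->
  {ae mu, forall x, f_ k x @[k --> \oo] --> f x} ->
  (\forall k \near \oo, \int[mu]_x f_ k x <= c)%E -> (\int[mu]_x f x <= c)%E.
Proof.
move=> mf_ mf f_0 f0 ff [N _ fc].
have := fatou mu measurableT mf_ (fun k x _ => f_0 k x).
rewrite (_ : \int[mu]_x limn_einf _ = \int[mu]_x f x)%E; last first.
  apply: ge0_ae_eq_integral => //.
  - rewrite (_ : (fun _ => _) = (fun x => - limn_esup (-%E \o f_^~ x))%E).
      apply: measurableT_comp => //; apply: measurable_fun_limn_esup => k.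
      exact: measurableT_comp.
    by apply/funext => x; rewrite limn_esupN oppeK.
  - move=> x _; rewrite limn_einf_lim; apply: lime_ge; first exact: is_cvg_einfs.
    by apply: nearW => k; apply: le_ereal_inf_tmp => _ [l _ <-]; exact: f_0.
  - by apply: filterS ff => x /cvg_limn_einf_sup[].
move=> /le_trans; apply; rewrite limn_einf_lim.
apply: lime_le; first exact: is_cvg_einfs.
apply: nearW => k; apply: le_trans (fc (maxn k N) (leq_maxr _ _)).
by apply: ereal_inf_lbound; exists (maxn k N) => //=; exact: leq_maxl.
Qed.

Lemma ae_nneseries_fin_num (f_ : (T -> \bar R)^nat) :
  (forall k, measurable_fun setT (f_ k)) -> (forall k x, 0 <= f_ k x)%E ->
  (\sum_(0 <= k <oo) \int[mu]_x f_ k x < +oo)%E ->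
  {ae mu, forall x, (\sum_(0 <= k <oo) f_ k x)%E \is a fin_num}.
Proof.
move=> mf f0 fin; pose S x := (\sum_(0 <= k <oo) f_ k x)%E.
have S0 x : (0 <= S x)%E by apply: nneseries_ge0 => k _ _; exact: f0.
have iS : mu.-integrable setT S.
  apply/integrableP; split; first exact: (ge0_emeasurable_sum (P := xpredT)).
  by under eq_integral do rewrite gee0_abs//; rewrite integral_nneseries.
by apply: filterS (integrable_ae measurableT iS) => x; exact.
Qed.

Lemma ae_cvg_measurable_limit (f_ : (T -> R)^nat) :
  (forall k, measurable_fun setT (f_ k)) -> {ae mu, forall x, cvgn (f_ ^~ x)} ->
  exists2 f : T -> R, measurable_fun setT f & {ae mu, forall x, f_ k x @[k --> \oo] --> f x}.
Proof.
move=> mf [N [mN N0 cN]].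
have cvgC x : ~ N x -> cvgn (f_ ^~ x) by move=> Nx; apply: contra_notP Nx => ?; exact: cN.
exists (fun x => limn (fun k => f_ k x * \1_(~` N) x)).
  apply: (@measurable_fun_cvg _ _ _ _ (fun k x => f_ k x * \1_(~` N) x)).
    by move=> k; apply: measurable_funM => //; apply: measurable_indic; exact: measurableC.
  move=> x _; rewrite indicE; have [Nx|Nx] := pselect (N x).
    by rewrite memNset; [under eq_fun do rewrite mulr0; exact: is_cvg_cst|exact].
  by rewrite mem_set//; under eq_fun do rewrite mulr1; exact: cvgC.
exists N; split=> // x; apply: contra_notP => Nx /=.
have -> : (fun k => f_ k x * \1_(~` N) x) = f_ ^~ x.
  by apply/funext => k; rewrite indicE mem_set// mulr1.
exact: cvgC.
Qed.

End almost_everywhere_limits.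

Section energy_limits.
Variables (R : realType) (n : nat) (p : R).
Local Notation mu := (lebesgue_rV R n).
Implicit Types (G : 'rV[R]_n -> 'rV[R]_n) (q : R).

Lemma energy_fatou (G_ : nat -> 'rV[R]_n -> 'rV[R]_n) G (c : \bar R) : 0 < p ->
  (forall k, measurable_fun setT (G_ k)) -> measurable_fun setT G ->
  {ae mu, forall x, G_ k x @[k --> \oo] --> G x} ->
  (\forall k \near \oo, energy p (G_ k) <= c)%E -> (energy p G <= c)%E.
Proof.
move=> p0 mG_ mG GG; apply: ae_fatou.
- by move=> k; exact: measurable_energy.
- exact: measurable_energy.
- by move=> k x; rewrite lee_fin powR_ge0.
- by move=> x; rewrite lee_fin powR_ge0.
- apply: filterS GG => x GGx; apply: cvg_EFin; first exact: nearW.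
  apply: cvg_powR => //; first by move=> k; exact: enorm_ge0.
  by apply: continuous_cvg GGx; exact: enorm_continuous.
Qed.

Lemma cvg_of_bounded_powR (v_ : nat -> 'rV[R]_n) (s C : R) : 0 < p -> 0 < s < 1 ->
  (forall k, enorm (s ^- k *: (v_ k - v_ k.+1)) `^ p <= C) ->
  forall i, cvgn (fun k => v_ k 0 i).
Proof.
move=> p0 /andP[s0 s1] vC i; have s01 : 0 <= s < 1 by rewrite ltW.
have increments k : `|v_ k 0 i - v_ k.+1 0 i| <= C `^ p^-1 * s ^+ k.
  have := norm_coord_le_enorm (v_ k - v_ k.+1) i; rewrite !mxE => /le_trans; apply.
  rewrite -ler_pdivrMr ?exprn_gt0// mulrC.
  rewrite -[leLHS](@powRK _ _ p) ?gt_eqF//; last first.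
    by rewrite mulr_ge0 ?enorm_ge0// invr_ge0 exprn_ge0// ltW.
  apply: ge0_ler_powR; rewrite ?nnegrE ?powR_ge0 ?invr_ge0 ?(ltW p0)//.
    by apply: le_trans (vC 0%N); exact: powR_ge0.
  by have := vC k; rewrite enormZ ger0_norm// invr_ge0 exprn_ge0// ltW.
have [l vl] := cvg_of_cauchy_rate (geometric_cauchy_rate s01 increments)
  (cvg_geometric0 _ s01).
by apply/cvg_ex; exists l.
Qed.

Lemma energy_geometric_summable (G_ : nat -> 'rV[R]_n -> 'rV[R]_n) (s : R) :
  1 <= p -> 0 < s < 1 -> (forall k, measurable_fun setT (G_ k)) ->
  (forall k, energy p (G_ k) <= (((s ^+ 2) ^+ k) `^ p)%:E)%E ->
  (\sum_(0 <= k <oo) energy p (fun x => s ^- k *: G_ k x)%R < +oo)%E.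
Proof.
move=> p1 /andP[s0 s1] mG Gs.
apply: (@le_lt_trans _ _ (1 / (1 - s))%:E); last exact: ltry.
apply: lime_le; first by apply: is_cvg_nneseries => k _ _; exact: energy_ge0.
apply: nearW => N; have s1N : `|s| < 1 by rewrite gtr0_norm.
apply: (@le_trans _ _ (series (geometric 1 s) N)%:E); last first.
  by rewrite lee_fin; exact: geometric_le_lim.
rewrite /series/= -sumEFin; apply: lee_sum => k _.
rewrite (@energyZ R n p (s ^- k) (G_ k) (mG k)).
apply: (@le_trans _ _ ((`|s ^- k| `^ p)%:E * (((s ^+ 2) ^+ k) `^ p)%:E)%E).
  by apply: lee_wpmul2l; [rewrite lee_fin powR_ge0|exact: Gs].
have sk0 : 0 < s ^+ k by exact: exprn_gt0.
rewrite -EFinM lee_fin ger0_norm ?invr_ge0 ?(ltW sk0)// -powRM ?invr_ge0 ?exprn_ge0 ?(ltW s0)//.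
rewrite -exprM mulnC exprM expr2 mulrA mulVf ?gt_eqF// mul1r.
by apply: ge1r_powR => //; rewrite sk0 exprn_ile1// ltW.
Qed.

Lemma energy_cauchy_ae_cvg (G_ : nat -> 'rV[R]_n -> 'rV[R]_n) q :
  1 <= p -> 0 < q < 1 -> (forall k, measurable_fun setT (G_ k)) ->
  (forall k, energy p (fun x => G_ k x - G_ k.+1 x)%R <= ((q ^+ k) `^ p)%:E)%E ->
  exists2 G : 'rV[R]_n -> 'rV[R]_n, measurable_fun setT G &
    {ae mu, forall x, G_ k x @[k --> \oo] --> G x}.
Proof.
move=> p1 /andP[q0 q1] mG Gq; have p0 : 0 < p by exact: lt_le_trans p1.
pose s := Num.sqrt q; have s2 : s ^+ 2 = q by rewrite sqr_sqrtr// ltW.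
have s01 : 0 < s < 1 by rewrite sqrtr_gt0 q0 -sqrtr1 ltr_sqrt.
pose D k x := s ^- k *: (G_ k x - G_ k.+1 x).
have mdiff k : measurable_fun setT (fun x => G_ k x - G_ k.+1 x).
  exact: measurable_funB_rV.
have mD k : measurable_fun setT (fun x => (enorm (D k x) `^ p)%:E).
  by apply: measurable_energy; exact: measurable_funZ_rV.
have D0 k x : (0 <= (enorm (D k x) `^ p)%:E)%E by rewrite lee_fin powR_ge0.
rewrite -s2 in Gq; have summable := energy_geometric_summable p1 s01 mdiff Gq.
have coord_cvg i : {ae mu, forall x, cvgn (fun k => G_ k x 0 i)}.
  apply: filterS (ae_nneseries_fin_num mD D0 summable) => x Sx.
  apply: (@cvg_of_bounded_powR _ s (fine (\sum_(0 <= k <oo) (enorm (D k x) `^ p)%:E)%E)) => //.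
  move=> k; rewrite -lee_fin fineK//.
  apply: le_trans (@nneseries_lim_ge _ _ xpredT 0 k.+1 (fun j _ _ => D0 j x)).
  by rewrite big_nat_recr//= leeDr//; exact: sume_ge0.
have /choice[g gP] : forall i, exists g, measurable_fun setT g /\
    {ae mu, forall x, G_ k x 0 i @[k --> \oo] --> (g x : R)}.
  move=> i; have mGi k := measurable_fun_coord i (mG k).
  by have [g mg gG] := ae_cvg_measurable_limit mGi (coord_cvg i); exists g.
exists (fun x => \row_i g i x).
  by apply: measurable_fun_rV => i; under eq_fun do rewrite mxE; have [] := gP i.
have : {ae mu, forall x, forall i, G_ k x 0 i @[k --> \oo] --> (g i x : R)}.
  by apply: filter_forall => i; have [] := gP i.
by apply: filterS => x Gg; apply: cvg_rV => i; rewrite mxE.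
Qed.

End energy_limits.

Section weak_gradient_closed.
Variables (R : realType) (n : nat) (p : R).
Local Notation mu := (lebesgue_rV R n).
Implicit Types (u w f : 'rV[R]_n -> R) (G : 'rV[R]_n -> 'rV[R]_n).

Definition cvg_on_balls (u_ : nat -> 'rV[R]_n -> R) u :=
  forall L : R, exists2 a_ : R^nat, a_ k @[k --> \oo] --> (0 : R) &
    forall k x, `|x| <= L -> `|u_ k x - u x| <= a_ k.

Lemma cvg_pairing (u_ : nat -> 'rV[R]_n -> R) w f :
  (forall k, loc_integrable (u_ k)) -> loc_integrable w -> test_function f ->
  cvg_on_balls u_ w -> pairing (u_ k) f @[k --> \oo] --> pairing w f.
Proof.
move=> lu lw tf uw; have [M M0 fM] := test_function_bounded tf.
have [_ [L _ fL]] := (test_functionP f).1 tf; have [a_ a_cvg ua] := uw L.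
apply: (@squeeze_dist _ _ (fun k => M * a_ k * fine (mu (@normball R n L)))).
  move=> k; rewrite -pairingB//; apply: norm_pairing_le => //.
  - have := loc_integrable_lin 1 (-1) (lu k) lw.
    by under eq_fun do rewrite mul1r mulN1r.
  - exact: measurable_test_function.
  - exact: ua.
rewrite -[X in _ --> X](mul0r (fine (mu (@normball R n L)))) -[X in X * _](mulr0 M).
by apply: cvgM; [apply: cvgM => //; exact: cvg_cst|exact: cvg_cst].
Qed.

Lemma cvg_pairing_energy (G_ : nat -> 'rV[R]_n -> 'rV[R]_n) G f i (e_ : R^nat) : 1 <= p ->
  (forall k, measurable_fun setT (G_ k)) -> measurable_fun setT G ->
  (forall k, loc_integrable (fun x => G_ k x 0 i)) -> loc_integrable (fun x => G x 0 i) ->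
  test_function f -> (forall k, 0 < e_ k) -> e_ k @[k --> \oo] --> (0 : R) ->
  (forall k, energy p (fun x => G_ k x - G x)%R <= (e_ k `^ p)%:E)%E ->
  pairing (fun x => G_ k x 0 i) f @[k --> \oo] --> pairing (fun x => G x 0 i) f.
Proof.
move=> p1 mG_ mG lG_ lG tf e0 e_cvg Ge; have [M M0 fM] := test_function_bounded tf.
have [_ [L _ fL]] := (test_functionP f).1 tf.
apply: (@squeeze_dist _ _ (fun k => M * e_ k * (fine (mu (@normball R n L)) + 1))).
  move=> k; rewrite -pairingB//.
  have -> : (fun x => G_ k x 0 i - G x 0 i) = (fun x => (G_ k x - G x) 0 i).
    by apply/funext => x; rewrite !mxE.
  apply: (@norm_pairing_le_energy _ _ p (fun x => G_ k x - G x)) => //.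
    exact: measurable_funB_rV.
  exact: measurable_test_function.
rewrite -[X in _ --> X](mul0r (fine (mu (@normball R n L)) + 1)) -[X in X * _](mulr0 M).
by apply: cvgM; [apply: cvgM => //; exact: cvg_cst|exact: cvg_cst].
Qed.

Lemma weak_gradient_closed (u_ : nat -> 'rV[R]_n -> R) w
    (G_ : nat -> 'rV[R]_n -> 'rV[R]_n) G (e_ : R^nat) : 1 <= p ->
  (forall k, continuous (u_ k)) -> (forall k, weak_gradient (u_ k) (G_ k)) ->
  continuous w -> measurable_fun setT G -> (energy p G < +oo)%E ->
  cvg_on_balls u_ w -> (forall k, 0 < e_ k) -> e_ k @[k --> \oo] --> (0 : R) ->
  (forall k, energy p (fun x => G_ k x - G x)%R <= (e_ k `^ p)%:E)%E ->
  weak_gradient w G.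
Proof.
move=> p1 cu uG cw mG Gfin uw e0 e_cvg Ge i.
have lG := loc_integrable_energy i p1 mG Gfin.
have lw := loc_integrable_continuous cw; have lu k := loc_integrable_continuous (cu k).
apply/(weak_partialP _ _ lw); split=> // f tf.
have tf' := test_function_partial i tf.
have uGi k := (weak_partialP i (fun x => G_ k x 0 i) (lu k)).1 (uG k i).
have lhs := cvg_pairing lu lw tf' uw.
have rhs : - pairing (fun x => G_ k x 0 i) f @[k --> \oo] --> - pairing (fun x => G x 0 i) f.
  apply: cvgN; apply: (cvg_pairing_energy p1 _ mG _ lG tf e0 e_cvg Ge) => k.
    exact: measurable_weak_gradient (uG k).
  by have [] := uGi k.
apply: (cvg_unique _ lhs); first exact: Rhausdorff.
by rewrite (_ : (fun k => _) = (fun k => - pairing (fun x => G_ k x 0 i) f))//;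
  apply/funext => k; have [_ ->] := uGi k.
Qed.

End weak_gradient_closed.

Section sobolev_limit.
Variables (R : realType) (n : nat) (p : R).
Local Notation mu := (lebesgue_rV R n).
Implicit Types (w : 'rV[R]_n -> R) (G : 'rV[R]_n -> 'rV[R]_n) (q m : R).

Lemma cvg_on_balls_continuous (u_ : nat -> 'rV[R]_n -> R) w :
  (forall k, continuous (u_ k)) -> cvg_on_balls u_ w -> continuous w.
Proof.
move=> cu uw x; apply/(@cvgrPdist_lt _ _ _ (nbhs (x : 'rV[R]_n))) => e e0.
have e3 : 0 < e / 3 by rewrite divr_gt0.
have [a_ /cvgrPdist_lt/(_ _ e3)[N _ /(_ N (leqnn N)) aN] ua] := uw (`|x| + 1).
rewrite /= sub0r normrN in aN; move: aN => /(le_lt_trans (ler_norm _)) aN.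
have x1 : \forall y \near x, `|y| <= `|x| + 1.
  apply/nbhs_ballP; exists 1 => //= y; rewrite mx_norm_ball /ball_/= distrC => yx.
  by rewrite -[y](subrK x) addrC; apply: le_trans (ler_normD _ _) _; rewrite lerD2l ltW.
have := continuous_near x (cu N) e3; apply: filterS2 x1 => y y1 uxy.
have wx : `|u_ N x - w x| < e / 3 by apply: le_lt_trans aN; apply: ua; rewrite lerDl.
have wy : `|u_ N y - w y| < e / 3 by apply: le_lt_trans aN; exact: ua.
move: uxy wx wy; rewrite !ltr_norml => /andP[? ?] /andP[? ?] /andP[? ?].
by apply/andP; split; lra.
Qed.

Lemma energy_cauchy_limit (G_ : nat -> 'rV[R]_n -> 'rV[R]_n) q m (d_ : R^nat) :
  1 <= p -> 0 < q < 1 -> (forall k, measurable_fun setT (G_ k)) ->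
  (forall k l, (k <= l)%N ->
     energy p (fun x => G_ k x - G_ l x)%R <= ((q ^+ k) `^ p)%:E)%E ->
  (forall k, energy p (G_ k) <= (m + d_ k)%:E)%E -> d_ k @[k --> \oo] --> (0 : R) ->
  exists G, [/\ measurable_fun setT G, (energy p G <= m%:E)%E &
    forall k, (energy p (fun x => G_ k x - G x)%R <= ((q ^+ k) `^ p)%:E)%E].
Proof.
move=> p1 q01 mG_ Gq Gm d0; have p0 : 0 < p by exact: lt_le_trans p1.
have [G mG GG] := energy_cauchy_ae_cvg p1 q01 mG_ (fun k => Gq k k.+1 (leqnSn k)).
exists G; split=> // [|k].
  apply/lee_addgt0Pr => e e0; apply: (energy_fatou p0 mG_ mG GG).
  have /cvgrPdist_lt/(_ e e0) := d0; apply: filterS => k.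
  rewrite sub0r normrN => /(le_lt_trans (ler_norm _)) dk.
  by apply: le_trans (Gm k) _; rewrite lee_fin lerD2l ltW.
apply: (@energy_fatou _ _ p (fun l x => G_ k x - G_ l x)) => //.
- by move=> l; exact: measurable_funB_rV.
- exact: measurable_funB_rV.
- by apply: filterS GG => x GGx; apply: cvgB => //; exact: cvg_cst.
- by exists k => // l /= kl; exact: Gq.
Qed.

(* Since the functions agree at [x0], Morrey's inequality turns convergence in
   energy into locally uniform convergence. *)
Lemma sobolev_cauchy_cvg_on_balls (x0 : 'rV[R]_n) (c : R) q
    (u_ : nat -> 'rV[R]_n -> R) (G_ : nat -> 'rV[R]_n -> 'rV[R]_n) :
  1 <= p -> n%:R < p -> 0 < q < 1 ->
  (forall k, continuous (u_ k)) -> (forall k, weak_gradient (u_ k) (G_ k)) ->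
  (forall k, u_ k x0 = c) ->
  (forall k l, (k <= l)%N ->
     energy p (fun x => G_ k x - G_ l x)%R <= ((q ^+ k) `^ p)%:E)%E ->
  exists2 w, cvg_on_balls u_ w & forall x, u_ k x @[k --> \oo] --> (w x : R).
Proof.
move=> p1 np /andP[q0 q1] cu uG ux0 Gq; have q01 : 0 <= q < 1 by rewrite ltW.
have [K K0 morreyK] := morrey p1 np; set al := morrey_exponent n p in morreyK.
have rate x k l : (k <= l)%N -> `|u_ k x - u_ l x| <= K * `|x - x0| `^ al * q ^+ k.
  move=> kl; have ukl := sobolev_leB (cu k) (cu l) (uG k) (uG l) (Gq k l kl).
  have := morreyK _ _ (exprn_gt0 k q0) ukl x x0.
  by rewrite !ux0 subrr subr0 mulrAC.
have rate_cvg x := cvg_geometric0 (K * `|x - x0| `^ al) q01.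
have /choice[w uw] : forall x, exists l : R, u_ k x @[k --> \oo] --> l.
  by move=> x; exact: cvg_of_cauchy_rate (rate x) (rate_cvg x).
exists w => // L; exists (fun k => K * (L + `|x0|) `^ al * q ^+ k); first exact: cvg_geometric0.
move=> k x xL; apply: le_trans (dist_cvg_le (rate x) (uw x) k) _.
have x0L : `|x - x0| <= L + `|x0| by apply: le_trans (ler_normB _ _) _; rewrite lerD2r.
rewrite ler_wpM2r ?exprn_ge0 ?(ltW q0)// ler_wpM2l//.
apply: ge0_ler_powR; rewrite ?nnegrE ?(ltW (morrey_exponent_gt0 p1 np))//.
exact: le_trans x0L.
Qed.

Lemma sobolev_limit (x0 : 'rV[R]_n) (c : R) q m (d_ : R^nat)
    (u_ : nat -> 'rV[R]_n -> R) (G_ : nat -> 'rV[R]_n -> 'rV[R]_n) :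
  1 <= p -> n%:R < p -> 0 < q < 1 ->
  (forall k, continuous (u_ k)) -> (forall k, weak_gradient (u_ k) (G_ k)) ->
  (forall k, u_ k x0 = c) ->
  (forall k l, (k <= l)%N ->
     energy p (fun x => G_ k x - G_ l x)%R <= ((q ^+ k) `^ p)%:E)%E ->
  (forall k, energy p (G_ k) <= (m + d_ k)%:E)%E -> d_ k @[k --> \oo] --> (0 : R) ->
  exists2 w, sobolev_le p m w & forall x, u_ k x @[k --> \oo] --> (w x : R).
Proof.
move=> p1 np q01 cu uG ux0 Gq Gm d0.
have [w uw wx] := sobolev_cauchy_cvg_on_balls p1 np q01 cu uG ux0 Gq.
have mG k := measurable_weak_gradient (uG k).
have [G [mGl Gle GG]] := energy_cauchy_limit p1 q01 mG Gq Gm d0.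
have cw := cvg_on_balls_continuous cu uw; exists w => //; split=> //; exists G => //.
have [q0 q1] := andP q01.
apply: (@weak_gradient_closed _ _ p u_ w G_ G (fun k => q ^+ k)) => //.
- exact: le_lt_trans Gle (ltry _).
- by move=> k; exact: exprn_gt0.
- by apply: cvg_expr; rewrite gtr0_norm.
Qed.

End sobolev_limit.

(** * The capacity of a point *)

Lemma monotone_threshold (R : realType) (P : nat -> R -> Prop) (e : R) :
  (forall j a b, a <= b -> P j a -> P j b) -> (forall j a, P j a -> 0 <= a) ->
  (forall j d, 0 < d -> P j (e + d)) ->
  exists2 m, m <= e &
    forall d, 0 < d -> (forall j, P j (m + d)) /\ exists j, ~ P j (m - d).
Proof.
move=> Pmono P0 Pe; pose A := [set a | forall j, P j a].
have lbA : lbound A 0 by move=> a /(_ 0%N); exact: P0.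
have infA : has_inf A by split; [exists (e + 1) => j; exact: Pe|exists 0].
exists (inf A) => [|d d0].
  by apply/ler_addgt0Pr => d d0; apply: ge_inf; [exact: infA.2|move=> j; exact: Pe].
split=> [j|].
  by have [a Aa /ltW ad] := inf_adherent d0 infA; apply: Pmono ad _; exact: Aa.
apply/not_existsP => AmV; suff : inf A <= inf A - d by rewrite leNgt gtrBl d0.
by apply: ge_inf; [exact: infA.2|move=> j; exact: contrapT (AmV j)].
Qed.

Lemma nondecreasing_majorant (J : nat -> nat) : exists j : nat -> nat,
  [/\ {homo j : k l / (k <= l)%N}, forall k, (J k <= j k)%N & forall k, (k <= j k)%N].
Proof.
pose j k := \max_(i < k.+1) maxn (J i) i; exists j.
have jge k : (maxn (J k) k <= j k)%N by rewrite (leq_bigmax_cond ord_max).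
split=> [||k]; last exact: leq_trans (leq_maxr _ _) (jge k).
  apply: homo_leq => // [? ? ?|k]; first exact: leq_trans.
  by rewrite /j [leqRHS]big_ord_recr leq_maxl.
by move=> k; exact: leq_trans (leq_maxl _ _) (jge k).
Qed.

Section point_capacity.
Variables (R : realType) (n : nat) (p : R).
Implicit Types (u v : 'rV[R]_n -> R) (x y : 'rV[R]_n) (C : set 'rV[R]_n) (e m d : R).

Definition competitor x C u := u x = 1 /\ forall y, C y -> u y = 0.

Definition cap_le e x C := exists2 u, competitor x C u & sobolev_le p e u.

Lemma competitor_mid x C u v : competitor x C u -> competitor x C v ->
  competitor x C (fun y => 2^-1 * u y + 2^-1 * v y).
Proof.
move=> [ux uC] [vx vC]; split=> [|y Cy]; last by rewrite uC ?vC// !mulr0 addr0.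
by rewrite ux vx; lra.
Qed.

Lemma competitorS x C C' u : C' `<=` C -> competitor x C u -> competitor x C' u.
Proof. by move=> CC [ux uC]; split=> // y /CC; exact: uC. Qed.

Lemma cap_leW e e' x C : e <= e' -> cap_le e x C -> cap_le e' x C.
Proof. by move=> ee [u xCu ue]; exists u => //; exact: sobolev_leW ue. Qed.

Lemma cap_leS e x C C' : C' `<=` C -> cap_le e x C -> cap_le e x C'.
Proof. by move=> CC [u xCu ue]; exists u => //; exact: competitorS xCu. Qed.

Lemma cap_le_ge0 e x C : cap_le e x C -> 0 <= e.
Proof. by move=> [u _ /sobolev_le_ge0]. Qed.

Lemma cap_le_closure e x C : cap_le e x C -> cap_le e x (closure C).
Proof.
move=> [u [ux uC] ue]; have [cu _] := ue; exists u => //; split=> // y Cy.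
have u0 : closed (u @^-1` [set 0]).
  by apply: (@preimage_closed _ _ u); [move=> z _; exact: cu|exact: closed_eq].
have := @closureS _ C (u @^-1` [set 0]) uC y Cy.
by rewrite -((closure_id _).1 u0).
Qed.

Lemma cap_le_affine (s : R) (O : 'M[R]_n) (a : 'rV[R]_n) e x C :
  1 <= p -> 0 < s -> O *m O^T = 1%:M -> cap_le e (s *: (x *m O) + a) C ->
  cap_le (s `^ (p - n%:R) * e) x [set z | C (s *: (z *m O) + a)].
Proof.
move=> p1 s0 OO [u [ux uC] ue]; exists (fun z => u (s *: (z *m O) + a)).
  by split=> // z; exact: uC.
exact: sobolev_le_affine.
Qed.

Lemma cap_le_homothety (s : R) (a : 'rV[R]_n) e x C :
  1 <= p -> 0 < s -> cap_le e (s *: x + a) C ->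
  cap_le (s `^ (p - n%:R) * e) x [set z | C (s *: z + a)].
Proof.
move=> p1 s0 [u [ux uC] ue]; exists (fun z => u (s *: z + a)).
  by split=> // z; exact: uC.
exact: sobolev_le_homothety.
Qed.

(* Clarkson's inequality makes almost minimisers a Cauchy sequence in energy,
   which replaces the weak compactness of bounded sets. *)
Lemma almost_minimizers_cauchy x (C_ : nat -> set 'rV[R]_n) m (d_ : R^nat) (J : nat -> nat) :
  2 <= p -> (forall i j, (i <= j)%N -> C_ i `<=` C_ j) ->
  (forall k l, (k <= l)%N -> d_ l <= d_ k) ->
  (forall k j, cap_le (m + d_ k) x (C_ j)) -> (forall k, ~ cap_le (m - d_ k) x (C_ (J k))) ->
  exists (u_ : nat -> 'rV[R]_n -> R) (G_ : nat -> 'rV[R]_n -> 'rV[R]_n), forall k,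
    [/\ competitor x (C_ k) (u_ k), continuous (u_ k), weak_gradient (u_ k) (G_ k),
        (energy p (G_ k) <= (m + d_ k)%:E)%E &
        forall l, (k <= l)%N ->
          (energy p (fun y => G_ k y - G_ l y)%R <= (2 `^ p * (2 * d_ k))%:E)%E].
Proof.
move=> p2 Cmono dmono capm Jm; have [j [jmono Jj kj]] := nondecreasing_majorant J.
have /choice[uG uGP] : forall k, exists uG : ('rV[R]_n -> R) * ('rV[R]_n -> 'rV[R]_n),
    [/\ competitor x (C_ (j k)) uG.1, continuous uG.1, weak_gradient uG.1 uG.2 &
        (energy p uG.2 <= (m + d_ k)%:E)%E].
  by move=> k; have [u xCu [cu [G uG Ge]]] := capm k (j k); exists (u, G).
exists (fun k => (uG k).1), (fun k => (uG k).2) => k; have [xCu cu uGk Ge] := uGP k.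
split=> // [|l kl]; first exact: competitorS (Cmono _ _ (kj k)) xCu.
have [xCv cv vGl Gl] := uGP l.
apply: (energy_sub_le_of_midpoint p2 (measurable_weak_gradient uGk)
  (measurable_weak_gradient vGl) Ge).
- by apply: (le_trans Gl); rewrite lee_fin lerD2l dmono.
- rewrite leNgt; apply/negP => /ltW mid_lt; apply: (Jm k).
  exists (fun y => 2^-1 * (uG k).1 y + 2^-1 * (uG l).1 y).
    apply: (competitorS (Cmono _ _ (Jj k))); apply: competitor_mid => //.
    exact: competitorS (Cmono _ _ (jmono _ _ kl)) xCv.
  split; first exact: continuous_lin.
  exists (fun y => 2^-1 *: (uG k).2 y + 2^-1 *: (uG l).2 y); last exact: mid_lt.
  exact: weak_gradient_lin.
Qed.

Lemma cap_le_bigcup e x (C_ : nat -> set 'rV[R]_n) : 2 <= p -> n%:R < p ->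
  (forall i j, (i <= j)%N -> C_ i `<=` C_ j) ->
  (forall j d, 0 < d -> cap_le (e + d) x (C_ j)) -> cap_le e x (\bigcup_j C_ j).
Proof.
move=> p2 np Cmono Ce; have p1 : 1 <= p by apply: le_trans p2; rewrite ler1n.
have [m me thr] := @monotone_threshold R (fun j a => cap_le a x (C_ j)) e
  (fun j a b => @cap_leW a b x (C_ j)) (fun j a => @cap_le_ge0 a x (C_ j)) Ce.
have p0 : 0 < p by exact: lt_le_trans p1.
pose q : R := 2^-1 `^ p; have q01 := powR_ge0_lt1 (half_ge0_lt1 R) p0.
have qE k : (2^-1 ^+ k) `^ p = q ^+ k :> R by rewrite powR_exprC ?invr_ge0.
pose z : R := (2 `^ p * 2)^-1; have t0 : 0 < 2 `^ p * 2 :> R by rewrite mulr_gt0 ?powR_gt0.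
have z0 : 0 < z by rewrite invr_gt0.
pose d_ k := z * q ^+ k.
have d0 k : 0 < d_ k by rewrite mulr_gt0// -qE powR_gt0// exprn_gt0 ?invr_gt0.
have dmono k l : (k <= l)%N -> d_ l <= d_ k.
  by move=> kl; rewrite ler_wpM2l ?(ltW z0)//; case/andP: q01 => ? /ltW ?; exact: ler_wiXn2l.
have /choice[J JP] : forall k, exists j, ~ cap_le (m - d_ k) x (C_ j).
  by move=> k; have [_] := thr _ (d0 k).
have [u_ [G_ uP]] := almost_minimizers_cauchy p2 Cmono dmono
  (fun k j => (thr _ (d0 k)).1 j) JP.
have [w wm uw] : exists2 w, sobolev_le p m w & forall y, u_ k y @[k --> \oo] --> (w y : R).
  apply: (@sobolev_limit _ _ p x 1 2^-1 m d_ u_ G_) => //.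
  - by rewrite invr_gt0 ltr0n invf_lt1 ?ltr1n.
  - by move=> k; have [] := uP k.
  - by move=> k; have [] := uP k.
  - by move=> k; have [[]] := uP k.
  - move=> k l kl; have [_ _ _ _ /(_ l kl)] := uP k.
    by rewrite /d_ /z -qE mulrA mulrA mulfV ?mul1r// gt_eqF.
  - by move=> k; have [] := uP k.
  - exact: cvg_geometric0.
exists w; last exact: sobolev_leW wm.
split=> [|y [i _ Ciy]]; apply: (cvg_unique _ (uw _)); try exact: Rhausdorff.
  rewrite (_ : (fun k => u_ k x) = cst 1); first exact: cvg_cst.
  by apply/funext => k; have [[]] := uP k.
apply: cvg_near_cst; exists i => // k /= ik.
by have [[_ uC] _ _ _ _] := uP k; apply: uC; exact: Cmono ik _ Ciy.
Qed.

Lemma cap_le_shift : 1 <= p -> n%:R < p -> exists2 K : R, 0 <= K &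
  forall M e x y C, 0 < M -> e <= M `^ p ->
    K * M * `|x - y| `^ morrey_exponent n p < 1 -> cap_le e x C ->
    cap_le ((1 - K * M * `|x - y| `^ morrey_exponent n p)^-1 `^ p * e) y C.
Proof.
move=> p1 np; have p0 : 0 < p by exact: lt_le_trans p1.
have [K K0 morreyK] := morrey p1 np; exists K => // M e x y C M0 eM.
set r := K * M * _ => r1 [u [ux uC] ue].
have := morreyK u M M0 (sobolev_leW eM ue) x y; rewrite ux -/r => uy.
have uy0 : 0 < 1 - r by rewrite subr_gt0.
have uyr : 1 - r <= u y by have := le_trans (ler_norm _) uy; lra.
have uypos : 0 < u y by exact: lt_le_trans uyr.
exists (fun z => (u y)^-1 * u z).
  by split=> [|z /uC ->]; rewrite ?mulr0// mulVf// gt_eqF.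
apply: sobolev_leW (sobolev_leZ (u y)^-1 ue).
rewrite ler_wpM2r ?(sobolev_le_ge0 ue)// ger0_norm ?invr_ge0 ?(ltW uypos)//.
apply: ge0_ler_powR; rewrite ?nnegrE ?invr_ge0 ?(ltW p0) ?(ltW uypos) ?(ltW uy0)//.
by rewrite lef_pV2.
Qed.

Lemma cap_le_cvg (e_ : R^nat) e (x_ : nat -> 'rV[R]_n) x0 C : 2 <= p -> n%:R < p ->
  e_ k @[k --> \oo] --> e -> x_ k @[k --> \oo] --> x0 ->
  (forall k, cap_le (e_ k) (x_ k) C) -> cap_le e x0 C.
Proof.
move=> p2 np e_cvg x_cvg Ce; have p1 : 1 <= p by apply: le_trans p2; rewrite ler1n.
have p0 : 0 < p by exact: lt_le_trans p1.
have [K K0 shiftK] := cap_le_shift p1 np; set al := morrey_exponent n p in shiftK.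
have al0 : 0 < al := morrey_exponent_gt0 p1 np.
pose M := (`|e| + 1) `^ p^-1.
have M0 : 0 < M by rewrite powR_gt0// ltr_wpDl.
pose r_ k := K * M * `|x_ k - x0| `^ al.
have r_cvg : r_ k @[k --> \oo] --> (0 : R).
  rewrite -[X in _ --> X](mulr0 (K * M)); apply: cvgM; first exact: cvg_cst.
  rewrite -[X in _ --> X](powR0 (lt0r_neq0 al0)); apply: cvg_powR => //.
  rewrite -[X in _ --> X](@normr0 _ 'rV[R]_n) -(subrr x0); apply: cvg_norm.
  by apply: cvgB => //; exact: cvg_cst.
have dilation_cvg : (1 - r_ k)^-1 @[k --> \oo] --> (1 : R).
  rewrite -[X in _ --> X]invr1; apply: cvgV => //.
  by rewrite -[X in _ --> X](subr0 1); apply: cvgB => //; exact: cvg_cst.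
have r_lt1 : \forall k \near \oo, r_ k < 1 by exact: (cvgr_lt _ r_cvg).
have bound_cvg : `|(1 - r_ k)^-1| `^ p * e_ k @[k --> \oo] --> e.
  rewrite [X in _ --> X](_ : e = `|1| `^ p * e); last by rewrite normr1 powR1 mul1r.
  by apply: cvgM => //; apply: cvg_powR => //; exact: cvg_norm.
have -> : C = \bigcup_(j : nat) C.
  by apply/seteqP; split=> [z Cz|z [_ _ //]]; exists 0%N.
apply: (@cap_le_bigcup e x0 (fun=> C)) => // [i j _ //|j d d0].
have e_le : \forall k \near \oo, e_ k <= `|e| + 1.
  by apply: (cvgr_le _ e_cvg); rewrite (le_lt_trans (ler_norm e))// ltrDl.
have bound_le : \forall k \near \oo, `|(1 - r_ k)^-1| `^ p * e_ k <= e + d.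
  by apply: (cvgr_le _ bound_cvg); rewrite ltrDl.
have [k [[rk ek] bk]] := filter_ex (filterI (filterI r_lt1 e_le) bound_le).
apply: cap_leW bk _; rewrite ger0_norm ?invr_ge0 ?subr_ge0 ?(ltW rk)//.
apply: shiftK => //; rewrite powRVK ?gt_eqF//; exact: addr_ge0.
Qed.

End point_capacity.

(** * Geometry of the domain *)

Section graph_normal.
Variables (R : realType) (n : nat) (l : 'I_n) (h : 'rV[R]_n.-1 -> R).
Implicit Types (a : 'rV[R]_n.-1) (v y z : 'rV[R]_n).

Definition graph_normal a : 'rV[R]_n :=
  \row_i oapp (fun j => - partial j h a) 1 (unlift l i).

Lemma dotv_graph_normal a v : dotv v (graph_normal a) =
  v 0 l - \sum_(j < n.-1) partial j h a * v 0 (lift l j).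
Proof.
rewrite /dotv (bigD1_ord l)//= mxE unlift_none/= mulr1; congr (_ + _).
by rewrite -sumrN; apply: eq_bigr => j _; rewrite mxE liftK/= mulrN mulrC.
Qed.

Lemma enorm_graph_normal_ge1 a : 1 <= enorm (graph_normal a).
Proof.
by apply: le_trans (norm_coord_le_enorm _ l); rewrite mxE unlift_none/= normr1.
Qed.

Lemma norm_col'_le v : `|col' l v| <= `|v|.
Proof.
by apply: rV_norm_le => // j; rewrite mxE norm_coord_le.
Qed.

Lemma C1_epigraph_normal a (e : R) : C1 h -> 0 < e ->
  exists2 d : R, 0 < d & forall y z, `|col' l y - a| < d -> `|col' l z - a| < d ->
    h (col' l y) < y 0 l -> z 0 l <= h (col' l z) ->
    - (e * `|y - z|) <= dotv (y - z) (graph_normal a).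
Proof.
move=> Ch e0; have [d d0 hd] := C1_strict_differentiable a Ch e0.
exists d => // y z ya za hy hz; have := hd _ _ ya za.
have -> : \sum_(j < n.-1) partial j h a * (col' l y 0 j - col' l z 0 j) =
    y 0 l - z 0 l - dotv (y - z) (graph_normal a).
  rewrite dotv_graph_normal !mxE opprB addrCA subrr addr0.
  by apply: eq_bigr => j _; rewrite !mxE.
have : e * `|col' l y - col' l z| <= e * `|y - z|.
  by rewrite ler_wpM2l ?(ltW e0)// -raddfB norm_col'_le.
rewrite ler_norml => eyz /andP[+ _]; move: hy hz eyz.
move: (h (col' l y)) (h (col' l z)) (dotv _ _) (e * `|col' l y - _|) (e * `|y - z|).
by move=> *; lra.
Qed.

End graph_normal.

Section C1_domain_normal.
Variables (R : realType) (n : nat) (Omega : set 'rV[R]_n).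

(* To first order at a boundary point, [Omega] lies on the inner side of the
   tangent hyperplane through any nearby point of its complement. *)
Lemma C1_domain_normal (x0 : 'rV[R]_n) : C1_domain Omega -> boundary Omega x0 ->
  exists2 nu : 'rV[R]_n, enorm nu = 1 & forall e : R, 0 < e ->
    exists2 rho : R, 0 < rho & forall x z : 'rV[R]_n,
      enorm (x - x0) < rho -> enorm (z - x0) < rho -> Omega x -> ~ Omega z ->
      - (e * enorm (x - z)) <= dotv (x - z) nu.
Proof.
move=> CO /CO[r [Q [b [h [l [r0 QQ Ch _ chartP]]]]]].
have QQ' : Q^T *m Q = 1%:M by exact: mulmx1C.
pose chart (x : 'rV[R]_n) := x *m Q + b.
have chartB x y : chart x - chart y = (x - y) *m Q.
  by rewrite /chart opprD addrACA subrr addr0 mulmxBl.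
pose c := graph_normal l h (col' l (chart x0)).
have c1 : 1 <= enorm c by exact: enorm_graph_normal_ge1.
have c0 : 0 < enorm c by exact: lt_le_trans c1.
have dotE v : dotv v (c *m Q^T) = dotv (v *m Q) c.
  by rewrite -(dotv_mulmx v _ QQ) -mulmxA QQ' mulmx1.
exists ((enorm c)^-1 *: (c *m Q^T)).
  by rewrite enormZ enorm_mulmx ?trmxK// ger0_norm ?invr_ge0 ?enorm_ge0// mulVf// gt_eqF.
move=> e e0; have [d d0 hd] := C1_epigraph_normal l (col' l (chart x0)) Ch e0.
have near_chart x : enorm (x - x0) < d -> `|col' l (chart x) - col' l (chart x0)| < d.
  apply: le_lt_trans; rewrite -raddfB; apply: le_trans (norm_col'_le _ _) _.
  by rewrite chartB; apply: le_trans (norm_le_enorm _) _; rewrite enorm_mulmx.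
exists (Num.min r d); first by rewrite lt_min r0.
move=> x z; rewrite !lt_min => /andP[xr xd] /andP[zr zd] Ox Oz.
have hx : h (col' l (chart x)) < chart x 0 l by apply/(chartP x xr).
have hz : chart z 0 l <= h (col' l (chart z)).
  by rewrite leNgt; apply/negP => hz; apply: Oz; apply/(chartP z zr).
have := hd _ _ (near_chart _ xd) (near_chart _ zd) hx hz; rewrite chartB -dotE => side.
rewrite dotvZr ler_pdivlMl//; apply: le_trans side.
rewrite mulrN lerN2 mulrCA ler_wpM2l ?(ltW e0)//.
apply: le_trans (norm_le_enorm _) _; rewrite enorm_mulmx//.
by rewrite ler_peMl ?enorm_ge0.
Qed.

End C1_domain_normal.

Section dist_compl.
Variables (R : realType) (n : nat) (Omega : set 'rV[R]_n).
Local Notation d := (dist_compl Omega).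
Implicit Types x y z : 'rV[R]_n.

Lemma dist_compl_le x z : ~ Omega z -> d x <= enorm (x - z).
Proof.
move=> Oz; apply: ge_inf; last by exists z.
by exists 0 => _ [y _ <-]; exact: enorm_ge0.
Qed.

Lemma dist_compl_adherent x (e : R) : ~` Omega !=set0 -> 0 < e ->
  exists2 z, ~ Omega z & enorm (x - z) < d x + e.
Proof.
move=> [z0 Oz0] e0.
have [] := @inf_adherent _ [set enorm (x - y) | y in ~` Omega] e e0.
  split; first by exists (enorm (x - z0)), z0.
  by exists 0 => _ [y _ <-]; exact: enorm_ge0.
by move=> _ [z Oz <-] xz; exists z.
Qed.

Lemma dist_compl_gt0 x : open Omega -> ~` Omega !=set0 -> Omega x -> 0 < d x.
Proof.
move=> oO cO0 Ox; have /nbhs_ballP[e /= e0 eO] := open_nbhs_nbhs (conj oO Ox).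
apply: (lt_le_trans e0); apply: lb_le_inf.
  by have [z0 Oz0] := cO0; exists (enorm (x - z0)), z0.
move=> _ [y Oy <-]; rewrite leNgt; apply/negP => xy; apply: Oy; apply: eO.
by rewrite mx_norm_ball /ball_/=; apply: le_lt_trans (norm_le_enorm _) xy.
Qed.

Lemma dist_compl_lipschitz x y : ~` Omega !=set0 -> `|d x - d y| <= enorm (x - y).
Proof.
move=> cO0; have upper a b : d a <= d b + enorm (a - b).
  apply/ler_addgt0Pr => e e0; have [z Oz bz] := dist_compl_adherent b cO0 e0.
  apply: le_trans (dist_compl_le a Oz) _.
  have -> : a - z = (a - b) + (b - z) by rewrite addrA subrK.
  by apply: le_trans (ler_enormD _ _) _; rewrite addrC addrAC lerD2r ltW.
have := upper x y; have := upper y x; rewrite -(enormN (y - x)) opprB.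
by rewrite ler_norml => yx xy; apply/andP; split; lra.
Qed.

Lemma enorm_cvg0 (x_ : nat -> 'rV[R]_n) x : x_ k @[k --> \oo] --> x ->
  enorm (x_ k - x) @[k --> \oo] --> (0 : R).
Proof.
move=> x_cvg; have diff_cvg : x_ k - x @[k --> \oo] --> (0 : 'rV[R]_n).
  by rewrite -(subrr x); apply: cvgB => //; exact: cvg_cst.
by rewrite -(enorm0 R n); apply: continuous_cvg diff_cvg; exact: enorm_continuous.
Qed.

Lemma dist_compl_cvg (x_ : nat -> 'rV[R]_n) x : ~` Omega !=set0 ->
  x_ k @[k --> \oo] --> x -> d (x_ k) @[k --> \oo] --> d x.
Proof.
move=> cO0 /enorm_cvg0; apply: squeeze_dist => k.
exact: dist_compl_lipschitz.
Qed.

(* In the coordinates [eta = (y - x) / d x] of the blow-up at [x], the domain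
   is asymptotically contained in the half-space [eta . nu > -1]. *)
Lemma C1_domain_blowup x0 : C1_domain Omega -> boundary Omega x0 -> ~ Omega x0 ->
  exists2 nu : 'rV[R]_n, enorm nu = 1 & forall c L : R, 0 < c ->
    exists2 rho : R, 0 < rho & forall x, enorm (x - x0) < rho -> 0 < d x ->
      forall eta, enorm eta <= L -> dotv eta nu <= - (1 + c) ->
      ~ Omega (d x *: eta + x).
Proof.
move=> CO bO Ox0; have [nu nu1 nuP] := C1_domain_normal CO bO.
exists nu => // c L c0; pose D : R := 2 + c + `|L|.
have D0 : 0 < D by rewrite /D; have := normr_ge0 L; lra.
have e0 : 0 < c / 2 / D by rewrite !divr_gt0.
have [r0 r00 rP] := nuP _ e0.
exists (r0 / D) => [|x xx0 dx eta eL etanu Oeta]; first by rewrite divr_gt0.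
set s := d x in dx Oeta.
have sx : s <= enorm (x - x0) by exact: dist_compl_le.
have [z Oz xz] := @dist_compl_adherent x (c / 2 * s) (ex_intro _ x0 Ox0)
  (mulr_gt0 (divr_gt0 c0 (ltr0Sn _ 1)) dx).
rewrite -/s in xz; have L0 : 0 <= L by apply: le_trans eL; exact: enorm_ge0.
rewrite ltr_pdivlMr// /D ger0_norm// in xx0; have E0 := enorm_ge0 (x - x0).
have blowup_near : enorm (s *: eta + x - x0) < r0.
  rewrite -addrA; apply: le_lt_trans (ler_enormD _ _) _.
  by rewrite enormZ gtr0_norm//; have := enorm_ge0 eta; nra.
have z_near : enorm (z - x0) < r0.
  have -> : z - x0 = - (x - z) + (x - x0) by rewrite opprB addrA subrK.
  by apply: le_lt_trans (ler_enormD _ _) _; rewrite enormN; nra.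
have dist_le : enorm (s *: eta + x - z) <= s * D - c / 2 * s.
  rewrite -addrA; apply: le_trans (ler_enormD _ _) _.
  by rewrite enormZ gtr0_norm// /D ger0_norm//; have := ler_wpM2l (ltW dx) eL; nra.
have side : dotv (s *: eta + x - z) nu <= - (c / 2 * s).
  rewrite -addrA dotvDl dotvZl; have := ler_wpM2l (ltW dx) etanu.
  by have := le_trans (ler_norm _) (dotv_le (x - z) nu); rewrite nu1 mulr1; lra.
have := rP _ _ blowup_near z_near Oeta Oz => /le_trans/(_ side); rewrite lerN2.
move=> /le_trans/(_ (ler_wpM2l (ltW e0) dist_le)).
have -> : c / 2 / D * (s * D - c / 2 * s) = c / 2 * s - c / 2 / D * (c / 2 * s).
  by field; rewrite gt_eqF.
by rewrite lerDl oppr_ge0 leNgt => /negP; apply; rewrite !mulr_gt0// invr_gt0.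
Qed.

End dist_compl.

Section half_space.
Variables (R : realType) (n : nat).

Lemma half_spaceE (l : 'I_n) : l.+1 = n ->
  half_space R n = [set x : 'rV[R]_n | 0 < x 0 l].
Proof.
move=> ln; apply/seteqP; split => x /=; last by move=> xl; exists l.
by move=> [k kn xk]; have -> // : l = k; apply/val_inj/eqP; rewrite -eqSS ln kn.
Qed.

Lemma open_half_space (l : 'I_n) : l.+1 = n -> open (half_space R n).
Proof.
move=> ln; rewrite (half_spaceE ln).
apply: (@open_comp _ _ (fun x : 'rV[R]_n => x 0 l) [set y : R | 0 < y]).
  by move=> x _; exact: coord_continuous.
exact: open_gt.
Qed.

End half_space.

(** * Rayleigh quotients *)

Section D1p_energy.
Variables (R : realType) (n : nat) (p : R).
Local Notation mu := (lebesgue_rV R n).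
Implicit Type u : 'rV[R]_n -> R.
Hypothesis p1 : 1 <= p.

Let p0 : 0 < p. Proof. exact: lt_le_trans p1. Qed.

Lemma sobolev_le_D1p e u : sobolev_le p e u -> D1p p u.
Proof.
move=> [cu [G uG Ge]]; split; first exact: loc_integrable_continuous.
have mG := measurable_weak_gradient uG; exists G => // i.
have mGi := measurable_fun_coord i mG.
rewrite inE; apply/andP; split; first by rewrite inE.
rewrite inE/= /finite_norm; apply: (@lty_poweRy _ _ p); first by rewrite gt_eqF.
rewrite powR_Lnorm ?gt_eqF//; apply: (@le_lt_trans _ _ (energy p G)); last first.
  exact: le_lt_trans Ge (ltry _).
rewrite -[leLHS]/(\int[mu]_x (`|G x 0%R i| `^ p)%:E)%E.
apply: ge0_le_integral => //.
- apply/measurable_EFinP; apply: (measurableT_comp (measurable_powR p)).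
  exact: measurableT_comp.
- exact: measurable_energy.
- move=> x _; rewrite lee_fin.
  by apply: ge0_ler_powR; rewrite ?nnegrE ?enorm_ge0 ?norm_coord_le_enorm// ltW.
Qed.

Lemma norm_powR_le_sum (x : 'rV[R]_n) : `|x| `^ p <= \sum_(i < n) `|x 0 i| `^ p.
Proof.
have [x0|x0] := eqVneq `|x| 0.
  by rewrite x0 powR0 ?gt_eqF// sumr_ge0// => i _; exact: powR_ge0.
have /mx_norm_neq0[[i j]/= xE] : mx_norm x != 0 by [].
rewrite (ord1 i) in xE; rewrite [`|x|]xE (bigD1 j)//= lerDl.
by apply: sumr_ge0 => k _; exact: powR_ge0.
Qed.

Lemma D1p_energy_lty u : D1p p u ->
  exists2 G, weak_gradient u G & (energy p G < +oo)%E.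
Proof.
move=> [_ [G uG GL]]; exists G => //; have mG := measurable_weak_gradient uG.
have := integrableZl measurableT (n%:R `^ p)
  (integrable_sum measurableT (index_enum 'I_n) (P := xpredT)
    (fun i _ => Lfun_integrable p1 (GL i))).
move=> /integrableP[miG]; apply: le_lt_trans.
apply: ge0_le_integral => //.
- by move=> x _; rewrite lee_fin powR_ge0.
- exact: measurable_energy.
- exact: measurableT_comp.
move=> x _; apply: le_trans (lee_abs _); rewrite sumEFin -EFinM lee_fin.
apply: (@le_trans _ _ ((n%:R * `|G x|) `^ p)).
  apply: ge0_ler_powR; rewrite ?nnegrE ?enorm_ge0 ?(ltW p0) ?mulr_ge0//.
  exact: enorm_le_norm.
by rewrite powRM// ler_wpM2l ?powR_ge0// norm_powR_le_sum.
Qed.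

End D1p_energy.

Section rayleigh.
Variables (R : realType) (n : nat) (p : R) (Omega : set 'rV[R]_n).
Implicit Types (u : 'rV[R]_n -> R) (x : 'rV[R]_n) (e a L : R).
Hypothesis p1 : 1 <= p.
Local Notation d := (dist_compl Omega).
Local Notation alpha := (morrey_exponent n p).

Let p0 : 0 < p. Proof. exact: lt_le_trans p1. Qed.

Lemma rayleigh_ge0 u : (0 <= rayleigh p Omega u)%E.
Proof. by rewrite mule_ge0// ?inve_ge0 poweR_ge0. Qed.

Lemma lambda_ge0 : (0 <= lambda p Omega)%E.
Proof. by apply: le_ereal_inf_tmp => _ [u _ <-]; exact: rayleigh_ge0. Qed.

Lemma competitor_D1p0_neq0 e u x : competitor x (~` Omega) u -> sobolev_le p e u ->
  D1p0_neq0 p Omega u.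
Proof.
move=> [ux u0] ue; split; last first.
  by move=> u00; move: ux; rewrite u00 => /eqP; rewrite eq_sym oner_eq0.
by split=> //; [exact: sobolev_le_D1p ue|case: ue].
Qed.

Lemma rayleigh_le e u x : sobolev_le p e u -> Omega x -> u x = 1 -> 0 < d x ->
  (rayleigh p Omega u <= (d x `^ (p - n%:R) * e)%:E)%E.
Proof.
move=> [_ [G uG Ge]] Ox ux dx.
have D0 : 0 < d x `^ (p - n%:R) by exact: powR_gt0.
rewrite /rayleigh (grad_normE p0 uG) EFinM.
apply: lee_pmul; [by rewrite inve_ge0 poweR_ge0|exact: energy_ge0| |exact: Ge].
rewrite inve_ple ?inE ?poweR_ge0// ?lee_fin ?(ltW D0)// inver (gt_eqF D0).
have -> : ((d x `^ (p - n%:R))^-1)%:E = ((d x `^ (- alpha))%:E `^ p)%E.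
  by rewrite poweR_EFin -powRrM mulNr morrey_exponentE// powRN.
have hardy_ge : ((d x `^ (- alpha))%:E <= hardy_norm p Omega u)%E.
  apply: ereal_sup_ubound; exists x => //.
  by rewrite ux mul1r ger0_norm ?invr_ge0 ?powR_ge0// powRN.
apply: gt0_ler_poweR => //; first exact: ltW.
- by rewrite in_itv/= leey andbT lee_fin powR_ge0.
- by rewrite in_itv/= leey andbT (le_trans _ hardy_ge)// lee_fin powR_ge0.
Qed.

Lemma lambda_le e x : Omega x -> 0 < d x -> cap_le p e x (~` Omega) ->
  (lambda p Omega <= (d x `^ (p - n%:R) * e)%:E)%E.
Proof.
move=> Ox dx [u xu ue]; apply: le_trans (rayleigh_le ue Ox xu.1 dx).
by apply: ereal_inf_lbound; exists u => //; exact: competitor_D1p0_neq0 xu ue.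
Qed.

Lemma extremal_of_cap_le L x : lambda p Omega = L%:E -> Omega x -> 0 < d x ->
  cap_le p (L / d x `^ (p - n%:R)) x (~` Omega) -> exists u, extremal p Omega u.
Proof.
move=> lL Ox dx [u xu ue]; exists u; have Du := competitor_D1p0_neq0 xu ue.
split=> //; apply/eqP; rewrite eq_le; apply/andP; split; last first.
  by apply: ereal_inf_lbound; exists u.
apply: le_trans (rayleigh_le ue Ox xu.1 dx) _.
by rewrite lL lee_fin mulrC divfK// gt_eqF// powR_gt0.
Qed.

Lemma hardy_norm_gt0 u : (forall x, Omega x -> 0 < d x) -> u <> cst 0 ->
  (forall x, ~ Omega x -> u x = 0) -> (0 < hardy_norm p Omega u)%E.
Proof.
move=> dp un0 u0; have [x ux] : exists x, u x != 0.
  apply: contra_notP un0 => /forallNP u00; apply/funext => x.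
  by apply/eqP/negPn/negP; exact: u00.
have Ox : Omega x by apply: contrapT => /u0 /eqP; rewrite (negbTE ux).
apply: (@lt_le_trans _ _ (`|u x / d x `^ alpha|)%:E).
  by rewrite lte_fin normr_gt0 mulf_neq0// invr_eq0 gt_eqF// powR_gt0// dp.
by apply: ereal_sup_ubound; exists x.
Qed.

(* The supremum defining the Hardy norm need not be attained, but it is nearly
   attained at some point, and this is enough for a strict bound. *)
Lemma rayleigh_lt_point u G E a : weak_gradient u G -> energy p G = E%:E ->
  0 < a -> (0 < hardy_norm p Omega u)%E -> (rayleigh p Omega u < a%:E)%E ->
  exists2 x, Omega x & E < a * `|u x / d x `^ alpha| `^ p.
Proof.
move=> uG GE a0 hardy0; rewrite /rayleigh (grad_normE p0 uG) GE => ua.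
have E0 : 0 <= E by rewrite -lee_fin -GE; exact: energy_ge0.
pose t := (E / a) `^ p^-1; have tp : t `^ p = E / a.
  by rewrite powRVK ?gt_eqF// divr_ge0// ltW.
have : (t%:E < hardy_norm p Omega u)%E.
  move: ua hardy0; case: (hardy_norm p Omega u) => [h| |]//; last by move=> _ _; rewrite ltry.
  rewrite !lte_fin => + h0; rewrite poweR_EFin inver gt_eqF ?powR_gt0//.
  rewrite -EFinM lte_fin ltr_pdivrMl ?powR_gt0// => Eh.
  rewrite ltNge; apply/negP => ht; have : h `^ p <= t `^ p.
    by apply: ge0_ler_powR; rewrite ?nnegrE ?powR_ge0// ltW.
  by rewrite tp ler_pdivlMr// leNgt Eh.
move=> /ereal_sup_gt[_ [x Ox <-]]; rewrite lte_fin => tx; exists x => //.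
rewrite mulrC -ltr_pdivrMr// -tp.
by apply: gt0_ltr_powR; rewrite ?nnegrE ?powR_ge0.
Qed.

Lemma lambda_near_minimizer L e : open Omega -> ~` Omega !=set0 ->
  lambda p Omega = L%:E -> 0 < e ->
  exists2 x, Omega x & cap_le p ((L + e) / d x `^ (p - n%:R)) x (~` Omega).
Proof.
move=> oO cO lL e0; have dp x : Omega x -> 0 < d x by exact: dist_compl_gt0.
have Le : 0 < L + e by rewrite ltr_wpDl// -lee_fin -lL lambda_ge0.
have lfin : lambda p Omega \is a fin_num by rewrite lL.
have [_ [u [[Du cu u0] un0] <-]] := lb_ereal_inf_adherent e0 lfin.
rewrite -/(lambda p Omega) lL -EFinD => ur.
have [G uG Gfin] := D1p_energy_lty p1 Du.
have GE : energy p G = (fine (energy p G))%:E by rewrite fineK// ge0_fin_numE ?energy_ge0.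
have [x Ox] := rayleigh_lt_point uG GE Le (hardy_norm_gt0 dp un0 u0) ur.
set E := fine _ in GE * => Ex; exists x => //.
have E0 : 0 <= E by rewrite -lee_fin -GE energy_ge0.
have D0 : 0 < d x `^ (p - n%:R) by rewrite powR_gt0// dp.
have ux0 : 0 < `|u x| `^ p.
  rewrite powR_gt0// normr_gt0; apply: contraTneq Ex => ->.
  by rewrite mul0r normr0 powR0 ?gt_eqF// mulr0 -leNgt.
exists (fun y => (u x)^-1 * u y).
  split=> [|y /u0 ->]; last by rewrite mulr0.
  by rewrite mulVf//; apply: contraTneq ux0 => ->; rewrite normr0 powR0 ?gt_eqF// ltxx.
have uE : sobolev_le p E u by split=> //; exists G => //; rewrite GE.
apply: sobolev_leW (sobolev_leZ (u x)^-1 uE).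
rewrite normfV powRV// ler_pdivrMl// mulrA ler_pdivlMr//.
have := ltW Ex; rewrite normrM normfV (ger0_norm (powR_ge0 _ _)).
rewrite powRM// ?invr_ge0 ?powR_ge0// powRV ?powR_ge0// -powRrM morrey_exponentE//.
by rewrite mulrA ler_pdivlMr// mulrC [X in _ <= X]mulrC [X in X <= _]mulrC.
Qed.

End rayleigh.

(** * Concentration *)

Lemma compact_subsequence (R : realType) (V : normedModType R) (K : set V) (x_ : nat -> V) :
  compact K -> (forall k, K (x_ k)) -> exists (x : V) (phi : nat -> nat),
    (forall k, (k <= phi k)%N) /\ x_ (phi k) @[k --> \oo] --> x.
Proof.
move=> cK xK; have FK : (x_ @ \oo) K by exists 0%N => // k _; exact: xK.
have [x [_ cx]] := cK (x_ @ \oo) _ FK.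
have h0 k : 0 < 2^-1 ^+ k :> R by rewrite exprn_gt0 ?invr_gt0.
have /choice[phi phiP] k : exists l, (k <= l)%N /\ `|x - x_ l| < 2^-1 ^+ k.
  have Fk : (x_ @ \oo) [set x_ l | l in [set l | (k <= l)%N]].
    by exists k => // l /= kl; exists l.
  have [_ [[l kl <-]]] := cx _ _ Fk (nbhsx_ballx x _ (h0 k)).
  by rewrite -ball_normE => xl; exists l.
exists x, phi; split=> [k|]; first by have [] := phiP k.
have h_cvg := cvg_geometric0 1 (half_ge0_lt1 R).
apply/cvgrPdist_lt => e e0; have /cvgrPdist_lt/(_ e e0) := h_cvg.
apply: filterS => k; rewrite mul1r sub0r normrN gtr0_norm//.
by apply: lt_trans; have [] := phiP k.
Qed.

Lemma boundary_of_cvg (T : topologicalType) (A : set T) (x_ : nat -> T) (x : T) :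
  (forall k, A (x_ k)) -> x_ k @[k --> \oo] --> x -> ~ A x -> boundary A x.
Proof.
move=> Ax_ x_cvg Ax; split=> [U /x_cvg[N _ /(_ N (leqnn N)) UN]|/interior_subset//].
by exists (x_ N).
Qed.

Section minimizing_sequence.
Variables (R : realType) (n : nat) (p L : R) (Omega : set 'rV[R]_n).
Local Notation d := (dist_compl Omega).
Hypotheses (p2 : 2 <= p) (np : n%:R < p).
Hypotheses (Omega_open : open Omega) (coOmega_neq0 : ~` Omega !=set0).
Hypothesis lambdaE : lambda p Omega = L%:E.

Let p1 : 1 <= p. Proof. by apply: le_trans p2; rewrite ler1n. Qed.

Let d_gt0 x : Omega x -> 0 < d x. Proof. exact: dist_compl_gt0. Qed.

Definition minimizing (x_ : nat -> 'rV[R]_n) := forall k, Omega (x_ k) /\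
  cap_le p ((L + 2^-1 ^+ k) / d (x_ k) `^ (p - n%:R)) (x_ k) (~` Omega).

Lemma cvg_minimizing_sequence : bounded_set Omega ->
  exists (x0 : 'rV[R]_n) (x_ : nat -> 'rV[R]_n),
    minimizing x_ /\ x_ k @[k --> \oo] --> x0.
Proof.
move=> /pinfty_ex_gt0[B _ OB]; have h0 k : 0 < 2^-1 ^+ k :> R by rewrite exprn_gt0 ?invr_gt0.
have /choice[x_ xP] k : exists x, Omega x /\
    cap_le p ((L + 2^-1 ^+ k) / d x `^ (p - n%:R)) x (~` Omega).
  have [x Ox xc] := lambda_near_minimizer p1 Omega_open coOmega_neq0 lambdaE (h0 k).
  by exists x.
have xB k : normball B (x_ k) by apply: OB; have [] := xP k.
have [x0 [phi [kphi x_cvg]]] := compact_subsequence (@compact_normball R n B) xB.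
exists x0, (fun k => x_ (phi k)); split; last exact: x_cvg.
move=> k; have [Ox xc] := xP (phi k); split; first exact: Ox.
apply: cap_leW xc; rewrite ler_wpM2r ?invr_ge0 ?powR_ge0// lerD2l.
by rewrite ler_wiXn2l ?invr_ge0// invf_le1// ler1n.
Qed.

Variables (x_ : nat -> 'rV[R]_n) (x0 : 'rV[R]_n).
Hypotheses (x_min : minimizing x_) (x_cvg : x_ k @[k --> \oo] --> x0).

Let half_cvg : 2^-1 ^+ k @[k --> \oo] --> (0 : R).
Proof. by have := cvg_geometric0 1 (half_ge0_lt1 R); under eq_fun do rewrite mul1r. Qed.

Lemma interior_extremal : Omega x0 -> exists u, extremal p Omega u.
Proof.
move=> Ox0; apply: (extremal_of_cap_le p1 lambdaE Ox0 (d_gt0 Ox0)).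
apply: (cap_le_cvg p2 np _ x_cvg (fun k => (x_min k).2)).
apply: cvgM; first by rewrite -[X in _ --> X]addr0; apply: cvgD => //; exact: cvg_cst.
apply: cvgV; first by rewrite gt_eqF// powR_gt0// d_gt0.
apply: cvg_powR; first by rewrite subr_gt0.
  by move=> k; rewrite ltW// d_gt0//; have [] := x_min k.
exact: dist_compl_cvg.
Qed.

Lemma blowup_cap_le k :
  cap_le p (L + 2^-1 ^+ k) 0 [set eta | ~ Omega (d (x_ k) *: eta + x_ k)].
Proof.
have [Ok xc] := x_min k; have dk := d_gt0 Ok.
have -> : L + 2^-1 ^+ k =
    d (x_ k) `^ (p - n%:R) * ((L + 2^-1 ^+ k) / d (x_ k) `^ (p - n%:R)).
  by rewrite mulrC divfK// gt_eqF// powR_gt0.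
by apply: (@cap_le_homothety _ _ p _ (x_ k) _ 0 (~` Omega)) => //; rewrite scaler0 add0r.
Qed.

Definition truncated_half_space (nu : 'rV[R]_n) (j : nat) :=
  [set eta | enorm eta <= j%:R /\ dotv eta nu <= - (1 + j.+1%:R^-1)].

Lemma blowup_truncated_half_space : C1_domain Omega -> ~ Omega x0 ->
  exists2 nu, enorm nu = 1 & forall j e, 0 < e ->
    cap_le p (L + e) 0 (truncated_half_space nu j).
Proof.
move=> CO Ox0; have [nu nu1 nuP] := C1_domain_blowup CO
  (boundary_of_cvg (fun k => (x_min k).1) x_cvg Ox0) Ox0.
exists nu => // j e e0.
have j0 : 0 < j.+1%:R^-1 :> R by rewrite invr_gt0.
have [rho rho0 rhoP] := nuP _ j%:R j0.
have near_rho : \forall k \near \oo, enorm (x_ k - x0) < rho.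
  exact: (cvgr_lt _ (enorm_cvg0 x_cvg)).
have near_e : \forall k \near \oo, 2^-1 ^+ k <= e by exact: (cvgr_le _ half_cvg).
have [k [k_rho k_e]] := filter_ex (filterI near_rho near_e).
apply: cap_leW (cap_leS _ (blowup_cap_le k)); first by rewrite lerD2l.
by move=> eta [eta_j eta_nu]; apply: rhoP => //; apply: d_gt0; have [] := x_min k.
Qed.

End minimizing_sequence.

Section half_space_exhaustion.
Variables (R : realType) (n : nat).
Implicit Types nu eta : 'rV[R]_n.

Lemma truncated_half_spaceS nu i j : (i <= j)%N ->
  truncated_half_space nu i `<=` truncated_half_space nu j.
Proof.
move=> ij eta [eta_i eta_nu]; split; first by apply: le_trans eta_i _; rewrite ler_nat.
by apply: le_trans eta_nu _; rewrite lerN2 lerD2l lef_pV2 ?posrE// ler_nat ltnS.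
Qed.

Lemma bigcup_truncated_half_space nu :
  [set eta | dotv eta nu < -1] `<=` \bigcup_j truncated_half_space nu j.
Proof.
move=> eta /= eta_nu; pose t := - 1 - dotv eta nu.
have t0 : 0 < t by rewrite subr_gt0.
pose j := maxn (Num.truncn (enorm eta)).+1 (Num.truncn t^-1).+1.
have enorm_j : enorm eta <= j%:R.
  by apply: ltW; apply: lt_le_trans (truncnS_gt _) _; rewrite ler_nat leq_maxl.
have jt : j.+1%:R^-1 <= t.
  rewrite -[leRHS]invrK lef_pV2 ?posrE ?invr_gt0//.
  by apply: ltW; apply: lt_le_trans (truncnS_gt _) _; rewrite ler_nat (leqW (leq_maxr _ _)).
exists j => //; split=> //.
by move: jt; rewrite /t; move: (dotv eta nu) (j.+1%:R^-1) => a b; lra.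
Qed.

Lemma closed_half_space_closure nu :
  [set eta | dotv eta nu <= -1] `<=` closure [set eta | dotv eta nu < -1].
Proof.
move=> eta /= eta_nu U /nbhs_ballP[r /= r0 rU].
pose t := r / (`|eta| + 1); have E1 : 0 < `|eta| + 1 by rewrite ltr_wpDl.
have t0 : 0 < t by rewrite divr_gt0.
exists ((1 + t) *: eta); split; first by rewrite /= dotvZl; nra.
apply: rU; rewrite mx_norm_ball /ball_/=.
rewrite scalerDl scale1r opprD addrA subrr sub0r normrN normrZ gtr0_norm//.
by rewrite /t mulrAC ltr_pdivrMr// ltr_pM2l// ltrDl.
Qed.

Lemma lambda_half_space_le (p L : R) nu : (0 < n)%N -> 1 <= p -> n%:R < p ->
  enorm nu = 1 -> cap_le p L 0 [set eta | dotv eta nu <= -1] ->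
  (lambda p (half_space R n) <= L%:E)%E.
Proof.
move=> n0 p1 np nu1 capL; have pn : 0 <= p - n%:R by rewrite subr_ge0 ltW.
have ln : (n.-1 < n)%N by rewrite prednK.
pose l := Ordinal ln; have lS : l.+1 = n by rewrite /= prednK.
pose a : 'rV[R]_n := delta_mx 0 l; have half_spaceP := @half_spaceE R n l lS.
have [Q QQ aQ] : exists2 Q : 'M[R]_n, Q *m Q^T = 1%:M & a *m Q = nu.
  by apply: orthogonal_exchange; rewrite enorm_delta nu1.
have half_space0 : ~ half_space R n 0 by rewrite half_spaceP /= mxE ltxx.
have half_space_a : half_space R n a by rewrite half_spaceP /= mxE !eqxx ltr01.
have da0 : 0 < dist_compl (half_space R n) a.
  by apply: dist_compl_gt0 half_space_a; [exact: open_half_space lS|exists 0].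
have da1 : dist_compl (half_space R n) a <= 1.
  by apply: le_trans (dist_compl_le a half_space0) _; rewrite subr0 enorm_delta.
have capa : cap_le p L a (~` half_space R n).
  have cap0 : cap_le p L (1 *: (a *m Q) + - nu) [set eta | dotv eta nu <= -1].
    by rewrite scale1r aQ subrr.
  have := cap_le_affine p1 ltr01 QQ cap0; rewrite powR1 mul1r; apply: cap_leS => z.
  rewrite half_spaceP /= => /negP; rewrite -leNgt scale1r dotvDl dotvNl dotvv nu1 expr1n.
  by rewrite -[in dotv _ nu]aQ dotv_mulmx// dotv_delta gerDr.
apply: le_trans (lambda_le p1 half_space_a da0 capa) _.
rewrite lee_fin ler_piMl ?(cap_le_ge0 capL)//.
apply: (@le_trans _ _ (1 `^ (p - n%:R))); last by rewrite powR1.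
by apply: ge0_ler_powR; rewrite ?nnegrE ?(ltW da0).
Qed.

End half_space_exhaustion.

Lemma boundary_concentration (R : realType) (n : nat) (p L : R) (Omega : set 'rV[R]_n)
    (x_ : nat -> 'rV[R]_n) (x0 : 'rV[R]_n) : (0 < n)%N -> 2 <= p -> n%:R < p -> open Omega ->
  C1_domain Omega -> minimizing p L Omega x_ -> x_ k @[k --> \oo] --> x0 -> ~ Omega x0 ->
  (lambda p (half_space R n) <= L%:E)%E.
Proof.
move=> n0 p2 np oO CO x_min x_cvg Ox0; have p1 : 1 <= p by apply: le_trans p2; rewrite ler1n.
have [nu nu1 nuP] := blowup_truncated_half_space p2 oO (ex_intro _ x0 Ox0) x_min x_cvg CO Ox0.
apply: (lambda_half_space_le n0 p1 np nu1).
apply: cap_leS (@closed_half_space_closure R n nu) _; apply: cap_le_closure.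
apply: cap_leS (@bigcup_truncated_half_space R n nu) _.
exact: cap_le_bigcup p2 np (@truncated_half_spaceS R n nu) nuP.
Qed.

Lemma bounded_set_setC_neq0 (R : realType) (n : nat) (A : set 'rV[R]_n) : (0 < n)%N ->
  bounded_set A -> ~` A !=set0.
Proof.
move=> n0 /pinfty_ex_gt0[B B0 AB]; exists (const_mx (B + 1)) => /AB xB.
have := le_trans (norm_coord_le _ (Ordinal n0)) xB; rewrite mxE.
by rewrite ger0_norm ?addr_ge0 ?(ltW B0)// leNgt ltrDl ltr01.
Qed.

Theorem theoremC (R : realType) (n : nat) (hn : (2 <= n)%N)
    (p : R) (hp : n%:R < p) (Omega : set 'rV[R]_n)
    (Omega_neq0 : Omega !=set0) (Omega_bounded : bounded_set Omega)
    (Omega_open : open Omega) (Omega_C1 : C1_domain Omega)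
    (hlambda : (lambda p Omega < lambda p (half_space R n))%E) :
  exists u : 'rV[R]_n -> R, extremal p Omega u.
Proof.
have n0 : (0 < n)%N by exact: leq_trans hn.
have p2 : 2 <= p by apply: le_trans (ltW hp); rewrite ler_nat.
have coOmega_neq0 := bounded_set_setC_neq0 n0 Omega_bounded.
have lambda_fin : lambda p Omega \is a fin_num.
  by rewrite ge0_fin_numE ?lambda_ge0// (lt_le_trans hlambda)// leey.
have lambdaE := esym (fineK lambda_fin).
have [x0 [x_ [x_min x_cvg]]] :=
  cvg_minimizing_sequence p2 Omega_open coOmega_neq0 lambdaE Omega_bounded.
have [Ox0|Ox0] := pselect (Omega x0).
  exact: (interior_extremal p2 hp Omega_open coOmega_neq0 lambdaE x_min x_cvg).
have := boundary_concentration n0 p2 hp Omega_open Omega_C1 x_min x_cvg Ox0.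
by rewrite -lambdaE leNgt hlambda.
Qed.
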